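(* Let $u_0\in L^1(\mathbb{R})$ and let $v_0=u_0^*$ (focusing case) or $v_0=-u_0^*$ (defocusing case), where $^*$ denotes complex conjugation. Let $\Phi^{\mathrm{up}},\bar\Phi^{\mathrm{up}},\Psi^{\mathrm{dn}},\Psi^{\mathrm{up}}$ and the reflection coefficient from the right $R(\lambda)$ be defined from $u_0,v_0$ as in the context, and let $\rho$ be the inverse Fourier transform of $R$, $$\rho(\alpha)=\frac{1}{2\pi}\int_{-\infty}^{+\infty}R(\lambda)e^{i\lambda\alpha}\,d\lambda .$$ Then the function $\rho(\alpha)$ is the unique solution of each of the following Fredholm integral equations of the second kind: $$\rho(\alpha)+\int_0^\infty \Phi^{\mathrm{up}}(z)\,\rho(z+\alpha)\,dz=-\tfrac12 v_0\!\left(\tfrac{\alpha}{2}\right)-\bar\Phi^{\mathrm{up}}(\alpha),$$ $$\rho(\alpha)+\int_0^\infty \Psi^{\mathrm{dn}}(z)\,\rho(z+\alpha)\,dz=-\tfrac12 v_0\!\left(\tfrac{\alpha}{2}\right)-\Psi^{\mathrm{up}}(\alpha).$$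
   Context: Setting: the Zakharov-Shabat system $i\mathbf{J}\,\partial_x\Psi-\mathbf{V}\Psi=\lambda\Psi$, $x\in\mathbb{R}$, with spectral parameter $\lambda$, $\mathbf{J}=\mathrm{diag}(1,-1)$ and $\mathbf{V}=i\begin{pmatrix}0&u_0\\ v_0&0\end{pmatrix}$, associated to the initial value problem for the nonlinear Schrödinger equation with initial potential $u_0$. Auxiliary functions. For $y\ge x$, the pairs $(\bar K^{\mathrm{up}},\bar K^{\mathrm{dn}})$ and $(K^{\mathrm{up}},K^{\mathrm{dn}})$ are the solutions of the Volterra systems $$\bar K^{\mathrm{up}}(x,y)+\int_x^\infty u_0(z)\bar K^{\mathrm{dn}}(z,z+y-x)\,dz=0,$$ $$\bar K^{\mathrm{dn}}(x,y)-\int_x^{\frac12(x+y)}v_0(z)\bar K^{\mathrm{up}}(z,x+y-z)\,dz=\tfrac12 v_0(\tfrac12(x+y)),$$ and $$K^{\mathrm{up}}(x,y)+\int_x^{\frac12(x+y)}u_0(z)K^{\mathrm{dn}}(z,x+y-z)\,dz=-\tfrac12u_0(\tfrac12(x+y)),$$ $$K^{\mathrm{dn}}(x,y)-\int_x^\infty v_0(z)K^{\mathrm{up}}(z,z+y-x)\,dz=0.$$ For $y\le x$, the pair $(M^{\mathrm{up}},M^{\mathrm{dn}})$ is the solution of $$M^{\mathrm{up}}(x,y)-\int_{-\infty}^xu_0(z)M^{\mathrm{dn}}(z,z+y-x)\,dz=0,$$ $$M^{\mathrm{dn}}(x,y)+\int_{\frac12(x+y)}^xv_0(z)M^{\mathrm{up}}(z,x+y-z)\,dz=-\tfrac12v_0(\tfrac12(x+y)).$$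 Derived functions: $$\Phi^{\mathrm{up}}(z)=\int_{\mathbb{R}}v_0(y)K^{\mathrm{up}}(y,y+z)\,dy,\qquad \bar\Phi^{\mathrm{up}}(z)=\int_{-\infty}^{z/2}v_0(y)\bar K^{\mathrm{up}}(y,z-y)\,dy,$$ $$\Psi^{\mathrm{dn}}(z)=\int_{\mathbb{R}}u_0(y)M^{\mathrm{dn}}(y,y-z)\,dy,\qquad \Psi^{\mathrm{up}}(z)=\int_{z/2}^{+\infty}v_0(y)M^{\mathrm{up}}(y,z-y)\,dy.$$ Entries of the transition matrices from the left and from the right: $$a_{\ell4}(\lambda)=1+\int_{\mathbb{R}^+} e^{i\lambda z}\Phi^{\mathrm{up}}(z)\,dz,\qquad a_{\ell3}(\lambda)=\int_{\mathbb{R}}e^{-2i\lambda y}v_0(y)\,dy+\int_{\mathbb{R}}e^{-i\lambda z}\bar\Phi^{\mathrm{up}}(z)\,dz,$$ $$a_{r1}(\lambda)=1+\int_{\mathbb{R}^+} e^{i\lambda z}\Psi^{\mathrm{dn}}(z)\,dz,\qquad a_{r3}(\lambda)=-\int_{\mathbb{R}}e^{-2i\lambda y}v_0(y)\,dy-\int_{\mathbb{R}}e^{-i\lambda z}\Psi^{\mathrm{up}}(z)\,dz.$$ The reflection coefficient from the right is $$R(\lambda)=\frac{a_{r3}(\lambda)}{a_{r1}(\lambda)}=-\frac{a_{\ell3}(\lambda)}{a_{\ell4}(\lambda)}.$$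
   Formalization: In the focusing case a_r1(λ)≠0 for all real λ is assumed, since otherwise R has a real singularity and ρ is undefined (e.g. a box potential of area π/2); the integral for ρ is taken in the Abel sense, the equations hold a.e., and uniqueness is in L¹(ℝ). *)

(* Defs.v *)
From HB Require Import structures.
From mathcomp Require Import all_boot all_order all_algebra.
From mathcomp Require Import all_classical all_reals all_analysis.
From mathcomp Require Import complex.

Set Implicit Arguments.
Unset Strict Implicit.
Unset Printing Implicit Defensive.

Import Order.TTheory GRing.Theory Num.Theory.
Import numFieldNormedType.Exports.

Local Open Scope classical_set_scope.
Local Open Scope ring_scope.
Local Open Scope complex_scope.

(** The library integrates real-valued functions only: complex-valued functions
    are measured and integrated through their real and imaginary parts. *)
Section ComplexLebesgue.
Context {R : realType}.
Notation mu := (@lebesgue_measure R).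

Definition Cmeasurable d (T : measurableType d) (D : set T) (f : T -> R[i]) :
  Prop :=
  measurable_fun D (fun t => complex.Re (f t)) /\
  measurable_fun D (fun t => complex.Im (f t)).

Definition Cintegrable (D : set R) (f : R -> R[i]) : Prop :=
  mu.-integrable D (fun x => (complex.Re (f x))%:E) /\
  mu.-integrable D (fun x => (complex.Im (f x))%:E).

Definition Cintegral (D : set R) (f : R -> R[i]) : R[i] :=
  (\int[mu]_(x in D) complex.Re (f x)) +i* (\int[mu]_(x in D) complex.Im (f x)).

Definition expi (t : R) : R[i] := cos t +i* sin t.

Definition AbelFourier (f : R -> R[i]) (alpha eps : R) : R[i] :=
  ((2 * pi)^-1)%:C *
  Cintegral setT (fun lambda =>
    f lambda * expi (lambda * alpha) * (expR (- (eps * `|lambda|)))%:C).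

(** The inverse Fourier integral is understood in the sense of Abel: a
    reflection coefficient is bounded and continuous but in general neither
    integrable nor square integrable.  On integrable [f] this is the Lebesgue
    integral [(2 pi)^-1 * \int f(lambda) e^(i lambda alpha)], by dominated
    convergence. *)
Definition inverse_fourier (f : R -> R[i]) (alpha : R) : R[i] :=
  lim (complex.Re (AbelFourier f alpha eps) @[eps --> 0^'+]) +i*
  lim (complex.Im (AbelFourier f alpha eps) @[eps --> 0^'+]).

End ComplexLebesgue.

Section ZakharovShabat.
Context {R : realType}.
Notation mu := (@lebesgue_measure R).

(** For integrable potentials the Volterra systems are uniquely solvable in the
    class of kernels [K] with [K x] in [L^1] of the half-line [S x], uniformly
    in [x]; the iterated integrals converge only almost everywhere, so the
    equations are required for almost all [(x, y)].  Only the values [K x y]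
    with [y] in [S x] matter. *)
Definition Volterra_kernel (S : R -> set R) (K : R -> R -> R[i]) : Prop :=
  Cmeasurable [set p : measurableTypeR R * measurableTypeR R | S p.1 p.2]
    (fun p => K p.1 p.2) /\
  exists C : R, {ae mu, forall x,
    (\int[mu]_(y in S x) (Normc.normc (K x y))%:E <= C%:E)%E}.

Definition half_right (x : R) : set R := `[x, +oo[.
Definition half_left (x : R) : set R := `]-oo, x].

Definition Kbar_solution (u0 v0 : R -> R[i]) (Kup Kdn : R -> R -> R[i]) :
  Prop :=
  [/\ Volterra_kernel half_right Kup, Volterra_kernel half_right Kdn &
   {ae mu, forall x, {ae mu, forall y, x <= y ->
     Kup x y + Cintegral `[x, +oo[ (fun z => u0 z * Kdn z (z + y - x)) = 0 /\
     Kdn x y - Cintegral `[x, (x + y) / 2] (fun z => v0 z * Kup z (x + y - z))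
       = 2^-1 * v0 ((x + y) / 2)}}].

Definition K_solution (u0 v0 : R -> R[i]) (Kup Kdn : R -> R -> R[i]) :
  Prop :=
  [/\ Volterra_kernel half_right Kup, Volterra_kernel half_right Kdn &
   {ae mu, forall x, {ae mu, forall y, x <= y ->
     Kup x y + Cintegral `[x, (x + y) / 2] (fun z => u0 z * Kdn z (x + y - z))
       = - (2^-1 * u0 ((x + y) / 2)) /\
     Kdn x y - Cintegral `[x, +oo[ (fun z => v0 z * Kup z (z + y - x)) = 0}}].

Definition M_solution (u0 v0 : R -> R[i]) (Mup Mdn : R -> R -> R[i]) :
  Prop :=
  [/\ Volterra_kernel half_left Mup, Volterra_kernel half_left Mdn &
   {ae mu, forall x, {ae mu, forall y, y <= x ->
     Mup x y - Cintegral `]-oo, x] (fun z => u0 z * Mdn z (z + y - x)) = 0 /\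
     Mdn x y + Cintegral `[(x + y) / 2, x] (fun z => v0 z * Mup z (x + y - z))
       = - (2^-1 * v0 ((x + y) / 2))}}].

Definition Phi_up (v0 : R -> R[i]) (Kup : R -> R -> R[i]) (z : R) : R[i] :=
  Cintegral setT (fun y => v0 y * Kup y (y + z)).

Definition Phibar_up (v0 : R -> R[i]) (Kbarup : R -> R -> R[i]) (z : R) : R[i] :=
  Cintegral `]-oo, z / 2] (fun y => v0 y * Kbarup y (z - y)).

Definition Psi_dn (u0 : R -> R[i]) (Mdn : R -> R -> R[i]) (z : R) : R[i] :=
  Cintegral setT (fun y => u0 y * Mdn y (y - z)).

Definition Psi_up (v0 : R -> R[i]) (Mup : R -> R -> R[i]) (z : R) : R[i] :=
  Cintegral `[z / 2, +oo[ (fun y => v0 y * Mup y (z - y)).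

Definition a_r1 (u0 : R -> R[i]) (Mdn : R -> R -> R[i]) (lambda : R) :
  R[i] :=
  1 + Cintegral `[0, +oo[ (fun z => expi (lambda * z) * Psi_dn u0 Mdn z).

Definition a_r3 (v0 : R -> R[i]) (Mup : R -> R -> R[i]) (lambda : R) :
  R[i] :=
  - Cintegral setT (fun y => expi (- 2 * lambda * y) * v0 y)
  - Cintegral setT (fun z => expi (- (lambda * z)) * Psi_up v0 Mup z).

Definition reflection_right (u0 v0 : R -> R[i]) (Mup Mdn : R -> R -> R[i])
  (lambda : R) : R[i] :=
  a_r3 v0 Mup lambda / a_r1 u0 Mdn lambda.

Definition Fredholm_solution (k g f : R -> R[i]) : Prop :=
  Cintegrable setT f /\
  {ae mu, forall alpha,
    f alpha + Cintegral `[0, +oo[ (fun z => k z * f (z + alpha)) = g alpha}.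

(** Uniqueness is in [L^1]: an exponential [e^(i lambda alpha)] with [lambda] a
    zero of [1 + \int_0^oo k(z) e^(i lambda z) dz] (a discrete eigenvalue) is a
    locally integrable solution of the homogeneous equation. *)
Definition unique_Fredholm_solution (k g f : R -> R[i]) : Prop :=
  Fredholm_solution k g f /\
  forall h, Fredholm_solution k g h -> {ae mu, forall alpha, h alpha = f alpha}.

End ZakharovShabat.

(* Main.v *)
(** Only the scattering data of [M] enter [R]. For fixed [lambda], the Fourier
    transforms in [y] of the kernels [K], [Kbar] and [M] solve first-order linear
    systems, that is, they are Jost solutions, and constancy of their Wronskians gives
    [a_l4 = a_r1], [a_l3 = - a_r3] and, in the defocusing case,
    [|a_r1|^2 = 1 + |a_r3|^2 > 0].  Writing [kt x = k (- x)] on the left half-line, each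
    Fredholm equation reads [f + kt * f = g] with [1 + FT kt = a_r1] and
    [FT g = a_r3] for both choices of [(k, g)].  By Wiener's lemma [1 / a_r1] is again a
    constant plus the Fourier transform of an integrable function, so that [R] is the
    Fourier transform of an integrable [rho0]; Fourier inversion in the sense of Abel
    gives [rho = rho0] almost everywhere, and injectivity of the Fourier transform gives
    both the equation and the uniqueness. *)

Require Import Defs.
From HB Require Import structures.
From mathcomp Require Import all_boot all_order all_algebra.
From mathcomp Require Import all_classical all_reals all_analysis.
From mathcomp Require Import complex measurable_realfun ring lra.

Set Implicit Arguments.
Unset Strict Implicit.
Unset Printing Implicit Defensive.

Import Order.TTheory GRing.Theory Num.Theory.
Import numFieldNormedType.Exports.
Local Open Scope classical_set_scope.
Local Open Scope ring_scope.
Local Open Scope complex_scope.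

(** Wiener's lemma is proved without Gelfand theory. With [F = 1 + FT f] and [c > 0] small,
    [1 / F = c conj F / (1 - (1 - c |F|^2))], where [1 - c |F|^2] lies in [[0, 1)] and stays away
    from 1 because [F] is bounded away from 0. The Neumann series has to converge in the algebra and
    not merely uniformly: the growth rate of the algebra norms of the powers must be governed by the
    sup norm. This is checked on functions with compact support and integrable transform, and passes
    to the rest by density and the binomial formula. The Abel limit defining [rho] may fail to exist
    on a null set, so its measurability is a question of its own, settled by a Cauchy criterion over
    the rationals. The three Volterra systems are brought to one form, by exchanging components for
    [K], by a sign change for [Kbar] and by [x -> - x] for [M]. Their transforms satisfy
    tail-integral equations almost everywhere only, so the Wronskian arguments are integrations by
    parts for tails, done by Fubini and not by differentiation. *)

Notation normc := Normc.normc.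
Notation Re := complex.Re.
Notation Im := complex.Im.

(** * Modulus, conjugation and unimodular exponentials *)

Section ComplexNorm.
Context {R : realType}.
Implicit Types z w : R[i].

Lemma cReD z w : Re (z + w) = Re z + Re w. Proof. by case: z; case: w. Qed.
Lemma cImD z w : Im (z + w) = Im z + Im w. Proof. by case: z; case: w. Qed.
Lemma cReN z : Re (- z) = - Re z. Proof. by case: z. Qed.
Lemma cImN z : Im (- z) = - Im z. Proof. by case: z. Qed.
Lemma cReM z w : Re (z * w) = Re z * Re w - Im z * Im w.
Proof. by case: z; case: w. Qed.
Lemma cImM z w : Im (z * w) = Re z * Im w + Im z * Re w.
Proof. by case: z; case: w. Qed.
Lemma cReC (x : R) : Re x%:C = x. Proof. by []. Qed.
Lemma cImC (x : R) : Im x%:C = 0. Proof. by []. Qed.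
Lemma Re_conjc z : Re (conjc z) = Re z. Proof. by case: z. Qed.
Lemma Im_conjc z : Im (conjc z) = - Im z. Proof. by case: z. Qed.
Lemma complexP z w : Re z = Re w -> Im z = Im w -> z = w.
Proof. by case: z => a b; case: w => c d /= -> ->. Qed.

Lemma normcE z : normc z = Num.sqrt (Re z ^+ 2 + Im z ^+ 2).
Proof. by case: z. Qed.

Lemma normc_ge0 z : 0 <= normc z. Proof. by rewrite normcE sqrtr_ge0. Qed.

Lemma normc_eq0 z : (normc z == 0) = (z == 0).
Proof.
by apply/eqP/eqP => [/Normc.eq0_normc//|->]; rewrite Normc.normc0.
Qed.

Lemma le_Re_normc z : `|Re z| <= normc z.
Proof. by rewrite normcE -sqrtr_sqr ler_wsqrtr// lerDl sqr_ge0. Qed.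

Lemma le_Im_normc z : `|Im z| <= normc z.
Proof. by rewrite normcE -sqrtr_sqr ler_wsqrtr// lerDr sqr_ge0. Qed.

Lemma normc_real (x : R) : normc x%:C = `|x|.
Proof. by rewrite normcE/= expr0n addr0 sqrtr_sqr. Qed.

Lemma normc_conj z : normc (conjc z) = normc z.
Proof. by rewrite !normcE Re_conjc Im_conjc sqrrN. Qed.

Lemma normc_leD z w : normc (z + w) <= normc z + normc w.
Proof. exact: le_normcD. Qed.

Lemma normcN z : normc (- z) = normc z.
Proof. by rewrite !normcE cReN cImN !sqrrN. Qed.

Lemma normc_leB z w : normc (z - w) <= normc z + normc w.
Proof. by rewrite -[normc w]normcN normc_leD. Qed.

Lemma normcX z n : normc (z ^+ n) = normc z ^+ n.
Proof.
elim: n => [|n IH]; first by rewrite !expr0 Normc.normc1.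
by rewrite !exprS Normc.normcM IH.
Qed.

Lemma normc_le_ReIm z : normc z <= `|Re z| + `|Im z|.
Proof.
have e : z = (Re z)%:C + (0 +i* Im z).
  by apply: complexP; rewrite ?cReD ?cImD ?addr0 ?add0r.
rewrite {1}e (le_trans (normc_leD _ _))// normc_real lerD2l.
by rewrite normcE/= expr0n add0r sqrtr_sqr.
Qed.

Lemma sqr_normc z : normc z ^+ 2 = Re z ^+ 2 + Im z ^+ 2.
Proof. by rewrite normcE sqr_sqrtr// addr_ge0// sqr_ge0. Qed.

Lemma mul_conjc z : z * conjc z = (normc z ^+ 2)%:C.
Proof.
apply: complexP; rewrite ?cReM ?cImM Re_conjc Im_conjc ?cReC ?cImC ?sqr_normc; ring.
Qed.

Lemma expiD (s t : R) : expi (s + t) = expi s * expi t.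
Proof. by apply: complexP; rewrite ?cReM ?cImM/= ?cosD ?sinD//; ring. Qed.

Lemma conj_expi (t : R) : conjc (expi t) = expi (- t).
Proof. by rewrite /expi/= cosN sinN. Qed.

Lemma normc_expi (t : R) : normc (expi t) = 1.
Proof. by rewrite normcE/= cos2Dsin2 sqrtr1. Qed.

End ComplexNorm.

(** * Measurability of complex-valued functions *)

Section CMeasurable.
Context {R : realType} d (T : measurableType d).
Implicit Types f g : T -> R[i].
Local Notation Cm := (@Cmeasurable R d T setT).

Lemma Cmeasurable_cst (c : R[i]) : Cm (fun=> c).
Proof. by split; exact: measurable_cst. Qed.

Lemma CmeasurableD f g : Cm f -> Cm g -> Cm (fun x => f x + g x).
Proof.
move=> [f1 f2] [g1 g2]; split.
  by under eq_fun do rewrite cReD; exact: measurable_funD.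
by under eq_fun do rewrite cImD; exact: measurable_funD.
Qed.

Lemma CmeasurableN f : Cm f -> Cm (fun x => - f x).
Proof.
move=> [f1 f2]; split.
  by under eq_fun do rewrite cReN; exact: measurableT_comp.
by under eq_fun do rewrite cImN; exact: measurableT_comp.
Qed.

Lemma CmeasurableB f g : Cm f -> Cm g -> Cm (fun x => f x - g x).
Proof. by move=> mf mg; apply: CmeasurableD => //; exact: CmeasurableN. Qed.

Lemma CmeasurableM f g : Cm f -> Cm g -> Cm (fun x => f x * g x).
Proof.
move=> [f1 f2] [g1 g2]; split.
  by under eq_fun do rewrite cReM; apply: measurable_funB; exact: measurable_funM.
by under eq_fun do rewrite cImM; apply: measurable_funD; exact: measurable_funM.
Qed.

Lemma Cmeasurable_conj f : Cm f -> Cm (fun x => conjc (f x)).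
Proof.
move=> [f1 f2]; split; first by under eq_fun do rewrite Re_conjc.
by under eq_fun do rewrite Im_conjc; exact: measurableT_comp.
Qed.

Lemma Cmeasurable_real (f : T -> R) : measurable_fun setT f ->
  Cm (fun x => (f x)%:C).
Proof. by move=> mf; split => //=; exact: measurable_cst. Qed.

Lemma measurable_normc f : Cm f -> measurable_fun setT (fun x => normc (f x)).
Proof.
move=> [f1 f2]; under eq_fun do rewrite normcE.
apply: (@measurableT_comp _ _ _ _ _ _ (@Num.sqrt R)) => //.
  exact: continuous_measurable_fun (@sqrt_continuous R).
by apply: measurable_funD; exact: measurable_funX.
Qed.

Lemma Cmeasurable_expi (f : T -> R) : measurable_fun setT f ->
  Cm (fun x => expi (f x)).
Proof.
move=> mf; split => /=.
  by apply: measurableT_comp => //; apply: continuous_measurable_fun; exact: continuous_cos.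
by apply: measurableT_comp => //; apply: continuous_measurable_fun; exact: continuous_sin.
Qed.

Lemma Cmeasurable_comp d' (T' : measurableType d') (h : T' -> T) f :
  measurable_fun setT h -> Cm f -> @Cmeasurable R d' T' setT (fun x => f (h x)).
Proof.
by move=> mh [f1 f2]; split; [exact: measurableT_comp f1 mh|
  exact: measurableT_comp f2 mh].
Qed.

(** A complex factor, so that an integral over a set becomes an integral over the whole line
    ([Cintegral_ind]) and all later estimates concern one domain. *)
Definition Cind (D : set T) (x : T) : R[i] := (\1_D x)%:C.

Lemma Cmeasurable_ind D : measurable D -> Cm (Cind D).
Proof. by move=> mD; apply: Cmeasurable_real; exact: measurable_indic. Qed.

Lemma normc_ind_le D x : normc (Cind D x) <= 1.
Proof. by rewrite normc_real indicE; case: (_ \in _); rewrite ?normr1 ?normr0. Qed.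

Lemma CindT D x : D x -> Cind D x = 1.
Proof. by move=> Dx; rewrite /Cind indicE mem_set. Qed.

Lemma CindF D x : ~ D x -> Cind D x = 0.
Proof. by move=> Dx; rewrite /Cind indicE memNset. Qed.

Lemma Cmeasurable_restrict D f : measurable D -> Cmeasurable D f ->
  Cm (fun x => Cind D x * f x).
Proof.
have e (g : T -> R) : (fun x => \1_D x * g x) = g \_ D.
  apply/funext => x; rewrite patchE indicE; case: (_ \in _);
  by rewrite ?mul1r ?mul0r.
move=> mD [f1 f2]; split.
- under eq_fun do rewrite cReM cReC cImC mul0r subr0.
  by rewrite e; exact/(measurable_restrictT _ _).1.
- under eq_fun do rewrite cImM cReC cImC mul0r addr0.
  by rewrite e; exact/(measurable_restrictT _ _).1.
Qed.

End CMeasurable.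

(** * Almost-everywhere statements on the line *)

Section AlmostEverywhere.
Context {R : realType}.
Notation mu := (@lebesgue_measure R).
Implicit Types P Q : R -> Prop.

Lemma ae_imp P Q : (forall x, P x -> Q x) ->
  {ae mu, forall x, P x} -> {ae mu, forall x, Q x}.
Proof. exact: (@filterS _ _ (ae_filter_ringOfSetsType mu)). Qed.

Lemma ae_imp2 P Q (S : R -> Prop) : (forall x, P x -> Q x -> S x) ->
  {ae mu, forall x, P x} -> {ae mu, forall x, Q x} -> {ae mu, forall x, S x}.
Proof. exact: (@filterS2 _ _ (ae_filter_ringOfSetsType mu)). Qed.

Lemma ae_all P : (forall x, P x) -> {ae mu, forall x, P x}.
Proof. exact: (@nearW _ _ _ (ae_filter_ringOfSetsType mu)). Qed.

End AlmostEverywhere.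

(** * Complex-valued Lebesgue integration *)

Section CIntegration.
Context {R : realType}.
Notation mu := (@lebesgue_measure R).
Notation TR := (measurableTypeR R).
Implicit Types f g : R -> R[i].

Definition L1 f := Cintegrable setT f.
Definition CI f := Cintegral setT f.
Definition L1norm f : \bar R := (\int[mu]_x (normc (f x))%:E)%E.
Notation Cm f := (@Cmeasurable R _ TR setT f).

Lemma L1_measurable f : L1 f -> Cm f.
Proof.
by move=> [f1 f2]; split; apply/measurable_EFinP;
  [exact: measurable_int f1|exact: measurable_int f2].
Qed.

Lemma L1norm_ge0 f : (0 <= L1norm f)%E.
Proof. by apply: integral_ge0 => x _; rewrite lee_fin normc_ge0. Qed.

Lemma L1_norm f : L1 f -> mu.-integrable setT (fun x => (normc (f x))%:E).
Proof.
move=> L; have mf := L1_measurable L; case: L => f1 f2.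
have i1 := integrable_norm f1; have i2 := integrable_norm f2.
have := integrableD measurableT i1 i2.
apply: le_integrable => //.
  by apply/measurable_EFinP; exact: measurable_normc.
move=> x _ /=; rewrite lee_fin ger0_norm ?normc_ge0// ger0_norm ?addr_ge0//.
exact: normc_le_ReIm.
Qed.

Lemma le_L1 f (g : R -> R) : Cm f -> (forall x, normc (f x) <= g x) ->
  mu.-integrable setT (EFin \o g) -> L1 f.
Proof.
move=> [m1 m2] fg ig; split; apply: le_integrable ig => //.
- exact/measurable_EFinP.
- move=> x _ /=; rewrite lee_fin (le_trans (le_Re_normc _))//.
  by rewrite (le_trans (fg _))// ler_norm.
- exact/measurable_EFinP.
- move=> x _ /=; rewrite lee_fin (le_trans (le_Im_normc _))//.
  by rewrite (le_trans (fg _))// ler_norm.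
Qed.

Lemma L1P f : L1 f <-> Cm f /\ (L1norm f < +oo)%E.
Proof.
split=> [L|[mf foo]].
  split; first exact: L1_measurable.
  have /integrableP[_] := L1_norm L; apply: le_lt_trans.
  by apply: eq_ge_integral || by under [leRHS]eq_integral do
    rewrite gee0_abs ?lee_fin ?normc_ge0//.
apply: (le_L1 mf (fun x => lexx _)); apply/integrableP; split.
  by apply/measurable_EFinP; exact: measurable_normc.
by under eq_integral do rewrite gee0_abs ?lee_fin ?normc_ge0//.
Qed.

Lemma L1norm_fin f : L1 f -> (L1norm f < +oo)%E.
Proof. by case/L1P. Qed.

Lemma le_L1c f g : Cm f -> (forall x, normc (f x) <= normc (g x)) -> L1 g -> L1 f.
Proof. by move=> mf fg /L1_norm; exact: le_L1. Qed.

Lemma L10 : L1 (fun=> 0).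
Proof. by split; exact: integrable0. Qed.

Lemma L1D f g : L1 f -> L1 g -> L1 (fun x => f x + g x).
Proof.
move=> [f1 f2] [g1 g2]; split.
  have := integrableD measurableT f1 g1; apply: eq_integrable => // x _ /=.
  by rewrite cReD EFinD.
have := integrableD measurableT f2 g2; apply: eq_integrable => // x _ /=.
by rewrite cImD EFinD.
Qed.

Lemma L1N f : L1 f -> L1 (fun x => - f x).
Proof.
move=> [f1 f2]; split.
  have := integrableN f1; apply: eq_integrable => // x _ /=; by rewrite cReN EFinN.
by have := integrableN f2; apply: eq_integrable => // x _ /=; rewrite cImN EFinN.
Qed.

Lemma L1B f g : L1 f -> L1 g -> L1 (fun x => f x - g x).
Proof. by move=> Lf Lg; apply: L1D => //; exact: L1N. Qed.

Lemma L1_bounded (b : R -> R[i]) f (M : R) : Cm b ->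
  (forall x, normc (b x) <= M) -> L1 f -> L1 (fun x => b x * f x).
Proof.
move=> mb bM Lf; apply: (@le_L1 _ (fun x => M * normc (f x))).
- by apply: CmeasurableM => //; exact: L1_measurable.
- by move=> x; rewrite Normc.normcM ler_wpM2r ?normc_ge0.
- by have := integrableZl measurableT M (L1_norm Lf); apply: eq_integrable.
Qed.

Lemma L1Zl (c : R[i]) f : L1 f -> L1 (fun x => c * f x).
Proof.
exact: (L1_bounded (Cmeasurable_cst _ _) (fun=> lexx (normc c))).
Qed.

Lemma L1_conj f : L1 f -> L1 (fun x => conjc (f x)).
Proof.
move=> Lf; apply: (le_L1c _ _ Lf) => [|x]; last by rewrite normc_conj.
by apply: Cmeasurable_conj; exact: L1_measurable.
Qed.

Lemma L1_ind (D : set R) f : measurable D -> L1 f -> L1 (fun x => Cind D x * f x).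
Proof.
move=> mD; apply: (@L1_bounded _ _ 1); first exact: Cmeasurable_ind.
exact: normc_ind_le.
Qed.

Lemma CID f g : L1 f -> L1 g -> CI (fun x => f x + g x) = CI f + CI g.
Proof.
move=> [f1 f2] [g1 g2]; apply: complexP; rewrite ?cReD ?cImD/=.
  by under eq_Rintegral do rewrite cReD; exact: RintegralD.
by under eq_Rintegral do rewrite cImD; exact: RintegralD.
Qed.

Lemma CIZl (c : R[i]) f : L1 f -> CI (fun x => c * f x) = c * CI f.
Proof.
move=> [f1 f2].
have Z (a : R) (h : R -> R) : mu.-integrable setT (EFin \o h) ->
    mu.-integrable setT (EFin \o (fun x => a * h x)).
  by move=> /(integrableZl measurableT a); apply: eq_integrable.
apply: complexP; rewrite ?cReM ?cImM/=.
  under eq_Rintegral do rewrite cReM.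
  by rewrite RintegralB ?RintegralZl//; exact: Z.
under eq_Rintegral do rewrite cImM.
by rewrite RintegralD ?RintegralZl//; exact: Z.
Qed.

(** Negation swaps positive and negative parts; when one of these integrals is infinite, [fine]
    sends both sides to 0. *)
Lemma CIN f : CI (fun x => - f x) = - CI f.
Proof.
have E (h : R -> R) : \int[mu]_x - h x = - \int[mu]_x h x.
  rewrite /Rintegral -fineN; under eq_integral do rewrite EFinN.
  rewrite integralE [in RHS]integralE.
  rewrite (_ : (fun x => - (h x)%:E)%E^\+%E = ((fun x => (h x)%:E)^\-)%E); last exact: funeposN.
  rewrite (_ : (fun x => - (h x)%:E)%E^\-%E = ((fun x => (h x)%:E)^\+)%E); last exact: funenegN.
  case: (integral _ _ _) => [a| |]; case: (integral _ _ _) => [b| |] //=.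
  by rewrite opprB.
apply: complexP; rewrite /CI ?cReN ?cImN/=.
  by rewrite -E; apply: eq_Rintegral => x _; exact: cReN.
by rewrite -E; apply: eq_Rintegral => x _; exact: cImN.
Qed.

Lemma CIB f g : L1 f -> L1 g -> CI (fun x => f x - g x) = CI f - CI g.
Proof. by move=> Lf Lg; rewrite CID ?CIN//; exact: L1N. Qed.

Lemma CIZr (c : R[i]) f : L1 f -> CI (fun x => f x * c) = CI f * c.
Proof. by move=> Lf; under eq_fun do rewrite mulrC; rewrite CIZl// mulrC. Qed.

Lemma CI0 : CI (fun=> 0) = 0.
Proof.
apply: complexP; rewrite /CI/Cintegral/=; rewrite /Rintegral integral0//.
Qed.

Lemma CI_conj f : L1 f -> CI (fun x => conjc (f x)) = conjc (CI f).
Proof.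
move=> [f1 f2]; apply: complexP; rewrite ?Re_conjc ?Im_conjc/=.
  by under eq_Rintegral do rewrite Re_conjc.
under eq_Rintegral do rewrite Im_conjc -mulN1r.
by rewrite RintegralZl// mulN1r.
Qed.

(** With [I] the value of the integral, [|I|^2 = \int Re (conj I * f) <= |I| \int |f|], then divide
    by [|I|]. Estimating real and imaginary parts separately would lose a constant. *)
Lemma normc_CI f : L1 f -> normc (CI f) <= \int[mu]_x normc (f x).
Proof.
move=> Lf; have Nge0 : 0 <= \int[mu]_x normc (f x).
  by apply: Rintegral_ge0 => x _; exact: normc_ge0.
have [->|I0] := eqVneq (CI f) 0; first by rewrite Normc.normc0.
have p : 0 < normc (CI f) by rewrite lt0r normc_eq0 I0 normc_ge0.
rewrite -(ler_pM2l p) -expr2 -RintegralZl//; last exact: L1_norm.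
have Lg := L1Zl (conjc (CI f)) Lf.
have -> : normc (CI f) ^+ 2 = \int[mu]_x Re (conjc (CI f) * f x).
  have := CIZl (conjc (CI f)) Lf; rewrite mulrC mul_conjc => /(congr1 (@complex.Re R)) /=.
  by move=> <-.
apply: le_Rintegral => //; first by case: Lg.
  by have := integrableZl measurableT (normc (CI f)) (L1_norm Lf); apply: eq_integrable.
move=> x _; rewrite (le_trans (ler_norm _))// (le_trans (le_Re_normc _))//.
by rewrite Normc.normcM normc_conj.
Qed.

Lemma L1norm_Rintegral f : L1 f -> L1norm f = (\int[mu]_x normc (f x))%:E.
Proof.
move=> Lf; rewrite /Rintegral fineK// ge0_fin_numE ?L1norm_ge0//.
exact: L1norm_fin.
Qed.

(** Trivial when the norm is infinite; in this form the bound applies to every section of a kernel,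
    although only almost all of them are integrable. *)
Lemma normc_CI_le f : Cm f -> ((normc (CI f))%:E <= L1norm f)%E.
Proof.
move=> mf; have [foo|] := boolP (L1norm f < +oo)%E; last first.
  by rewrite -leNgt leye_eq => /eqP ->; rewrite leey.
have Lf : L1 f by apply/L1P.
by rewrite L1norm_Rintegral// lee_fin; exact: normc_CI.
Qed.

Lemma ae_CI f g : Cm f -> Cm g -> {ae mu, forall x, f x = g x} -> CI f = CI g.
Proof.
move=> [f1 f2] [g1 g2] fg; apply: complexP; rewrite /CI/Cintegral/=; congr fine;
  apply: ae_eq_integral => //; try exact/measurable_EFinP;
  by move: fg; apply: ae_imp => x /= ->.
Qed.

Lemma ae_L1 f g : Cm g -> {ae mu, forall x, f x = g x} -> L1 f -> L1 g.
Proof.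
move=> mg fg Lf; apply/L1P; split => //; have := L1norm_fin Lf.
congr (_ < _)%E; apply: ae_eq_integral => //.
- by apply/measurable_EFinP; apply: measurable_normc; exact: L1_measurable.
- by apply/measurable_EFinP; exact: measurable_normc.
- by move: fg; apply: ae_imp => x /= ->.
Qed.

Lemma Cintegral_ind (D : set R) f : measurable D ->
  Cintegral D f = CI (fun x => Cind D x * f x).
Proof.
have e (h : R -> R) : h \_ D = (fun x => \1_D x * h x).
  apply/funext => x; rewrite patchE indicE; case: (_ \in _);
  by rewrite ?mul1r ?mul0r.
move=> mD; apply: complexP; rewrite /CI/Cintegral/= Rintegral_mkcond e;
  apply: eq_Rintegral => x _.
  by rewrite cReM cReC cImC mul0r subr0.
by rewrite cImM cReC cImC mul0r addr0.
Qed.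

Lemma L1norm_le f (g : R -> R) : Cm f -> measurable_fun setT g -> (forall x, normc (f x) <= g x) ->
  (L1norm f <= \int[mu]_x (g x)%:E)%E.
Proof.
move=> mf mg fg; apply: ge0_le_integral => //.
- by move=> x _; rewrite lee_fin normc_ge0.
- by apply/measurable_EFinP; exact: measurable_normc.
- exact/measurable_EFinP.
- by move=> x _; rewrite lee_fin.
Qed.

Lemma L1normD f g : Cm f -> Cm g -> (L1norm (fun x => f x + g x)%R <= L1norm f + L1norm g)%E.
Proof.
move=> mf mg; rewrite /L1norm -ge0_integralD//.
- apply: L1norm_le => //.
  + exact: CmeasurableD.
  + by apply: measurable_funD; exact: measurable_normc.
  + by move=> x; exact: normc_leD.
- by move=> x _; rewrite lee_fin normc_ge0.
- by apply/measurable_EFinP; exact: measurable_normc.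
- by move=> x _; rewrite lee_fin normc_ge0.
- by apply/measurable_EFinP; exact: measurable_normc.
Qed.

Lemma L1normZ (c : R[i]) f : Cm f -> L1norm (fun x => c * f x) = ((normc c)%:E * L1norm f)%E.
Proof.
move=> mf; rewrite /L1norm -ge0_integralZl//.
- by apply: eq_integral => x _; rewrite Normc.normcM EFinM.
- by apply/measurable_EFinP; exact: measurable_normc.
- by move=> x _; rewrite lee_fin normc_ge0.
- by rewrite lee_fin normc_ge0.
Qed.

End CIntegration.
Notation Cm f := (@Cmeasurable _ _ (measurableTypeR _) setT f).

(** * Affine changes of variable *)

Section AffineSubstitution.
Context {R : realType}.
Notation mu := (@lebesgue_measure R).
Notation TR := (measurableTypeR R).

Lemma measurable_affine (a b : R) :
  measurable_fun setT (fun x : TR => a * x + b : TR).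
Proof. by apply: measurable_funD => //; exact: measurable_funM. Qed.


(** By uniqueness of Lebesgue measure: the image measure scaled by [a] gives each half-open interval
    its length. *)
Lemma lebesgue_measure_affine (a b : R) (A : set R) : 0 < a -> measurable A ->
  (a%:E * mu ((fun x => a * x + b)%R @^-1` A))%E = mu A.
Proof.
move=> a0 mA; pose k : {nonneg R} := NngNum (ltW a0).
pose pm : {measure set TR -> \bar R} :=
  measure_function_pushforward__canonical__measure_function_Measure mu
    (measurable_affine a b).
apply/esym.
rewrite (lebesgue_measure_unique (mu := mscale k pm))// => X [[s t]] _ <-.
have e : (fun x => a * x + b) @^-1` `]s, t] = `] (s - b) / a, (t - b) / a]%classic.
  by apply/seteqP; split => x /=; rewrite !in_itv/=;
    rewrite ltr_pdivrMr// ler_pdivlMr// [x * a]mulrC ltrBlDr lerBrDr.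
transitivity (a%:E * mu `] ((s - b) / a)%R, ((t - b) / a)%R])%E; last by rewrite -e.
rewrite !lebesgue_measure_itv/= !lte_fin ltr_pM2r ?invr_gt0// ltrD2r.
case: ifPn => _; last by rewrite mule0.
by rewrite -!EFinD -EFinM; congr (_%:E); field; rewrite gt_eqF.
Qed.

Lemma ge0_integral_affine (a b : R) (f : R -> \bar R) : 0 < a ->
  measurable_fun setT f -> (forall x, 0 <= f x)%E ->
  (\int[mu]_x f x = a%:E * \int[mu]_x f (a * x + b)%R)%E.
Proof.
move=> a0 mf f0; pose k : {nonneg R} := NngNum (ltW a0).
pose pm : {measure set TR -> \bar R} :=
  measure_function_pushforward__canonical__measure_function_Measure mu
    (measurable_affine a b).
transitivity (\int[mscale k pm]_x f x)%E.
  apply: eq_measure_integral => A mA _; apply/esym.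
  exact: (lebesgue_measure_affine b a0 mA).
rewrite ge0_integral_mscale//; congr (_ * _)%E.
by rewrite (ge0_integral_pushforward (measurable_affine a b)).
Qed.

Lemma ge0_integral_opp (f : R -> \bar R) :
  measurable_fun setT f -> (forall x, 0 <= f x)%E ->
  (\int[mu]_x f x = \int[mu]_x f (- x)%R)%E.
Proof.
move=> mf f0.
have mphi : measurable_fun setT (fun x : TR => - x : TR) by exact: measurableT_comp.
pose pm : {measure set TR -> \bar R} :=
  measure_function_pushforward__canonical__measure_function_Measure mu mphi.
transitivity (\int[pm]_x f x)%E.
  apply: eq_measure_integral => A mA _; apply/esym.
  exact: (lebesgue_measureN mA).
by rewrite (ge0_integral_pushforward mphi).
Qed.

Lemma Rintegral_affine (a b : R) (f : R -> R) : 0 < a ->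
  mu.-integrable setT (EFin \o f) ->
  (\int[mu]_x f x = a * \int[mu]_x f (a * x + b))%R.
Proof.
move=> a0 If; have mf := measurable_int _ If.
have mg : measurable_fun setT (EFin \o (fun x => f (a * x + b))).
  by apply/measurable_EFinP; apply: (@measurableT_comp _ _ _ TR TR TR f) => //;
     [exact/measurable_EFinP|exact: measurable_affine].
rewrite /Rintegral integralE [in RHS]integralE.
rewrite (ge0_integral_affine b a0 (measurable_funepos mf))//.
rewrite (ge0_integral_affine b a0 (measurable_funeneg mf))//.
have ig : mu.-integrable setT (EFin \o (fun x => f (a * x + b))).
  apply/integrableP; split => //; case/integrableP: If => _.
  rewrite (ge0_integral_affine b a0)//; last exact: measurableT_comp.
  by rewrite -lte_pdivlMl// mulry gtr0_sg ?invr_gt0// mul1e.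
have p1 := integral_funepos_lt_pinfty measurableT ig.
have p2 := integral_funeneg_lt_pinfty measurableT ig.
have q1 : (\int[mu]_x ((EFin \o f)^\+ (a * x + b)%R))%E \is a fin_num.
  rewrite ge0_fin_numE; last by apply: integral_ge0.
  move: p1; congr (_ < _)%E; apply: eq_integral => x _; by rewrite !funeposE.
have q2 : (\int[mu]_x ((EFin \o f)^\- (a * x + b)%R))%E \is a fin_num.
  rewrite ge0_fin_numE; last by apply: integral_ge0.
  move: p2; congr (_ < _)%E; apply: eq_integral => x _; by rewrite !funenegE.
rewrite -muleBr//; last by rewrite fin_num_adde_defl// fin_numN.
rewrite fineM//; last by rewrite fin_numB q1 q2.
rewrite /=; congr (_ * _); congr (fine (_ - _)%E);
  apply: eq_integral => x _;
    [by rewrite !funeposE|by rewrite !funenegE].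
Qed.

Lemma Rintegral_opp (f : R -> R) : measurable_fun (setT : set TR) f ->
  (\int[mu]_x f x = \int[mu]_x f (- x))%R.
Proof.
move=> /measurable_EFinP mf; rewrite /Rintegral integralE [in RHS]integralE.
rewrite [X in (X - _)%E](ge0_integral_opp (measurable_funepos mf)).
rewrite [X in (_ - X)%E](ge0_integral_opp (measurable_funeneg mf)).
  by congr (fine (_ - _)%E); apply: eq_integral => x _;
    [rewrite !funeposE|rewrite !funenegE].
exact: funeneg_ge0.
exact: funepos_ge0.
Qed.

Implicit Types f g : R -> R[i].

Lemma Cm_affine (a b : R) f : Cm f -> Cm (fun x => f (a * x + b)).
Proof. by move=> mf; apply: (Cmeasurable_comp (measurable_affine a b)). Qed.

Lemma Cm_opp f : Cm f -> Cm (fun x => f (- x)).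
Proof.
move=> mf; apply: (@Cmeasurable_comp _ _ TR _ TR (fun x : TR => - x : TR)) => //.
exact: measurableT_comp.
Qed.

Lemma L1norm_affine (a b : R) f : 0 < a -> Cm f ->
  L1norm f = (a%:E * L1norm (fun x => f (a * x + b)%R))%E.
Proof.
move=> a0 mf; apply: (ge0_integral_affine b a0) => [|x].
  by apply/measurable_EFinP; exact: measurable_normc.
by rewrite lee_fin normc_ge0.
Qed.

Lemma L1norm_opp f : Cm f -> L1norm (fun x => f (- x)) = L1norm f.
Proof.
move=> mf; apply/esym/ge0_integral_opp => [|x].
  by apply/measurable_EFinP; exact: measurable_normc.
by rewrite lee_fin normc_ge0.
Qed.

Lemma L1_affine (a b : R) f : 0 < a -> L1 f -> L1 (fun x => f (a * x + b)).
Proof.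
move=> a0 /L1P[mf foo]; apply/L1P; split; first exact: Cm_affine.
move: foo; rewrite (L1norm_affine b a0)// -lte_pdivlMl// mulry gtr0_sg ?invr_gt0//.
by rewrite mul1e.
Qed.

Lemma L1_opp f : L1 f -> L1 (fun x => f (- x)).
Proof.
by move=> /L1P[mf foo]; apply/L1P; split; [exact: Cm_opp|rewrite L1norm_opp].
Qed.

Lemma CI_affine (a b : R) f : 0 < a -> L1 f ->
  CI f = a%:C * CI (fun x => f (a * x + b)).
Proof.
move=> a0 [f1 f2]; apply: complexP; rewrite ?cReM ?cImM ?cReC ?cImC ?mul0r.
  by rewrite subr0; exact: (Rintegral_affine b a0 f1).
by rewrite addr0; exact: (Rintegral_affine b a0 f2).
Qed.

Lemma CI_opp f : Cm f -> CI (fun x => f (- x)) = CI f.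
Proof.
by move=> [f1 f2]; apply: complexP; rewrite /CI/=; rewrite [RHS]Rintegral_opp.
Qed.

Lemma L1_shift (b : R) f : L1 f -> L1 (fun x => f (x + b)).
Proof.
move=> /(L1_affine b ltr01); congr L1; apply/funext => x; by rewrite mul1r.
Qed.

Lemma CI_shift (b : R) f : L1 f -> CI (fun x => f (x + b)) = CI f.
Proof.
move=> /(CI_affine b ltr01) ->; rewrite mul1r.
by congr CI; apply/funext => x; rewrite mul1r.
Qed.

Lemma L1_sub (b : R) f : L1 f -> L1 (fun x => f (b - x)).
Proof.
move=> /(L1_shift b)/L1_opp; congr L1; apply/funext => x; by rewrite addrC.
Qed.

Lemma CI_sub (b : R) f : L1 f -> CI (fun x => f (b - x)) = CI f.
Proof.
move=> Lf; rewrite -(CI_shift b Lf) -(CI_opp (L1_measurable (L1_shift b Lf))).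
by congr CI; apply/funext => x; rewrite addrC.
Qed.

Lemma Cm_shift (b : R) f : Cm f -> Cm (fun x => f (x + b)).
Proof.
move=> /(Cm_affine 1 b); congr Cmeasurable; apply/funext => x; by rewrite mul1r.
Qed.

Lemma L1norm_shift (b : R) f : Cm f -> L1norm (fun x => f (x + b)) = L1norm f.
Proof.
move=> mf; rewrite [RHS](L1norm_affine b ltr01)// mul1e.
by congr L1norm; apply/funext => x; rewrite mul1r.
Qed.

Lemma L1norm_sub (b : R) f : Cm f -> L1norm (fun x => f (b - x)) = L1norm f.
Proof.
move=> mf; rewrite -(L1norm_shift b mf) -[RHS](L1norm_opp (Cm_shift b mf)).
by congr L1norm; apply/funext => x; rewrite addrC.
Qed.

End AffineSubstitution.

(** * Fubini and Tonelli for complex-valued kernels *)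

Section ComplexFubini.
Context {R : realType}.
Notation mu := (@lebesgue_measure R).
Notation TR := (measurableTypeR R).
Implicit Types F : R -> R -> R[i].

Definition Cm2 F := Cmeasurable setT (fun p : TR * TR => F p.1 p.2).

Lemma Cm2_sec1 F (x : R) : Cm2 F -> Cm (F x).
Proof.
move=> mF.
apply: (@Cmeasurable_comp _ _ _ _ TR (fun y : TR => (x, y) : TR * TR) _ _ mF).
exact: pair1_measurable.
Qed.

Lemma Cm2_swap F : Cm2 F -> Cm2 (fun x y => F y x).
Proof.
move=> mF; apply: (@Cmeasurable_comp _ _ _ _ (TR * TR)%type
  (fun p : TR * TR => (p.2, p.1) : TR * TR) _ _ mF).
exact: measurable_fun_pair.
Qed.

Lemma tonelli_norm F : Cm2 F ->
  (\int[mu]_x L1norm (F x) = \int[mu]_y L1norm (F^~ y))%E.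
Proof.
move=> mF; apply: (fubini_tonelli (m1 := mu) (m2 := mu)
  (fun p : TR * TR => (normc (F p.1 p.2))%:E)) => [|p].
  by apply/measurable_EFinP; exact: measurable_normc.
by rewrite lee_fin normc_ge0.
Qed.

Lemma measurable_L1norm F : Cm2 F -> measurable_fun setT (fun x : TR => L1norm (F x)).
Proof.
move=> mF; apply: (measurable_fun_fubini_tonelli_F (m2 := mu)
  (fun p : TR * TR => (normc (F p.1 p.2))%:E)) => [|p].
  by apply/measurable_EFinP; exact: measurable_normc.
by rewrite lee_fin normc_ge0.
Qed.

Section fubini_hyp.
Variable F : R -> R -> R[i].
Hypothesis mF : Cm2 F.
Hypothesis fF : (\int[mu]_x L1norm (F x) < +oo)%E.

(** Applied to [Re] and [Im], which are both dominated by the modulus: each component of [F] is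
    integrable on the product, and the real Fubini theorem applies to it. *)
Let part (h : R[i] -> R) : measurable_fun setT (fun p : TR * TR => h (F p.1 p.2)) ->
  (forall z, `|h z| <= normc z) ->
  (mu \x mu)%E.-integrable setT (fun p : TR * TR => (h (F p.1 p.2))%:E).
Proof.
move=> mh hn; apply/(integrable12ltyP mu mu).
  exact/measurable_EFinP.
apply: le_lt_trans fF; apply: ge0_le_integral => //.
- by move=> x _; exact: integral_ge0.
- apply: (measurable_fun_fubini_tonelli_F (m2 := mu)
    (fun p : TR * TR => `|(h (F p.1 p.2))%:E|)%E) => //.
  by apply: measurableT_comp => //; exact/measurable_EFinP.
- exact: measurable_L1norm.
move=> x _; apply: ge0_le_integral => //=.
- apply/measurable_EFinP; apply: measurableT_comp => //.
  exact: (measurableT_comp mh (pair1_measurable x)).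
- by apply/measurable_EFinP; apply: measurable_normc; exact: Cm2_sec1.
- by move=> y _; rewrite lee_fin.
Qed.

Let pRe := part mF.1 (@le_Re_normc R).
Let pIm := part mF.2 (@le_Im_normc R).

Lemma fubini_ae1 : {ae mu, forall x, L1 (F x)}.
Proof.
have := ae_integrable1 pIm; have := ae_integrable1 pRe.
by apply: ae_imp2 => x a b.
Qed.

Lemma fubini_ae2 : {ae mu, forall y, L1 (F^~ y)}.
Proof.
have := ae_integrable2 pIm; have := ae_integrable2 pRe.
by apply: ae_imp2 => x a b.
Qed.

Let fine_integrable (g : TR -> \bar R) : mu.-integrable setT g ->
  mu.-integrable setT (EFin \o (fine \o g)).
Proof.
move=> ig; apply: le_integrable (ig) => //.
  by apply/measurable_EFinP; apply: measurableT_comp => //; exact: measurable_int ig.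
move=> x _ /=; case: (g x) => [r| |]//=; rewrite normr0 ?leey//.
Qed.

(** An integrable [g] is finite almost everywhere, so [fine] alters it only on a null set. This
    links [CI] of the sections, which is real-valued in each component, with the extended iterated
    integral. *)
Let fine_Rintegral (g : TR -> \bar R) : mu.-integrable setT g ->
  (\int[mu]_x (fine (g x)) = fine (\int[mu]_x g x)%E)%R.
Proof.
move=> ig; congr fine; apply: ae_eq_integral => //.
- exact: measurable_int (fine_integrable ig).
- exact: measurable_int ig.
- have := integrable_ae measurableT ig; apply: ae_imp => x /(_ I) h _.
  by rewrite fineK.
Qed.

Lemma fubini_L1 : L1 (fun x => CI (F x)).
Proof.
by split; [have := integrable_fubini_F pRe|have := integrable_fubini_F pIm];
  move=> /fine_integrable.
Qed.

Lemma fubini_Re : Re (CI (fun x => CI (F x))) =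
  fine (\int[mu]_x \int[mu]_y (Re (F x y))%:E)%E.
Proof. exact: fine_Rintegral (integrable_fubini_F pRe). Qed.

Lemma fubini_Im : Im (CI (fun x => CI (F x))) =
  fine (\int[mu]_x \int[mu]_y (Im (F x y))%:E)%E.
Proof. exact: fine_Rintegral (integrable_fubini_F pIm). Qed.

Lemma fubini_ReC : (\int[mu]_x \int[mu]_y (Re (F x y))%:E =
  \int[mu]_y \int[mu]_x (Re (F x y))%:E)%E.
Proof. exact: (Fubini pRe). Qed.

Lemma fubini_ImC : (\int[mu]_x \int[mu]_y (Im (F x y))%:E =
  \int[mu]_y \int[mu]_x (Im (F x y))%:E)%E.
Proof. exact: (Fubini pIm). Qed.

Lemma fubini_norm : (L1norm (fun x => CI (F x)) <= \int[mu]_x L1norm (F x))%E.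
Proof.
apply: ge0_le_integral => //.
- by move=> x _; rewrite lee_fin normc_ge0.
- by apply/measurable_EFinP; apply: measurable_normc; exact: L1_measurable fubini_L1.
- exact: measurable_L1norm.
- by move=> x _; apply: normc_CI_le; exact: Cm2_sec1.
Qed.

End fubini_hyp.

Lemma fubini_L1' F : Cm2 F -> (\int[mu]_x L1norm (F x) < +oo)%E ->
  L1 (fun y => CI (F^~ y)).
Proof.
by move=> mF; rewrite tonelli_norm//; apply: fubini_L1; exact: Cm2_swap.
Qed.

Lemma fubini_CI F : Cm2 F -> (\int[mu]_x L1norm (F x) < +oo)%E ->
  CI (fun x => CI (F x)) = CI (fun y => CI (F^~ y)).
Proof.
move=> mF fF; have mF' := Cm2_swap mF.
have fF' : (\int[mu]_y L1norm (F^~ y) < +oo)%E by rewrite -tonelli_norm.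
apply: complexP.
  by rewrite (fubini_Re mF fF) (fubini_Re mF' fF') fubini_ReC.
by rewrite (fubini_Im mF fF) (fubini_Im mF' fF') fubini_ImC.
Qed.

End ComplexFubini.

Lemma conjcM (R : realType) (z w : R[i]) : conjc (z * w) = conjc z * conjc w.
Proof. exact: rmorphM. Qed.

(** * Fourier transform *)

Section FourierTransform.
Context {R : realType}.
Notation mu := (@lebesgue_measure R).
Notation TR := (measurableTypeR R).
Implicit Types f g : R -> R[i].

Lemma Cm2_comp (h : TR * TR -> TR) f : measurable_fun setT h -> Cm f ->
  Cm2 (fun x y => f (h (x, y))).
Proof.
move=> mh mf; have := Cmeasurable_comp mh mf.
by congr Cmeasurable; apply/funext => -[x y].
Qed.

Lemma Cm2_fst f : Cm f -> Cm2 (fun x y => f x).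
Proof. by move=> mf; apply: (@Cm2_comp (fun p => p.1) _ _ mf); exact: measurable_fst. Qed.

Lemma Cm2_snd f : Cm f -> Cm2 (fun x y => f y).
Proof. by move=> mf; apply: (@Cm2_comp (fun p => p.2) _ _ mf); exact: measurable_snd. Qed.

Lemma Cm2_sub f : Cm f -> Cm2 (fun x y => f (x - y)).
Proof.
move=> mf; apply: (@Cm2_comp (fun p => p.1 - p.2) _ _ mf).
by apply: measurable_funB; [exact: measurable_fst|exact: measurable_snd].
Qed.

Lemma Cm2_expi (h : TR * TR -> R) : measurable_fun setT h ->
  Cm2 (fun x y => expi (h (x, y))).
Proof.
move=> mh; have := Cmeasurable_expi mh; congr Cmeasurable; by apply/funext => -[].
Qed.

Lemma Cm_expiNM (l : R) : Cm (fun x => expi (- (l * x))).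
Proof.
apply: Cmeasurable_expi; apply: measurableT_comp => //; exact: measurable_funM.
Qed.

Lemma L1_expi (h : TR -> R) f : measurable_fun setT h -> L1 f ->
  L1 (fun x => expi (h x) * f x).
Proof.
move=> mh; apply: (@L1_bounded _ _ _ 1); first exact: Cmeasurable_expi.
by move=> x; rewrite normc_expi.
Qed.

Lemma L1_expiM (l : R) f : L1 f -> L1 (fun x => expi (l * x) * f x).
Proof. by apply: L1_expi; exact: measurable_funM. Qed.

Lemma L1_expiNM (l : R) f : L1 f -> L1 (fun x => expi (- (l * x)) * f x).
Proof.
by apply: L1_expi; apply: measurableT_comp => //; exact: measurable_funM.
Qed.

Definition FT f (l : R) : R[i] := CI (fun x => expi (- (l * x)) * f x).

Definition nrm f : R := \int[mu]_x normc (f x).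

Lemma nrm_ge0 f : 0 <= nrm f.
Proof. by apply: Rintegral_ge0 => x _; exact: normc_ge0. Qed.

Lemma nrmE f : L1 f -> L1norm f = (nrm f)%:E.
Proof. exact: L1norm_Rintegral. Qed.

Lemma nrmD f g : L1 f -> L1 g -> nrm (fun x => f x + g x) <= nrm f + nrm g.
Proof.
move=> Lf Lg; rewrite -lee_fin EFinD -!nrmE//; last exact: L1D.
by apply: L1normD; exact: L1_measurable.
Qed.

Lemma nrmZ (c : R[i]) f : L1 f -> nrm (fun x => c * f x) = normc c * nrm f.
Proof.
move=> Lf; apply: EFin_inj; rewrite EFinM -!nrmE//; last exact: L1Zl.
by rewrite L1normZ//; exact: L1_measurable.
Qed.

Lemma nrm_opp f : nrm (fun x => - f x) = nrm f.
Proof. by apply: eq_Rintegral => x _; rewrite normcN. Qed.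

Lemma FT_le f l : L1 f -> normc (FT f l) <= nrm f.
Proof.
move=> Lf; apply: (le_trans (normc_CI (L1_expiNM l Lf))).
rewrite le_eqVlt; apply/orP; left; apply/eqP; apply: eq_Rintegral => x _.
by rewrite Normc.normcM normc_expi mul1r.
Qed.

Lemma FTD f g l : L1 f -> L1 g -> FT (fun x => f x + g x) l = FT f l + FT g l.
Proof.
move=> Lf Lg; rewrite /FT -CID; try exact: L1_expiNM.
by congr CI; apply/funext => x; rewrite mulrDr.
Qed.

Lemma FTZ (c : R[i]) f l : L1 f -> FT (fun x => c * f x) l = c * FT f l.
Proof.
move=> Lf; rewrite /FT -CIZl; last exact: L1_expiNM.
by congr CI; apply/funext => x; rewrite mulrCA.
Qed.

Lemma FTN f l : FT (fun x => - f x) l = - FT f l.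
Proof.
rewrite /FT -CIN.
by congr CI; apply/funext => x; rewrite mulrN.
Qed.

Lemma FTB f g l : L1 f -> L1 g -> FT (fun x => f x - g x) l = FT f l - FT g l.
Proof. by move=> Lf Lg; rewrite FTD ?FTN//; exact: L1N. Qed.

Lemma FT0 l : FT (fun=> 0) l = 0.
Proof. by rewrite /FT; under eq_fun do rewrite mulr0; exact: CI0. Qed.

Lemma ae_FT f g l : Cm f -> Cm g -> {ae mu, forall x, f x = g x} -> FT f l = FT g l.
Proof.
move=> mf mg fg; apply: ae_CI.
- by apply: CmeasurableM => //; exact: Cm_expiNM.
- by apply: CmeasurableM => //; exact: Cm_expiNM.
- by move: fg; apply: ae_imp => x ->.
Qed.

(** Provides the adjoint: with it [|1 + FT f|^2] is again a constant plus the transform of an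
    integrable function. *)
Lemma FT_conj f l : L1 f -> FT (fun x => conjc (f (- x))) l = conjc (FT f l).
Proof.
move=> Lf; rewrite /FT -CI_conj; last exact: L1_expiNM.
rewrite -[LHS]CI_opp; last first.
  apply: L1_measurable; apply: L1_expiNM; apply: L1_conj; exact: L1_opp.
congr CI; apply/funext => x.
by rewrite !opprK conjcM conj_expi mulrN.
Qed.

Definition conv f g (x : R) : R[i] := CI (fun y => f y * g (x - y)).

Section conv.
Variables f g : R -> R[i].
Hypotheses (Lf : L1 f) (Lg : L1 g).

Let mf := L1_measurable Lf.
Let mg := L1_measurable Lg.

Let m2 : Cm2 (fun x y => f y * g (x - y)).
Proof. by apply: CmeasurableM; [exact: Cm2_snd|exact: Cm2_sub]. Qed.

(** Tonelli: for fixed [y] the integral in [x] equals [normc (f y) * nrm g] by translation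
    invariance. *)
Let intE : (\int[mu]_x L1norm (fun y => f y * g (x - y))%R = (nrm f * nrm g)%:E)%E.
Proof.
rewrite tonelli_norm// EFinM -!nrmE// muleC -[RHS]ge0_integralZl//.
- apply: eq_integral => y _; rewrite L1normZ; last exact: (Cm_shift (- y)).
  by rewrite L1norm_shift// muleC.
- by apply/measurable_EFinP; exact: measurable_normc.
- by move=> x _; rewrite lee_fin normc_ge0.
- exact: L1norm_ge0.
Qed.

Lemma L1_conv : L1 (conv f g).
Proof. by apply: fubini_L1 => //; rewrite intE ltry. Qed.

Lemma nrm_conv : nrm (conv f g) <= nrm f * nrm g.
Proof.
rewrite -lee_fin -nrmE; last exact: L1_conv.
by rewrite -intE; apply: fubini_norm => //; rewrite intE ltry.
Qed.

(** The phase at [x] is the product of the phases at [y] and at [x - y]; Fubini applies by [intE],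
    as a unimodular factor leaves the norms unchanged. *)
Lemma FT_conv l : FT (conv f g) l = FT f l * FT g l.
Proof.
pose F x y := expi (- (l * x)) * (f y * g (x - y)).
have mF : Cm2 F by apply: CmeasurableM => //; apply: (@Cm2_fst (fun x => expi (- (l * x)))); exact: Cm_expiNM.
have normF x : L1norm (F x) = L1norm (fun y => f y * g (x - y)).
  by apply: eq_integral => y _; rewrite Normc.normcM normc_expi mul1r.
have iF : (\int[mu]_x L1norm (F x) < +oo)%E.
  by under eq_integral do rewrite normF; rewrite intE ltry.
have ae1 : {ae mu, forall x, L1 (fun y => f y * g (x - y))}.
  by apply: fubini_ae1 => //; rewrite intE ltry.
transitivity (CI (fun x => CI (F x))).
  apply: ae_CI.
  - by apply: CmeasurableM; [exact: Cm_expiNM|exact: L1_measurable L1_conv].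
  - exact: L1_measurable (fubini_L1 mF iF).
  - by apply: ae_imp ae1 => x Lx; rewrite /conv /F CIZl.
rewrite fubini_CI// /FT mulrC -CIZl; last exact: L1_expiNM.
congr CI; apply/funext => y; rewrite /F.
rewrite -(CI_shift (- y) (L1_expiNM l Lg)).
have -> : CI (fun x => expi (- (l * (x - y))) * g (x - y)) * (expi (- (l * y)) * f y) =
  CI (fun x => (expi (- (l * y)) * f y) * (expi (- (l * (x - y))) * g (x - y))).
  by rewrite mulrC CIZl//; apply: (@L1_shift _ (- y) (fun x => expi (- (l * x)) * g x)); exact: L1_expiNM.
congr CI; apply/funext => x.
have -> : - (l * x) = - (l * y) + - (l * (x - y)) by ring.
by rewrite expiD; ring.
Qed.

End conv.

Lemma FT_shift (b : R) f l : L1 f -> FT (fun x => f (x + b)) l = expi (l * b) * FT f l.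
Proof.
move=> Lf; rewrite /FT -(CI_shift b (L1_expiNM l Lf)).
rewrite -CIZl; last first.
  apply: (@L1_shift _ b (fun x => expi (- (l * x)) * f x)); exact: L1_expiNM.
congr CI; apply/funext => x; rewrite mulrA -expiD; congr (expi _ * _); ring.
Qed.

End FourierTransform.

(** * Abel means and Fourier inversion *)

Section PoissonKernel.
Context {R : realType}.
Notation mu := (@lebesgue_measure R).
Notation TR := (measurableTypeR R).

Lemma cvgy_bound (F : R -> R) (l C : R) : (forall x, 0 < x -> `|F x - l| <= C / x) ->
  F x @[x --> +oo] --> l.
Proof.
move=> FC; apply/cvgrPdist_le => e e0; exists (Num.max 0 (C / e)).
split; first exact: num_real.
move=> x; rewrite gt_max => /andP[x0 Cx].
by rewrite distrC (le_trans (FC _ x0))// ler_pdivrMr// mulrC -ler_pdivrMr// ltW.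
Qed.

Lemma ge0_FTCy (f F : R -> R) (a l : R) :
  (forall x, a <= x -> 0 <= f x) -> continuous f ->
  (forall x : R, is_derive x 1 F (f x)) -> F x @[x --> +oo] --> l ->
  (\int[mu]_(x in `[a, +oo[) (f x)%:E = (l - F a)%:E)%E.
Proof.
move=> f0 cf dF Fl; have cF : continuous F.
  by move=> x; apply: differentiable_continuous; apply/derivable1_diffP.
rewrite (ge0_continuous_FTC2y f0 _ Fl)//.
- exact: continuous_subspaceT.
- exact/cvg_at_right_filter/cF.
- by move=> x _; rewrite derive1E; exact: derive_val.
Qed.

Definition poisson (e t : R) : R := e / (pi * (e ^+ 2 + t ^+ 2)).
(** Minus the derivative of the Poisson kernel [poisson e], which is the inverse Fourier transform
    of [l |-> exp (- e |l|)]. The sign makes it nonnegative on the right half-line. *)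
Definition dpoisson (e t : R) : R := 2 * e * t / (pi * (e ^+ 2 + t ^+ 2) ^+ 2).

Let sqD_gt0 (e t : R) : 0 < e -> 0 < e ^+ 2 + t ^+ 2.
Proof. by move=> e0; rewrite ltr_pwDl ?exprn_gt0 ?sqr_ge0. Qed.

Let pi0 : (pi : R) != 0. Proof. by rewrite gt_eqF ?pi_gt0. Qed.

Lemma poisson_ge0 (e t : R) : 0 < e -> 0 <= poisson e t.
Proof.
by move=> e0; rewrite divr_ge0 ?mulr_ge0 ?pi_ge0// ltW// sqD_gt0.
Qed.

Lemma poissonN (e t : R) : poisson e (- t) = poisson e t.
Proof. by rewrite /poisson sqrrN. Qed.

Lemma is_derive_poisson (e t : R) : 0 < e ->
  is_derive t 1 (poisson e) (- dpoisson e t).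
Proof.
move=> e0; have p := sqD_gt0 t e0.
have d1 : is_derive t 1 (fun s : R => pi * (e ^+ 2 + s ^+ 2)) (pi * (2 * t)).
  by apply: is_derive_eq; rewrite /GRing.scale/= ; ring.
have d2 : is_derive t 1 (fun s : R => (pi * (e ^+ 2 + s ^+ 2))^-1)
    (- (pi * (e ^+ 2 + t ^+ 2)) ^- 2 *: (pi * (2 * t))).
  by apply: is_deriveV; rewrite mulf_neq0// gt_eqF.
rewrite /poisson; apply: is_derive_eq.
rewrite /dpoisson /GRing.scale/=; clear d1 d2; move: pi0; move: (pi : R) => q q0.
by field; rewrite q0 gt_eqF.
Qed.

Lemma continuous_poisson (e : R) : 0 < e -> continuous (poisson e).
Proof.
move=> e0 t; apply: differentiable_continuous; apply/derivable1_diffP.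
by have := is_derive_poisson t e0 => h; exact: ex_derive.
Qed.

Lemma continuous_dpoisson (e : R) : 0 < e -> continuous (dpoisson e).
Proof.
move=> e0 t; have p := sqD_gt0 t e0.
have d2 : {for t, continuous (fun s : R => (pi * (e ^+ 2 + s ^+ 2) ^+ 2)^-1)}.
  apply: differentiable_continuous; apply/derivable1_diffP.
  by apply: derivableV => //; rewrite mulf_neq0// expf_neq0// gt_eqF.
exact: (continuousM (@mulrl_continuous _ (2 * e) t) d2).
Qed.

Lemma dpoisson_ge0 (e t : R) : 0 < e -> 0 <= t -> 0 <= dpoisson e t.
Proof.
move=> e0 t0; rewrite divr_ge0 ?mulr_ge0 ?pi_ge0 ?(ltW e0)//.
all: by rewrite ltW// sqD_gt0.
Qed.

(* Layer-cake form: bounds on Poisson averages follow from bounds on interval averages. *)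
Lemma poisson_layer (e t : R) : 0 < e -> 0 <= t ->
  (\int[mu]_(s in `]t, +oo[) (dpoisson e s)%:E = (poisson e t)%:E)%E.
Proof.
move=> e0 t0; rewrite integral_itv_obnd_cbnd; last first.
  apply/measurable_EFinP/measurable_funTS.
  by apply: continuous_measurable_fun; exact: continuous_dpoisson.
have dF (x : R) : is_derive x 1 (fun s => - poisson e s) (dpoisson e x).
  by have h := is_derive_poisson x e0; apply: is_derive_eq; rewrite opprK.
have Fl : (fun s => - poisson e s) x @[x --> +oo] --> (0 : R); last first.
  rewrite (ge0_FTCy _ (continuous_dpoisson e0) dF Fl) ?opprK ?add0r//.
  by move=> x tx; rewrite dpoisson_ge0// (le_trans t0).
apply: (@cvgy_bound _ _ pi^-1) => x x0.
rewrite subr0 normrN ger0_norm ?poisson_ge0// /poisson invfM mulrA [e * _]mulrC -mulrA.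
rewrite ler_pM2l ?invr_gt0 ?pi_gt0// ler_pdivrMr ?sqD_gt0//.
rewrite ler_pdivlMl//; have := sqr_ge0 (e - x); have := sqr_ge0 (e+x); nra.
Qed.

Lemma integral_poisson (e : R) : 0 < e -> (\int[mu]_t (poisson e t)%:E = 1)%E.
Proof.
move=> e0; rewrite ge0_symfun_integralT; last 3 first.
- by move=> t; exact: poisson_ge0.
- exact: continuous_poisson.
- by move=> t /=; rewrite poissonN.
pose F (t : R) := atan (e^-1 * t) / pi.
have dF (x : R) : is_derive x 1 F (poisson e x).
  have d : is_derive x 1 (fun t : R => e^-1 * t) e^-1.
    by apply: is_derive_eq; rewrite /GRing.scale/= mulr1.
  have d2 := @is_derive1_comp _ atan (fun t : R => e^-1 * t) x _ _ (is_derive1_atan (e^-1 * x)) d.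
  have d3 : is_derive x 1 (fun t : R => (atan \o (fun t : R => e^-1 * t)) t * pi^-1) (poisson e x).
    apply: is_derive_eq; rewrite /GRing.scale/= /poisson; clear d d2 F.
    move: pi0; move: (pi : R) => q q0; field.
    by rewrite q0 !gt_eqF// ?sqD_gt0.
  exact: d3.
have Fl : F x @[x --> +oo] --> (2^-1 : R); last first.
  rewrite -set_itvcy (ge0_FTCy _ (continuous_poisson e0) dF Fl).
    by rewrite /F mulr0 atan0 mul0r subr0 -EFinM mulfV.
  by move=> t _; exact: poisson_ge0.
rewrite /F; have -> : (2^-1 : R) = (pi / 2) / pi by rewrite mulrAC mulfV// mul1r.
apply: cvgMl => //.
apply: (@cvg_comp _ _ _ (fun t : R => e^-1 * t) atan _ +oo); last exact: cvgy_atan.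
by apply: gt0_cvgMry => //; rewrite invr_gt0.
Qed.

Lemma measurable_poisson (e : R) : 0 < e -> measurable_fun setT (poisson e : TR -> TR).
Proof. by move=> e0; apply: continuous_measurable_fun; exact: continuous_poisson. Qed.

Lemma integrable_poisson (e : R) : 0 < e -> mu.-integrable setT (EFin \o poisson e).
Proof.
move=> e0; apply/integrableP; split.
  by apply/measurable_EFinP; exact: measurable_poisson.
under eq_integral do rewrite gee0_abs ?lee_fin ?poisson_ge0//.
by rewrite integral_poisson// ltry.
Qed.

Let damp_bound (e x : R) : 0 < e -> 0 < x -> expR (- (e * x)) <= e^-1 / x.
Proof.
move=> e0 x0; rewrite expRN -invfM lef_pV2 ?posrE ?expR_gt0 ?mulr_gt0//.
by have := expR_ge1Dx (e * x); apply: le_trans; rewrite lerDr.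
Qed.

Let damp_derive (e x : R) : is_derive x 1 (fun t : R => expR (- (e * t))) (- e * expR (- (e * x))).
Proof.
have d : is_derive x 1 (fun t : R => - (e * t)) (- e).
  by apply: is_derive_eq; rewrite /GRing.scale/= mulr1.
have := @is_derive1_comp _ expR (fun t : R => - (e * t)) x _ _ (is_derive_expR (- (e * x))) d.
by move=> h; apply: is_derive_eq; rewrite mulrC.
Qed.

Lemma integral_damp (e : R) : 0 < e ->
  (\int[mu]_(x in `[0%R, +oo[) (expR (- (e * x)))%:E = (e^-1)%:E)%E.
Proof.
move=> e0.
have cf : continuous (fun x : R => expR (- (e * x))).
  move=> x; apply: differentiable_continuous; apply/derivable1_diffP.
  by have h := damp_derive e x; exact: ex_derive.
pose F (t : R) := - e^-1 * expR (- (e * t)).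
have dF (x : R) : is_derive x 1 F (expR (- (e * x))).
  have h := damp_derive e x; apply: is_derive_eq.
  by rewrite /GRing.scale/=; field; rewrite gt_eqF.
have Fl : F x @[x --> +oo] --> (0 : R); last first.
  rewrite (ge0_FTCy _ cf dF Fl); last by move=> x _; exact: expR_ge0.
  by rewrite /F mulr0 oppr0 expR0 mulr1 opprK add0r.
rewrite /F; apply: (@cvgy_bound _ _ (e^-1 * e^-1)) => x x0.
rewrite subr0 normrM normrN (gtr0_norm (expR_gt0 _)) gtr0_norm ?invr_gt0// -mulrA.
by rewrite ler_pM2l ?invr_gt0//; exact: damp_bound.
Qed.

(** The fundamental theorem on a half-line is used for nonnegative integrands; adding 1 to the
    cosine achieves this, and the integral of the damping factor alone is subtracted in
    [CI_damp]. *)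
Lemma integral_damp_cos (e t : R) : 0 < e ->
  (\int[mu]_(x in `[0%R, +oo[) (expR (- (e * x)) * (1 + cos (x * t)))%:E =
   (e^-1 + e / (e ^+ 2 + t ^+ 2))%:E)%E.
Proof.
move=> e0; have p := sqD_gt0 t e0.
have dc (x : R) : is_derive x 1 (fun s : R => cos (s * t)) (- sin (x * t) * t).
  have d : is_derive x 1 (fun s : R => s * t) t.
    by apply: is_derive_eq; rewrite /GRing.scale/= mulr1 ?mulr0 ?add0r ?addr0.
  exact: (@is_derive1_comp _ cos (fun s : R => s * t) x _ _ (is_derive_cos (x * t)) d).
have ds (x : R) : is_derive x 1 (fun s : R => sin (s * t)) (cos (x * t) * t).
  have d : is_derive x 1 (fun s : R => s * t) t.
    by apply: is_derive_eq; rewrite /GRing.scale/= mulr1 ?mulr0 ?add0r ?addr0.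
  exact: (@is_derive1_comp _ sin (fun s : R => s * t) x _ _ (is_derive_sin (x * t)) d).
pose c := (e ^+ 2 + t ^+ 2)^-1.
(* The part with [c] is the real part of [exp ((- e + i t) s) / (- e + i t)]. *)
pose F s := expR (- (e * s)) * (- e^-1 + c * (t * sin (s * t) - e * cos (s * t))).
have cf : continuous (fun x : R => expR (- (e * x)) * (1 + cos (x * t))).
  move=> x; apply: differentiable_continuous; apply/derivable1_diffP.
  by have h := damp_derive e x; have h2 := dc x; exact: ex_derive.
have dF (x : R) : is_derive x 1 F (expR (- (e * x)) * (1 + cos (x * t))).
  have h := damp_derive e x; have h2 := dc x; have h3 := ds x.
  apply: is_derive_eq.
  by rewrite /GRing.scale/= /c; field; rewrite ?gt_eqF.
have Fl : F x @[x --> +oo] --> (0 : R); last first.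
  rewrite (ge0_FTCy _ cf dF Fl).
    rewrite /F mulr0 mul0r oppr0 expR0 sin0 cos0 /c; congr (_%:E).
    by field; rewrite !gt_eqF.
  by move=> x _; rewrite mulr_ge0 ?expR_ge0// -lerBlDl sub0r cos_geN1.
rewrite /F.
apply: (@cvgy_bound _ _ (e^-1 * (e^-1 + c * (`|t| + e)))) => x x0.
rewrite subr0 normrM ger0_norm ?expR_ge0//.
rewrite [leRHS]mulrAC ler_pM ?expR_ge0//; first exact: damp_bound.
rewrite (le_trans (ler_normD _ _))// normrN gtr0_norm ?invr_gt0// lerD2l.
rewrite normrM gtr0_norm ?invr_gt0// ler_pM2l ?invr_gt0//.
rewrite (le_trans (ler_normB _ _))// !normrM (gtr0_norm e0) lerD//.
  by rewrite ler_piMr// ler_norml sin_geN1 sin_le1.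
by rewrite ler_piMr ?(ltW e0)// ler_norml cos_geN1 cos_le1.
Qed.

End PoissonKernel.

(** * Abel means of a Fourier transform as Poisson averages *)

Section AbelPoisson.
Context {R : realType}.
Notation mu := (@lebesgue_measure R).
Notation TR := (measurableTypeR R).

Definition damp (e l : R) : R := expR (- (e * `|l|)).

Lemma damp_ge0 (e l : R) : 0 <= damp e l. Proof. exact: expR_ge0. Qed.

Lemma continuous_damp (e : R) : continuous (damp e).
Proof.
move=> l; apply: continuous_comp; last exact: continuous_expR.
apply: cvgN; apply: cvgM; [exact: cvg_cst|exact: norm_continuous].
Qed.

Lemma measurable_damp (e : R) : measurable_fun setT (damp e : TR -> TR).
Proof. exact: continuous_measurable_fun (@continuous_damp e). Qed.

Lemma integralT_damp (e : R) : 0 < e ->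
  (\int[mu]_l (damp e l)%:E = (2 / e)%:E)%E.
Proof.
move=> e0; rewrite ge0_symfun_integralT; last 3 first.
- by move=> l; exact: damp_ge0.
- exact: continuous_damp.
- by move=> l /=; rewrite /damp normrN.
rewrite EFinM -set_itvcy; congr (_ * _)%E; rewrite -integral_damp//.
apply: eq_integral; by move=> x; rewrite inE/= in_itv/= andbT => x0; rewrite /damp ger0_norm.
Qed.

Lemma integralT_damp_cos (e t : R) : 0 < e ->
  (\int[mu]_l (damp e l * (1 + cos (l * t)))%:E =
   (2 * (e^-1 + e / (e ^+ 2 + t ^+ 2)))%:E)%E.
Proof.
move=> e0; rewrite (@ge0_symfun_integralT _ (fun l => damp e l * (1 + cos (l * t)))); last 3 first.
- by move=> l; rewrite mulr_ge0 ?damp_ge0// -lerBlDl sub0r cos_geN1.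
- move=> l; apply: cvgM; first exact: continuous_damp.
  apply: cvgD; first exact: cvg_cst.
  apply: (@continuous_comp _ _ _ (fun l : R => l * t) cos); last exact: continuous_cos.
  exact: mulrr_continuous.
- by move=> l /=; rewrite /damp normrN mulNr cosN.
rewrite EFinM -set_itvcy; congr (_ * _)%E; rewrite -integral_damp_cos//.
apply: eq_integral; by move=> x; rewrite inE/= in_itv/= andbT => x0; rewrite /damp ger0_norm.
Qed.

Lemma integrable_damp (e : R) : 0 < e -> mu.-integrable setT (EFin \o damp e).
Proof.
move=> e0; apply/integrableP; split.
  by apply/measurable_EFinP; exact: measurable_damp.
under eq_integral do rewrite gee0_abs ?lee_fin ?damp_ge0//.
by rewrite integralT_damp// ltry.
Qed.

Lemma L1_damp (e : R) : 0 < e -> L1 (fun l => (damp e l)%:C).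
Proof.
move=> e0; apply: (@le_L1 _ _ (damp e)); last exact: integrable_damp.
  by apply: Cmeasurable_real; exact: measurable_damp.
by move=> l; rewrite normc_real ger0_norm ?damp_ge0.
Qed.

Lemma CI_damp (e t : R) : 0 < e ->
  CI (fun l => expi (l * t) * (damp e l)%:C) = (2 * pi * poisson e t)%:C.
Proof.
move=> e0.
have mt (s : R) : measurable_fun setT (fun l : TR => l * s) by exact: measurable_funM.
have L s : L1 (fun l => expi (l * s) * (damp e l)%:C).
  by apply: L1_expi => //; exact: L1_damp.
have [L_re L_im] := L t; have [L_re' L_im'] := L (- t).
apply: complexP; rewrite ?cReC ?cImC.
- have i1 : mu.-integrable setT (EFin \o (fun l => damp e l * (1 + cos (l * t)))).
    apply/integrableP; split.
      apply/measurable_EFinP; apply: measurable_funM; first exact: measurable_damp.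
      apply: measurable_funD => //; apply: measurableT_comp (mt t).
      exact: continuous_measurable_fun (@continuous_cos R).
    under eq_integral => l _.
      rewrite gee0_abs; last first.
        by rewrite lee_fin mulr_ge0 ?damp_ge0// -lerBlDl sub0r cos_geN1.
      over.
    by rewrite integralT_damp_cos// ltry.
  transitivity (\int[mu]_l (damp e l * (1 + cos (l * t)) - damp e l)).
    by apply: eq_Rintegral => l _; rewrite cReM cReC cImC /=; ring.
  rewrite RintegralB//; last exact: integrable_damp.
  rewrite /Rintegral integralT_damp_cos// integralT_damp//= /poisson.
  have := pi_gt0 R; move: (pi : R) => q q0; field.
  by rewrite !gt_eqF// ltr_pwDl ?exprn_gt0 ?sqr_ge0.
(* The imaginary part of the integrand is odd in [l], so its integral equals its own negative. *)
- set J := LHS.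
  have JN : J = - J.
    rewrite {1}/J /CI/= Rintegral_opp; last by apply/measurable_EFinP; exact: measurable_int L_im.
    transitivity (\int[mu]_l (-1 * Im (expi (l * t) * (damp e l)%:C))).
      apply: eq_Rintegral => l _; rewrite cImM cReC cImC /damp normrN/= [- l * t]mulNr sinN.
      by ring.
    by rewrite RintegralZl// mulN1r.
  lra.
Qed.

Lemma poisson_le (e t : R) : 0 < e -> poisson e t <= e^-1.
Proof.
move=> e0; rewrite /poisson ler_pdivrMr; last first.
  by rewrite mulr_gt0 ?pi_gt0// ltr_pwDl ?exprn_gt0 ?sqr_ge0.
rewrite ler_pdivlMl//; have := pi_ge2 R; have := sqr_ge0 t; have := sqr_ge0 e; nra.
Qed.

Lemma measurable_poisson_sub (e x : R) : 0 < e ->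
  measurable_fun setT (fun y : TR => poisson e (x - y) : TR).
Proof.
move=> e0; apply: (measurableT_comp (measurable_poisson e0)).
exact: measurable_funB.
Qed.

Lemma L1_poisson (e x : R) (f : R -> R[i]) : 0 < e -> L1 f ->
  L1 (fun y => (poisson e (x - y))%:C * f y).
Proof.
move=> e0; apply: (@L1_bounded _ _ _ e^-1).
  by apply: Cmeasurable_real; exact: measurable_poisson_sub.
by move=> y; rewrite normc_real ger0_norm ?poisson_ge0// poisson_le.
Qed.

(** The damping factor makes the double integral absolutely convergent; after Fubini the integral in
    [l] is the Poisson kernel by [CI_damp]. *)
Lemma AbelFourier_FT (f : R -> R[i]) (x e : R) : 0 < e -> L1 f ->
  AbelFourier (FT f) x e = CI (fun y => (poisson e (x - y))%:C * f y).
Proof.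
move=> e0 Lf; have mf := L1_measurable Lf.
pose F l y := (expi (- (l * y)) * f y) * (expi (l * x) * (damp e l)%:C).
have mD : Cm (fun l => expi (l * x) * (damp e l)%:C).
  apply: CmeasurableM; last by apply: L1_measurable; exact: L1_damp.
  by apply: Cmeasurable_expi; exact: measurable_funM.
have mF : Cm2 F.
  apply: CmeasurableM; last exact: (@Cm2_fst _ (fun l => expi (l * x) * (damp e l)%:C)).
  apply: CmeasurableM; last exact: Cm2_snd.
  apply: (@Cm2_expi _ (fun p => - (p.1 * p.2))).
  apply: measurableT_comp => //; apply: measurable_funM.
    exact: measurable_fst.
  exact: measurable_snd.
have iF : (\int[mu]_l L1norm (F l) < +oo)%E.
  have -> : (\int[mu]_l L1norm (F l) = \int[mu]_l ((nrm f)%:E * (damp e l)%:E))%E.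
    apply: eq_integral => l _; transitivity (L1norm (fun y => (damp e l)%:C * f y)).
      by apply: eq_integral => y _; rewrite !Normc.normcM !normc_expi !mul1r mulrC.
    by rewrite L1normZ// normc_real ger0_norm ?damp_ge0// muleC nrmE.
  rewrite ge0_integralZl//; last 3 first.
  - by apply/measurable_EFinP; exact: measurable_damp.
  - by move=> l _; rewrite lee_fin damp_ge0.
  - by rewrite lee_fin nrm_ge0.
  by rewrite integralT_damp// -EFinM ltry.
rewrite /AbelFourier.
transitivity (((2 * pi)^-1)%:C * CI (fun l => CI (F l))).
  congr (_ * CI _); apply/funext => l; rewrite /F CIZr; last exact: L1_expiNM.
  by rewrite mulrA.
rewrite fubini_CI// -CIZl; last exact: fubini_L1'.
congr CI; apply/funext => y.
have -> : CI (F^~ y) = f y * CI (fun l => expi (l * (x - y)) * (damp e l)%:C).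
  rewrite -CIZl; last first.
    by apply: L1_expi; [exact: measurable_funM|exact: L1_damp].
  congr CI; apply/funext => l; rewrite /F.
  have -> : l * (x - y) = - (l * y) + l * x by ring.
  by rewrite expiD; ring.
rewrite CI_damp// [RHS]mulrC mulrCA -rmorphM; congr (_ * _%:C).
by rewrite mulrA mulVf ?mul1r// mulf_neq0// gt_eqF// pi_gt0.
Qed.

End AbelPoisson.

(** * Convergence of Poisson averages at Lebesgue points *)

Section LebesguePoints.
Context {R : realType}.
Notation mu := (@lebesgue_measure R).
Notation TR := (measurableTypeR R).

Lemma lebesgue_pt_bound (f : R -> R) (x eta : R) : 0 < eta -> lebesgue_pt f x ->
  exists2 delta : R, 0 < delta & forall r, 0 < r -> r <= delta ->
    (\int[mu]_(y in ball x r) `|f y - f x|%:E <= (eta * (r *+ 2))%:E)%E.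
Proof.
move=> eta0 /fine_cvgP[fin /cvgrPdist_lt/(_ eta eta0) h].
have [d/= d0 H] := filterI fin h.
exists (d / 2); first by rewrite divr_gt0.
move=> r r0 rd; have : ball (0 : R) d r.
  by rewrite /= /ball/= sub0r normrN gtr0_norm// (le_lt_trans rd)// ltr_pdivrMr// ltr_pMr// ltr1n.
move=> /H /(_ r0)[fr]; rewrite sub0r normrN.
move: fr; rewrite /= /davg /iavg lebesgue_measure_ball ?(ltW r0)//.
rewrite inver mulrn_eq0/= gt_eqF//.
set I := (\int[mu]_(y in _) _)%E; move=> fI.
rewrite ger0_norm; last first.
  by rewrite fine_ge0// mule_ge0 ?integral_ge0// lee_fin invr_ge0 mulrn_wge0// ltW.
move=> hr; have : ((r *+ 2)^-1%:E * I <= eta%:E)%E.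
  by rewrite -(fineK fI) lee_fin ltW.
by rewrite lee_pdivrMl ?mulrn_wgt0// -EFinM mulrC.
Qed.

Section poisson_near.
Variables (phi : R -> R) (x eta delta e : R).
Hypotheses (mphi : measurable_fun setT (phi : TR -> TR)) (phi0 : forall y, 0 <= phi y).
Hypotheses (eta0 : 0 < eta) (e0 : 0 < e) (delta0 : 0 < delta).
Hypothesis phi_eta : forall r, 0 < r -> r <= delta ->
  (\int[mu]_(y in ball x r) (phi y)%:E <= (eta * (r *+ 2))%:E)%E.

Let A : set (TR * TR) := [set p | `|x - p.1| < p.2].

Let mA : measurable A.
Proof.
rewrite (_ : A = (fun p : TR * TR => p.2 - `|x - p.1| : TR) @^-1` `]0, +oo[); last first.
  by apply/seteqP; split => p /=; rewrite in_itv/= andbT subr_gt0.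
rewrite -[X in measurable X]setTI.
have mh : measurable_fun setT (fun p : TR * TR => p.2 - `|x - p.1| : TR).
  apply: measurable_funB; first exact: measurable_snd.
  apply: (measurableT_comp (@normr_measurable R setT)).
  by apply: measurable_funB => //; exact: measurable_fst.
exact: mh.
Qed.

(** Layer-cake kernel: its integral in [s] is [poisson e (x - y)] ([intK]), while for fixed [s > 0]
    it is a multiple of the indicator of [ball x s]. *)
Let K y s := \1_A (y, s) * dpoisson e s.

Let K0 y s : 0 <= K y s.
Proof.
rewrite /K indicE; case: (boolP ((y, s) \in A)) => [/set_mem /= h|_]; last by rewrite mul0r.
by rewrite mul1r dpoisson_ge0// ltW// (le_lt_trans (normr_ge0 (x - y))).
Qed.

Let mK : measurable_fun setT (fun p : TR * TR => K p.1 p.2).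
Proof.
apply: measurable_funM.
  rewrite (_ : (fun _ => _) = \1_A); first exact: measurable_indic.
  by apply/funext => -[].
apply: (@measurableT_comp _ _ _ _ _ _ (dpoisson e : TR -> TR)).
  by apply: continuous_measurable_fun; exact: continuous_dpoisson.
exact: measurable_snd.
Qed.

Let intK y : (\int[mu]_s (K y s)%:E = (poisson e (x - y))%:E)%E.
Proof.
have -> : poisson e (x - y) = poisson e `|x - y|.
  by case: (ler0P (x - y)) => // _; rewrite poissonN.
rewrite -poisson_layer// [RHS]integral_mkcond; apply: eq_integral => s _.
rewrite patchE /K indicE.
have -> : ((y, s) \in A) = (s \in (`]`|x - y|, +oo[%classic : set R)).
  by apply/idP/idP; rewrite !inE/= in_itv/= andbT.
by case: ifPn => _; rewrite ?mul1r ?mul0r.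
Qed.

Let g y := \1_(ball x delta) y * phi y.

Let g0 y : 0 <= g y.
Proof. by rewrite mulr_ge0// indicE. Qed.

Let mg : measurable_fun setT (g : TR -> TR).
Proof. by apply: measurable_funM => //; apply: measurable_indic; exact: measurable_ball. Qed.

(** For fixed [s > 0] the left side is a multiple of the integral of [phi] over the ball of radius
    [min s delta], which [phi_eta] bounds by [eta] times the length of that ball, hence of
    [ball x s]. *)
Let inner s : (\int[mu]_y (g y * K y s)%:E <= \int[mu]_y (eta * K y s)%:E)%E.
Proof.
have [s0|s0] := leP s 0.
  rewrite le_eqVlt; apply/orP; left; apply/eqP; apply: eq_integral => y _.
  rewrite /K indicE memNset ?mul0r ?mulr0//=.
  by apply/negP; rewrite -leNgt (le_trans s0).
have KE y : K y s = \1_(ball x s) y * dpoisson e s.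
  by rewrite /K !indicE; congr (_ %:R * _); apply/idP/idP; rewrite !inE.
have d0 : 0 <= dpoisson e s by rewrite dpoisson_ge0// ltW.
pose r := Num.min s delta.
have r0 : 0 < r by rewrite lt_min s0 delta0.
have gE y : g y * K y s = dpoisson e s * (\1_(ball x r) y * phi y).
  rewrite /g KE.
  have -> : \1_(ball x r) y = \1_(ball x s) y * \1_(ball x delta) y :> R.
    rewrite !indicE -natrM mulnb; congr (_ %:R); congr nat_of_bool.
    by apply/idP/andP => [|[]]; rewrite !inE /ball/= lt_min; [case/andP|move=> -> ->].
  by ring.
have m1 (t : R) : measurable_fun setT (\1_(ball x t) : TR -> R).
  by apply: measurable_indic; exact: measurable_ball.
have KE2 y : eta * K y s = dpoisson e s * (eta * \1_(ball x s) y).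
  by rewrite KE; ring.
have -> : (\int[mu]_y (g y * K y s)%:E =
    (dpoisson e s)%:E * \int[mu]_y (\1_(ball x r) y * phi y)%:E)%E.
  under eq_integral do rewrite gE EFinM.
  rewrite ge0_integralZl//; first by apply/measurable_EFinP; apply: measurable_funM.
  by move=> y _; rewrite lee_fin mulr_ge0// indicE.
have -> : (\int[mu]_y (eta * K y s)%:E =
    (dpoisson e s)%:E * \int[mu]_y (eta * \1_(ball x s) y)%:E)%E.
  under eq_integral do rewrite KE2 EFinM.
  rewrite ge0_integralZl//; first by apply/measurable_EFinP; apply: measurable_funM.
  by move=> y _; rewrite lee_fin mulr_ge0// ?indicE// ltW.
apply: lee_wpmul2l; first by rewrite lee_fin.
have -> : (\int[mu]_y (\1_(ball x r) y * phi y)%:E = \int[mu]_(y in ball x r) (phi y)%:E)%E.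
  rewrite [RHS]integral_mkcond; apply: eq_integral => y _.
  by rewrite patchE indicE; case: ifPn => _; rewrite ?mul1r ?mul0r.
apply: (le_trans (phi_eta r0 _)); first by rewrite ge_min lexx orbT.
under eq_integral do rewrite EFinM.
rewrite ge0_integralZl//; last 2 first.
- exact/measurable_EFinP.
- by rewrite lee_fin ltW.
have -> : (\int[mu]_y (\1_(ball x s) y)%:E = (s *+ 2)%:E)%E.
  rewrite integral_indic//; last exact: measurable_ball.
  by rewrite setIT; exact: lebesgue_measure_ball (ltW s0).
rewrite -EFinM lee_fin ler_pM2l//.
by rewrite lerMn2r/= ge_min lexx.
Qed.

(** Tonelli in [(y, s)]: [inner] is applied layer by layer, and undoing the layers leaves [eta]
    times the total mass 1 of the Poisson kernel. *)
Lemma poisson_near : (\int[mu]_(y in ball x delta) (poisson e (x - y) * phi y)%:E <= eta%:E)%E.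
Proof.
have m1 y : measurable_fun setT (fun s : TR => (K y s)%:E).
  by apply/measurable_EFinP; exact: (measurableT_comp mK (pair1_measurable y)).
have -> : (\int[mu]_(y in ball x delta) (poisson e (x - y) * phi y)%:E =
   \int[mu]_y \int[mu]_s (g y * K y s)%:E)%E.
  rewrite integral_mkcond; apply: eq_integral => y _.
  under eq_integral do rewrite EFinM.
  rewrite ge0_integralZl//; last 2 first.
  - by move=> s _; rewrite lee_fin K0.
  - by rewrite lee_fin g0.
  rewrite intK patchE /g indicE.
  by case: ifPn => _; rewrite -EFinM ?mul1r ?mul0r// mulrC.
have mgK : measurable_fun setT (fun p : TR * TR => (g p.1 * K p.1 p.2)%:E).
  apply/measurable_EFinP; apply: measurable_funM mK.
  apply: (measurableT_comp mg); exact: measurable_fst.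
have meK : measurable_fun setT (fun p : TR * TR => (eta * K p.1 p.2)%:E).
  by apply/measurable_EFinP; apply: measurable_funM mK.
rewrite (fubini_tonelli (m1 := mu) (m2 := mu) (fun p : TR * TR => (g p.1 * K p.1 p.2)%:E))//; last first.
  by move=> p; rewrite lee_fin mulr_ge0.
apply: (@le_trans _ _ (\int[mu]_s \int[mu]_y (eta * K y s)%:E)%E).
  apply: ge0_le_integral => //.
  - by move=> s _; apply: integral_ge0 => y _; rewrite lee_fin mulr_ge0.
  - apply: (measurable_fun_fubini_tonelli_G (m1 := mu)
      (fun p : TR * TR => (g p.1 * K p.1 p.2)%:E)) => // p.
    by rewrite lee_fin mulr_ge0.
  - apply: (measurable_fun_fubini_tonelli_G (m1 := mu)
      (fun p : TR * TR => (eta * K p.1 p.2)%:E)) => // p.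
    by rewrite lee_fin mulr_ge0// ltW.
  - by move=> s _; exact: inner.
rewrite -(fubini_tonelli (m1 := mu) (m2 := mu) (fun p : TR * TR => (eta * K p.1 p.2)%:E))//; last first.
  by move=> p; rewrite lee_fin mulr_ge0// ltW.
have -> : (\int[mu]_y \int[mu]_s (eta * K (y, s).1 (y, s).2)%:E =
    \int[mu]_y (eta%:E * (poisson e (x - y))%:E))%E.
  apply: eq_integral => y _; under eq_integral do rewrite EFinM.
  rewrite ge0_integralZl ?intK//; last by rewrite lee_fin ltW.
  - exact: m1.
  - by move=> s _; rewrite lee_fin K0.
rewrite ge0_integralZl//; last 3 first.
- by apply/measurable_EFinP; exact: measurable_poisson_sub.
- by move=> y _; rewrite lee_fin poisson_ge0.
- by rewrite lee_fin ltW.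
have -> : (\int[mu]_y (poisson e (x - y))%:E = 1)%E.
  rewrite -(integral_poisson e0).
  have mp : measurable_fun setT (fun t : TR => (poisson e t)%:E).
    by apply/measurable_EFinP; exact: measurable_poisson.
  have p0 (t : R) : (0 <= (poisson e t)%:E)%E by rewrite lee_fin poisson_ge0.
  rewrite [RHS](ge0_integral_affine (- x) ltr01)// mul1e.
  by apply: eq_integral => y _; rewrite mul1r -[in LHS]opprB poissonN.
by rewrite mule1.
Qed.

End poisson_near.

Lemma poisson_mass (e x : R) : 0 < e ->
  (\int[mu]_y (poisson e (x - y))%:E = 1)%E.
Proof.
move=> e0; rewrite -(integral_poisson e0).
have mp : measurable_fun setT (fun t : TR => (poisson e t)%:E).
  by apply/measurable_EFinP; exact: measurable_poisson.
have p0 (t : R) : (0 <= (poisson e t)%:E)%E by rewrite lee_fin poisson_ge0.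
rewrite [RHS](ge0_integral_affine (- x) ltr01)// mul1e.
by apply: eq_integral => y _; rewrite mul1r -[in LHS]opprB poissonN.
Qed.

Lemma integrable_poisson_sub (e x : R) : 0 < e ->
  mu.-integrable setT (EFin \o (fun y => poisson e (x - y))).
Proof.
move=> e0; apply/integrableP; split.
  by apply/measurable_EFinP; exact: measurable_poisson_sub.
under eq_integral do rewrite gee0_abs ?lee_fin ?poisson_ge0//.
by rewrite poisson_mass// ltry.
Qed.

Lemma integrable_poissonM (e x : R) (f : R -> R) : 0 < e ->
  mu.-integrable setT (EFin \o f) ->
  mu.-integrable setT (EFin \o (fun y => poisson e (x - y) * f y)).
Proof.
move=> e0 If; have mf := measurable_int _ If.
apply: (le_integrable _ _ _ (integrableZl measurableT (e^-1) If)) => //.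
  apply/measurable_EFinP; apply: measurable_funM.
    exact: measurable_poisson_sub.
  exact/measurable_EFinP.
move=> y _; rewrite /= lee_fin [in leLHS]normrM [in leRHS]normrM ler_wpM2r//.
by rewrite (ger0_norm (poisson_ge0 _ e0)) gtr0_norm ?invr_gt0// poisson_le.
Qed.

(** Away from the origin the kernel is [O(e)]. The bound keeps the factor [poisson 1 t], so that the
    constant [f x] can also be integrated over the far region. *)
Lemma poisson_far (e delta t : R) : 0 < e -> 0 < delta -> delta <= `|t| ->
  poisson e t <= e * (1 + delta ^- 2) * poisson 1 t.
Proof.
move=> e0 d0 dt; rewrite /poisson expr1n mul1r -mulrA ler_pM2l// !invfM.
rewrite [leRHS]mulrCA ler_pM2l ?invr_gt0 ?pi_gt0//.
have d2 : delta ^+ 2 <= t ^+ 2 by rewrite -[t ^+ 2]real_normK ?num_real// ler_pXn2r// nnegrE ltW.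
have t2 : 0 < t ^+ 2 by rewrite (lt_le_trans _ d2)// exprn_gt0.
rewrite ler_pdivlMr ?ltr_pwDl ?sqr_ge0// ler_pdivrMl ?ltr_pwDl ?exprn_gt0 ?sqr_ge0//.
have h : 1 <= delta ^- 2 * t ^+ 2 by rewrite ler_pdivlMl ?exprn_gt0// mulr1.
have : 0 <= e ^+ 2 * (1 + delta ^- 2).
  by rewrite mulr_ge0 ?sqr_ge0// addr_ge0// invr_ge0 exprn_ge0// ltW.
nra.
Qed.

(** Since the kernel has mass 1, the difference is a Poisson average of [f y - f x]. It is split at
    the radius [delta] of the Lebesgue point estimate: [poisson_near] bounds the inside by [eta],
    [poisson_far] the outside by [e * C]. *)
Lemma poisson_bound (f : R -> R) (x eta : R) : 0 < eta ->
  mu.-integrable setT (EFin \o f) -> lebesgue_pt f x ->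
  exists2 C : R, 0 <= C & forall e, 0 < e ->
    `|\int[mu]_y (poisson e (x - y) * f y) - f x| <= eta + e * C.
Proof.
move=> eta0 If Lx; have [delta d0 H] := lebesgue_pt_bound eta0 Lx.
have mf : measurable_fun setT (f : TR -> TR) by apply/measurable_EFinP; exact: measurable_int If.
pose phi y := `|f y - f x|.
have mphi : measurable_fun setT (phi : TR -> TR).
  by apply: measurableT_comp => //; apply: measurable_funB.
have phi0 y : 0 <= phi y by exact: normr_ge0.
pose c := 1 + delta ^- 2.
have c0 : 0 <= c by rewrite addr_ge0// invr_ge0 exprn_ge0// ltW.
have p1 : (0 : R) < 1 by [].
pose N := \int[mu]_y `|f y|.
have N0 : 0 <= N by apply: Rintegral_ge0.
have NE : (\int[mu]_y `|f y|%:E = N%:E)%E.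
  rewrite /N /Rintegral fineK// ge0_fin_numE; last exact: integral_ge0.
  by case/integrableP: If.
exists (c * (N + `|f x|)) => [|e e0]; first by apply: mulr_ge0 => //; exact: addr_ge0.
have Ip := integrable_poisson_sub x e0.
have Ipf := integrable_poissonM x e0 If.
have Ipx : mu.-integrable setT (EFin \o (fun y => poisson e (x - y) * f x)).
  by have := integrableZr measurableT (f x) Ip; apply: eq_integrable.
have fxE : f x = \int[mu]_y (poisson e (x - y) * f x).
  by rewrite RintegralZr// /Rintegral poisson_mass// mul1r.
rewrite {1}fxE -RintegralB//; apply: (le_trans (le_normr_Rintegral _ _)) => //.
  have := integrableB measurableT Ipf Ipx; exact: eq_integrable.
have -> : \int[mu]_y `|poisson e (x - y) * f y - poisson e (x - y) * f x| =
    \int[mu]_y (poisson e (x - y) * phi y).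
  apply: eq_Rintegral => y _.
  by rewrite -mulrBr normrM ger0_norm// poisson_ge0.
rewrite -lee_fin /Rintegral.
have key : (\int[mu]_y (poisson e (x - y) * phi y)%:E <= (eta + e * (c * (N + `|f x|)))%:E)%E.
  pose B : set R := ball x delta.
  pose F1 y := \1_B y * (poisson e (x - y) * phi y).
  pose F2 y := e * c * (`|f y| + `|f x| * poisson 1 (x - y)).
  have mB : measurable B by exact: measurable_ball.
  have mp (s : R) : 0 < s -> measurable_fun setT (fun y : TR => poisson s (x - y) : TR).
    exact: measurable_poisson_sub.
  have F20 y : 0 <= F2 y.
    rewrite /F2; apply: mulr_ge0; first by rewrite mulr_ge0 ?(ltW e0).
    by rewrite addr_ge0// mulr_ge0// poisson_ge0.
  have mF1 : measurable_fun setT F1.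
    by apply: measurable_funM => //; apply: measurable_funM => //; exact: mp.
  have mF2 : measurable_fun setT F2.
    apply: measurable_funM => //; apply: measurable_funD.
      exact: measurableT_comp.
    by apply: measurable_funM => //; exact: mp.
  apply: (@le_trans _ _ (\int[mu]_y (F1 y + F2 y)%:E)%E).
    apply: ge0_le_integral => //.
    - by move=> y _; rewrite lee_fin mulr_ge0// poisson_ge0.
    - by apply/measurable_EFinP; apply: measurable_funM => //; exact: mp.
    - by apply/measurable_EFinP; apply: measurable_funD.
    move=> y _; rewrite lee_fin /F1 indicE.
    case: (boolP (y \in B)) => [|yB]; first by rewrite mul1r lerDl.
    rewrite mul0r add0r.
    have dxy : delta <= `|x - y|.
      by rewrite leNgt; apply: contraNN yB => h; rewrite inE.
    apply: (@le_trans _ _ (e * c * (poisson 1 (x - y)) * phi y)).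
      by rewrite ler_wpM2r// poisson_far.
    rewrite -mulrA ler_wpM2l ?mulr_ge0 ?(ltW e0)//.
    apply: (@le_trans _ _ (poisson 1 (x - y) * (`|f y| + `|f x|))).
      by rewrite ler_wpM2l ?poisson_ge0//; exact: ler_normB.
    rewrite mulrDr lerD//; last by rewrite mulrC.
    by rewrite ler_piMl// (le_trans (poisson_le _ _))// invr1.
  under eq_integral do rewrite EFinD.
  rewrite ge0_integralD//; last 4 first.
  - by move=> y _; rewrite lee_fin mulr_ge0 ?indicE// mulr_ge0// poisson_ge0.
  - exact/measurable_EFinP.
  - by move=> y _; rewrite lee_fin.
  - exact/measurable_EFinP.
  rewrite EFinD; apply: leeD.
    apply: le_trans (poisson_near mphi phi0 eta0 e0 d0 H).
    rewrite le_eqVlt; apply/orP; left; apply/eqP.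
    rewrite [RHS]integral_mkcond; apply: eq_integral => y _.
    by rewrite patchE /F1 indicE; case: ifPn => _; rewrite ?mul1r ?mul0r.
  have F2E y : (F2 y)%:E = ((e * c)%:E * (`|f y|%:E + `|f x|%:E * (poisson 1 (x - y))%:E))%E.
    by [].
  have mp1 : measurable_fun setT (fun y : TR => (poisson 1 (x - y))%:E).
    by apply/measurable_EFinP; exact: mp.
  have p10 y : (0 <= (poisson 1 (x - y))%:E)%E by rewrite lee_fin poisson_ge0.
  have mnf : measurable_fun setT (fun y : TR => `|f y|%:E).
    by apply/measurable_EFinP; exact: measurableT_comp.
  have fx0 : (0 <= `|f x|%:E)%E by rewrite lee_fin.
  under eq_integral do rewrite F2E.
  rewrite ge0_integralZl//; last 3 first.
  - by apply: emeasurable_funD => //; exact: measurable_funeM.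
  - by move=> y _; apply: adde_ge0; [rewrite lee_fin|exact: mule_ge0].
  - by rewrite lee_fin mulr_ge0// ltW.
  rewrite ge0_integralD//; last 2 first.
  - by move=> y _; exact: mule_ge0.
  - exact: measurable_funeM.
  by rewrite ge0_integralZl// poisson_mass// mule1 NE -EFinD -EFinM mulrA.
rewrite fineK// ge0_fin_numE; first exact: le_lt_trans key (ltry _).
by apply: integral_ge0 => y _; rewrite lee_fin mulr_ge0// poisson_ge0.
Qed.

Lemma poisson_cvg (f : R -> R) (x : R) :
  mu.-integrable setT (EFin \o f) -> lebesgue_pt f x ->
  (\int[mu]_y (poisson e (x - y) * f y)) @[e --> 0^'+] --> f x.
Proof.
move=> If Lx; apply/cvgrPdist_le => eps eps0.
have [|C C0 H] := @poisson_bound f x (eps / 2) _ If Lx; first by rewrite divr_gt0.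
exists (eps / 2 / (C + 1)) => /=.
  by rewrite !divr_gt0// ltr_wpDl.
move=> e; rewrite /ball/= sub0r normrN => eC e0.
rewrite distrC (le_trans (H _ e0))// [leRHS](splitr eps) lerD2l.
rewrite gtr0_norm// in eC.
have : e * (C + 1) < eps / 2 by rewrite -ltr_pdivlMr// ltr_wpDl.
by rewrite mulrDr mulr1 => h; rewrite ltW// (le_lt_trans _ h)// lerDl ltW.
Qed.

End LebesguePoints.

(** * Measurability of a limit at [0] from the right *)

Section LimitMeasurable.
Context {R : realType}.
Notation mu := (@lebesgue_measure R).
Notation TR := (measurableTypeR R).

(** The two filters have the same limits, so [lim] chooses the same value, including where there is
    no limit. *)
Lemma lim_near_eq (f g : R -> R) : (forall e, 0 < e -> f e = g e) ->
  lim (f e @[e --> 0^'+]) = lim (g e @[e --> 0^'+]).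
Proof.
move=> fg; have E : \forall e \near 0^'+, f e = g e.
  by exists 1 => //= e _ e0; exact: fg.
rewrite /lim; congr get; apply/funext => l; apply/propext; split;
  apply: cvg_trans; apply: near_eq_cvg; by apply: filterS E => e ->.
Qed.

Lemma natSinv_lt (e : R) : 0 < e -> exists n : nat, (n.+1%:R^-1 : R) < e.
Proof.
move=> e0; have [n _ H] := near_infty_natSinv_lt (PosNum e0).
by exists n; exact: (H n (leqnn n)).
Qed.

Variable B : R -> R -> R.
Hypothesis mB : forall e, 0 < e -> measurable_fun setT (B e : TR -> TR).
Hypothesis cB : forall x e eps, 0 < e -> 0 < eps ->
  exists2 d, 0 < d & forall e', 0 < e' -> `|e - e'| < d -> `|B e x - B e' x| < eps.

(** Enumerates the rationals as reals; integers that encode no rational give 0, which the condition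
    [0 < r p] in [E] discards. *)
Let r (n : nat) : R := ratr (odflt 0 (unpickle n : option rat)).
Let E (k n p q : nat) : set TR := [set x | 0 < r p < n.+1%:R^-1 -> 0 < r q < n.+1%:R^-1 ->
  `|B (r p) x - B (r q) x| <= k.+1%:R^-1].
Let D : set TR := [set x | cvg (B e x @[e --> 0^'+])].

Let mE k n p q : measurable (E k n p q).
Proof.
have [/andP[p0 pn]|hp] := boolP (0 < r p < n.+1%:R^-1); last first.
  rewrite (_ : E k n p q = setT)//; apply/seteqP; split => // x _ /= h.
  by rewrite h in hp.
have [/andP[q0 qn]|hq] := boolP (0 < r q < n.+1%:R^-1); last first.
  rewrite (_ : E k n p q = setT)//; apply/seteqP; split => // x _ /= _ h.
  by rewrite h in hq.
rewrite (_ : E k n p q = (fun x => `|B (r p) x - B (r q) x| : TR) @^-1` `]-oo, k.+1%:R^-1]).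
  rewrite -[X in measurable X]setTI.
  have mh : measurable_fun setT (fun x : TR => `|B (r p) x - B (r q) x| : TR).
    by apply: (measurableT_comp (@normr_measurable R setT)); apply: measurable_funB; exact: mB.
  exact: mh.
apply/seteqP; split => x; rewrite /E /= in_itv/= p0 pn q0 qn; first by apply.
by move=> h _ _.
Qed.

(* By continuity in [e], the Cauchy criterion at [0] may be tested on rationals. *)
Let DE : D = \bigcap_k \bigcup_n \bigcap_p \bigcap_q E k n p q.
Proof.
apply/seteqP; split => x.
- move=> /= cx k _.
  have k0 : (0 : R) < k.+1%:R^-1 / 2 by rewrite divr_gt0.
  have /cvgrPdist_le/(_ _ k0)[d /= d0 H] := cx.
  have [n nd] := natSinv_lt d0.
  exists n => // p _ q _ /= /andP[p0 pn] /andP[q0 qn].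
  have hp : `|lim (B e x @[e --> 0^'+]) - B (r p) x| <= k.+1%:R^-1 / 2.
    by apply: H => //; rewrite /ball/= sub0r normrN gtr0_norm// (lt_trans pn).
  have hq : `|lim (B e x @[e --> 0^'+]) - B (r q) x| <= k.+1%:R^-1 / 2.
    by apply: H => //; rewrite /ball/= sub0r normrN gtr0_norm// (lt_trans qn).
  rewrite [leRHS]splitr (le_trans (ler_distD (lim (B e x @[e --> 0^'+])) _ _))//.
  by rewrite lerD// distrC.
- move=> H /=; apply: cauchy_cvg; apply: cauchy_exP => eps eps0.
  have eps2 : 0 < eps / 2 by rewrite divr_gt0.
  have [k ke] := natSinv_lt eps2.
  have [n _ Hn] := H k I.
  have n0 : (0 : R) < n.+1%:R^-1 by rewrite invr_gt0.
  have [q0 /[!in_itv]/= q0n] := rat_in_itvoo n0.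
  have rq (q : rat) : exists m, r m = ratr q by exists (pickle q); rewrite /r pickleK.
  have [q qE] := rq q0.
  exists (B (r q) x); exists n.+1%:R^-1 => //= e.
  rewrite /ball/= sub0r normrN => en e0; rewrite gtr0_norm// in en.
  have [d d0 Hd] := cB x e0 eps2.
  have md : Num.max 0 (e - d) < e by rewrite gt_max e0/= ltrBlDr ltrDl.
  have [p0 /[!in_itv]/= /andP[]] := rat_in_itvoo md.
  rewrite gt_max => /andP[p00 p0d] p0e.
  have [p pE] := rq p0.
  rewrite (le_lt_trans (ler_distD (B (r p) x) _ _))// (splitr eps) ler_ltD//.
    apply: (le_trans _ (ltW ke)); apply: (Hn q I p I).
      by rewrite qE.
    by rewrite pE p00 (lt_trans p0e).
  rewrite distrC; apply: Hd; rewrite ?pE// gtr0_norm ?subr_gt0//.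
  by rewrite ltrBlDr -ltrBlDl.
Qed.

Let mD : measurable D.
Proof.
rewrite DE; apply: bigcapT_measurable => k; apply: bigcupT_measurable => n.
by apply: bigcapT_measurable => p; apply: bigcapT_measurable => q; exact: mE.
Qed.

(** On the convergence set [D] the limit is taken along [e = 1 / (n + 1)]; on its complement [lim]
    has its constant default value [point]. *)
Lemma measurable_lim0 : measurable_fun setT (fun x : TR => lim (B e x @[e --> 0^'+]) : TR).
Proof.
rewrite -(setUv D); apply: (measurable_funU _ mD (measurableC mD)).2.
split.
  apply: (@measurable_fun_cvg _ _ _ _ (fun n x => B n.+1%:R^-1 x)).
    by move=> n; apply: measurable_funTS; apply: mB; rewrite invr_gt0.
  move=> x Dx; have /cvg_at_rightP := Dx; apply; split.
    by move=> n; rewrite invr_gt0.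
  exact: cvg_harmonic.
apply: (eq_measurable_fun (fun=> point)); last exact: measurable_cst.
by move=> x; rewrite inE => nD; rewrite dvgP.
Qed.

End LimitMeasurable.

(** * Fourier inversion almost everywhere and injectivity of the transform *)

Section FourierInversion.
Context {R : realType}.
Notation mu := (@lebesgue_measure R).
Notation TR := (measurableTypeR R).

Definition Cpoisson (e : R) (t : R) : R[i] := (poisson e t)%:C.

Lemma L1_Cpoisson (e : R) : 0 < e -> L1 (Cpoisson e).
Proof.
move=> e0; apply: (@le_L1 _ _ (poisson e)); last exact: integrable_poisson.
  by apply: Cmeasurable_real; exact: measurable_poisson.
by move=> t; rewrite normc_real ger0_norm// poisson_ge0.
Qed.

Lemma AbelFourier_conv (f : R -> R[i]) (x e : R) : 0 < e -> L1 f ->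
  AbelFourier (FT f) x e = conv f (Cpoisson e) x.
Proof.
move=> e0 Lf; rewrite AbelFourier_FT//.
by congr CI; apply/funext => y; rewrite mulrC.
Qed.

(** The bound does not depend on [t]. It makes Abel means continuous in [e], which is what allows
    their convergence to be tested on rational [e]. *)
Lemma poisson_lip (e e' t : R) : 0 < e -> 0 < e' ->
  `|poisson e t - poisson e' t| <= `|e - e'| * (e ^- 2 + (e * e')^-1).
Proof.
move=> e0 e0'.
have p : 0 < e ^+ 2 + t ^+ 2 by rewrite ltr_pwDl ?exprn_gt0 ?sqr_ge0.
have p' : 0 < e' ^+ 2 + t ^+ 2 by rewrite ltr_pwDl ?exprn_gt0 ?sqr_ge0.
have pp := pi_gt0 R.
have -> : poisson e t - poisson e' t =
    (e - e') * (pi^-1 * ((t ^+ 2 - e * e') / ((e ^+ 2 + t ^+ 2) * (e' ^+ 2 + t ^+ 2)))).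
  rewrite /poisson; move: (pi : R) pp => q q0; field; by rewrite !gt_eqF.
rewrite normrM ler_wpM2l// normrM gtr0_norm ?invr_gt0//.
have pi1 : pi^-1 <= (1 : R) by rewrite invf_le1// (le_trans _ (pi_ge2 R))// ler1n.
set X := _ / _.
apply: (@le_trans _ _ `|X|); first by rewrite ler_piMl.
rewrite /X normrM normfV (gtr0_norm (mulr_gt0 p p')) ler_pdivrMr ?mulr_gt0//.
apply: (@le_trans _ _ (t ^+ 2 + e * e')).
  apply: (le_trans (ler_normB _ _)).
  by rewrite (ger0_norm (sqr_ge0 _)) (gtr0_norm (mulr_gt0 e0 e0')).
rewrite [leRHS]mulrDl lerD//.
  rewrite mulrA; apply: (@le_trans _ _ (1 * (e' ^+ 2 + t ^+ 2))).
    by rewrite mul1r lerDr sqr_ge0.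
  rewrite ler_pM2r// ler_pdivlMl ?exprn_gt0// mulr1 lerDl sqr_ge0//.
rewrite ler_pdivlMl ?mulr_gt0//.
have -> : e * e' * (e * e') = e ^+ 2 * e' ^+ 2 by ring.
by rewrite ler_pM ?sqr_ge0// lerDl sqr_ge0.
Qed.

Lemma conv_poisson_continuous (f : R -> R[i]) (x e eps : R) : L1 f -> 0 < e -> 0 < eps ->
  exists2 d, 0 < d & forall e', 0 < e' -> `|e - e'| < d ->
    normc (conv f (Cpoisson e) x - conv f (Cpoisson e') x) < eps.
Proof.
move=> Lf e0 eps0.
(* Bounds the constant of [poisson_lip] for all [e' >= e / 2], integrated against [f]. *)
pose C := (e ^- 2 + (e * (e / 2))^-1) * nrm f.
have C0 : 0 <= C.
  apply: mulr_ge0; last exact: nrm_ge0.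
  by rewrite addr_ge0// invr_ge0 ?exprn_ge0 ?mulr_ge0 ?divr_ge0// ltW.
exists (Num.min (e / 2) (eps / (C + 1))).
  by rewrite lt_min !divr_gt0// ltr_wpDl.
move=> e' e0'; rewrite lt_min => /andP[d1 d2].
have e2 : e / 2 <= e'.
  rewrite leNgt; apply/negP => h; move: d1; rewrite ltNge => /negP; apply.
  rewrite (le_trans _ (ler_norm _))//; lra.
have Lp (s : R) : 0 < s -> L1 (fun y => f y * Cpoisson s (x - y)).
  move=> s0; have := L1_poisson x s0 Lf; congr L1; apply/funext => y.
  by rewrite mulrC.
rewrite /conv -CIB; [|exact: Lp|exact: Lp].
apply: (le_lt_trans (normc_CI (L1B (Lp _ e0) (Lp _ e0')))).
apply: (@le_lt_trans _ _ (`|e - e'| * C)); last first.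
  have h : `|e - e'| * (C + 1) < eps by rewrite -ltr_pdivlMr// ltr_wpDl.
  by apply: le_lt_trans h; rewrite ler_wpM2l// lerDl.
have -> : `|e - e'| * C =
    \int[mu]_y (`|e - e'| * (e ^- 2 + (e * (e / 2))^-1) * normc (f y)).
  by rewrite RintegralZl// /C ?mulrA//; exact: L1_norm.
apply: le_Rintegral => //.
- by apply: L1_norm; apply: L1B; exact: Lp.
- have := integrableZl measurableT (`|e - e'| * (e ^- 2 + (e * (e / 2))^-1)) (L1_norm Lf).
  exact: eq_integrable.
move=> y _; rewrite -mulrBr Normc.normcM mulrC ler_wpM2r ?normc_ge0//.
rewrite /Cpoisson -rmorphB normc_real (le_trans (poisson_lip _ _ _))//.
rewrite ler_wpM2l// lerD2l lef_pV2 ?posrE ?mulr_gt0 ?divr_gt0// ler_pM2l//.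
Qed.

Lemma Re_conv_poisson (f : R -> R[i]) (x e : R) :
  Re (conv f (Cpoisson e) x) = \int[mu]_y (poisson e (x - y) * Re (f y)).
Proof. by apply: eq_Rintegral => y _; rewrite cReM cReC cImC mulr0 subr0 mulrC. Qed.

Lemma Im_conv_poisson (f : R -> R[i]) (x e : R) :
  Im (conv f (Cpoisson e) x) = \int[mu]_y (poisson e (x - y) * Im (f y)).
Proof. by apply: eq_Rintegral => y _; rewrite cImM cReC cImC mulr0 add0r mulrC. Qed.

Theorem Cm_inverse_fourier (f : R -> R[i]) : L1 f -> Cm (inverse_fourier (FT f)).
Proof.
move=> Lf; split.
- rewrite /inverse_fourier/=.
  under eq_fun do rewrite (lim_near_eq (fun e e0 => congr1 (@complex.Re R) (AbelFourier_conv _ e0 Lf))).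
  apply: measurable_lim0.
    by move=> e e0; case: (L1_measurable (L1_conv Lf (L1_Cpoisson e0))).
  move=> x e eps e0 eps0; have [d d0 H] := conv_poisson_continuous x Lf e0 eps0.
  exists d => // e' e0' h; apply: le_lt_trans (H _ e0' h).
  by rewrite -cReN -cReD le_Re_normc.
- rewrite /inverse_fourier/=.
  under eq_fun do rewrite (lim_near_eq (fun e e0 => congr1 (@complex.Im R) (AbelFourier_conv _ e0 Lf))).
  apply: measurable_lim0.
    by move=> e e0; case: (L1_measurable (L1_conv Lf (L1_Cpoisson e0))).
  move=> x e eps e0 eps0; have [d d0 H] := conv_poisson_continuous x Lf e0 eps0.
  exists d => // e' e0' h; apply: le_lt_trans (H _ e0' h).
  by rewrite -cImN -cImD le_Im_normc.
Qed.

Lemma ae_lebesgue_pt (f : R -> R) : mu.-integrable setT (EFin \o f) ->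
  {ae mu, forall x, lebesgue_pt f x}.
Proof.
by move=> If; apply: lebesgue_differentiation; apply: open_integrable_locally => //; exact: openT.
Qed.

Lemma ae_AbelFourier_cvg (f : R -> R[i]) : L1 f -> {ae mu, forall x,
  Re (AbelFourier (FT f) x e) @[e --> 0^'+] --> Re (f x) /\
  Im (AbelFourier (FT f) x e) @[e --> 0^'+] --> Im (f x)}.
Proof.
move=> Lf; have [f1 f2] := Lf; have := ae_lebesgue_pt f2; have := ae_lebesgue_pt f1.
apply: ae_imp2 => x l1 l2; split.
  apply: cvg_trans (poisson_cvg f1 l1); apply: near_eq_cvg.
  exists 1; first exact: ltr01.
  by move=> e _ e0; rewrite AbelFourier_conv// Re_conv_poisson.
apply: cvg_trans (poisson_cvg f2 l2); apply: near_eq_cvg.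
exists 1; first exact: ltr01.
  by move=> e _ e0; rewrite AbelFourier_conv// Im_conv_poisson.
Qed.

Theorem inverse_fourier_FT (f : R -> R[i]) : L1 f ->
  {ae mu, forall x, inverse_fourier (FT f) x = f x}.
Proof.
move=> Lf; have := ae_AbelFourier_cvg Lf; apply: ae_imp => x [l1 l2].
rewrite /inverse_fourier (cvg_lim _ l1)// (cvg_lim _ l2)//.
by case: (f x).
Qed.

Lemma L1_inverse_fourier (f : R -> R[i]) : L1 f -> L1 (inverse_fourier (FT f)).
Proof.
move=> Lf; apply: ae_L1 (Lf); first exact: Cm_inverse_fourier.
by have := inverse_fourier_FT Lf; apply: ae_imp => x ->.
Qed.

Theorem FT_inj (f g : R -> R[i]) : L1 f -> L1 g -> (forall l, FT f l = FT g l) ->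
  {ae mu, forall x, f x = g x}.
Proof.
move=> Lf Lg /funext fg; have := inverse_fourier_FT Lg; have := inverse_fourier_FT Lf.
by apply: ae_imp2 => x <- <-; rewrite fg.
Qed.

Lemma L1_dct (F : nat -> R -> R[i]) (f : R -> R[i]) (g : R -> R) :
  (forall n, Cm (F n)) -> Cm f -> {ae mu, forall x, normc (F n x - f x) @[n --> \oo] --> 0} ->
  (forall n x, normc (F n x) <= g x) -> (forall x, normc (f x) <= g x) ->
  mu.-integrable setT (EFin \o g) ->
  nrm (fun x => F n x - f x) @[n --> \oo] --> 0.
Proof.
move=> mF mf Ff Fg fg Ig.
have mh n : measurable_fun setT (fun x : TR => (normc (F n x - f x))%:E).
  by apply/measurable_EFinP; apply: measurable_normc; exact: CmeasurableB.
have Ig2 := integrableD measurableT Ig Ig.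
have h0 : {ae mu, forall x, setT x -> (normc (F n x - f x))%:E @[n --> \oo] --> 0%E}.
  apply: ae_imp Ff => x h _; apply: cvg_EFin; last exact: h.
  exact: nearW.
have h1 : {ae mu, forall x (n : nat), setT x ->
    (`|(normc (F n x - f x))%:E| <= ((EFin \o g) \+ (EFin \o g)) x)%E}.
  apply: ae_all => x n _ /=; rewrite lee_fin ger0_norm ?normc_ge0//.
  by rewrite (le_trans (normc_leB _ _))// lerD.
have [_ _ /=] := dominated_convergence measurableT mh (measurable_cst _) h0 Ig2 h1.
by rewrite integral0 => H; apply: fine_cvg; exact: H.
Qed.

Lemma normc_cvg0 (T : Type) (F : set_system T) {FF : Filter F} (z : T -> R[i]) (w : R[i]) :
  Re (z t) @[t --> F] --> Re w -> Im (z t) @[t --> F] --> Im w ->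
  normc (z t - w) @[t --> F] --> 0.
Proof.
move=> h1 h2.
have h : `|Re (z t) - Re w| + `|Im (z t) - Im w| @[t --> F] --> 0.
  rewrite -[X in _ --> X]addr0 -[X in _ --> X + _](normr0 R) -[X in _ --> _ + X](normr0 R).
  apply: cvgD; apply: cvg_norm.
    by rewrite -[X in _ --> X](subrr (Re w)); apply: cvgB => //; exact: cvg_cst.
  by rewrite -[X in _ --> X](subrr (Im w)); apply: cvgB => //; exact: cvg_cst.
apply: (squeeze_cvgr _ (cvg_cst 0) h).
near=> t; rewrite normc_ge0/= (le_trans (normc_le_ReIm _))// cReD cImD cReN cImN.
by [].
Unshelve. all: by end_near. Qed.

Lemma FT_cvg (f : R -> R[i]) (u : nat -> R) (l : R) : L1 f -> u @ \oo --> l ->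
  normc (FT f (u n) - FT f l) @[n --> \oo] --> 0.
Proof.
move=> Lf ul; have mf := L1_measurable Lf.
have H : nrm (fun x => expi (- (u n * x)) * f x - expi (- (l * x)) * f x) @[n --> \oo] --> 0.
  apply: (@L1_dct (fun n x => expi (- (u n * x)) * f x) _ (fun x => normc (f x))).
  - by move=> n; apply: CmeasurableM => //; exact: Cm_expiNM.
  - by apply: CmeasurableM => //; exact: Cm_expiNM.
  - apply: ae_all => x.
    have ux : - (u n * x) @[n --> \oo] --> - (l * x).
      by apply: cvgN; apply: cvgM => //; exact: cvg_cst.
    have cu : cos (- (u n * x)) @[n --> \oo] --> cos (- (l * x)).
      by apply: (@cvg_comp _ _ _ _ cos _ _ _ ux); exact: continuous_cos.
    have su : sin (- (u n * x)) @[n --> \oo] --> sin (- (l * x)).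
      by apply: (@cvg_comp _ _ _ _ sin _ _ _ ux); exact: continuous_sin.
    apply: normc_cvg0.
      under eq_fun do rewrite cReM; rewrite cReM.
      by apply: cvgB; apply: cvgM => //; exact: cvg_cst.
    under eq_fun do rewrite cImM; rewrite cImM.
    by apply: cvgD; apply: cvgM => //; exact: cvg_cst.
  - by move=> n x; rewrite Normc.normcM normc_expi mul1r.
  - by move=> x; rewrite Normc.normcM normc_expi mul1r.
  - exact: L1_norm.
apply: (squeeze_cvgr _ (cvg_cst 0) H).
apply: nearW => n; apply/andP; split; first exact: normc_ge0.
have -> : FT f (u n) - FT f l =
    CI (fun x => expi (- (u n * x)) * f x - expi (- (l * x)) * f x).
  by rewrite CIB//; exact: L1_expiNM.
by apply: normc_CI; apply: L1B; exact: L1_expiNM.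
Qed.

(** Any 1-Lipschitz [h] is allowed, so as to serve [Re], [Im] and [z |-> normc (1 + z)] alike. *)
Lemma continuous_normc_FT_sub (f : R -> R[i]) (h : R[i] -> R) : L1 f ->
  (forall z w, `|h z - h w| <= normc (z - w)) -> continuous (fun l => h (FT f l)).
Proof.
move=> Lf hh l; apply/continuous_withinNx/cvgr_dnbhsP => u [_ ul].
apply/cvgrPdist_le => e e0.
have /cvgrPdist_le/(_ e e0) := FT_cvg Lf ul.
apply: filterS => n; rewrite sub0r normrN ger0_norm ?normc_ge0//.
by apply: le_trans; rewrite distrC.
Qed.

Lemma Cm_FT (f : R -> R[i]) : L1 f -> Cm (FT f).
Proof.
move=> Lf; split; apply: continuous_measurable_fun; apply: continuous_normc_FT_sub => // z w.
  by rewrite -cReN -cReD le_Re_normc.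
by rewrite -cImN -cImD le_Im_normc.
Qed.

(** Every Abel mean of [FT f] is bounded by the integral of [D], as [(2 * pi)^-1 <= 1], and the
    means tend to [f] almost everywhere. The factor 2 comes from passing to the limit in real and
    imaginary parts separately. *)
Lemma FT_sup_bound (f : R -> R[i]) (D : R -> R) : L1 f ->
  (forall l, normc (FT f l) <= D l) -> mu.-integrable setT (EFin \o D) ->
  {ae mu, forall x, normc (f x) <= 2 * \int[mu]_l D l}.
Proof.
move=> Lf fD ID; have := ae_AbelFourier_cvg Lf; apply: ae_imp => x [l1 l2].
have mD : measurable_fun setT (D : TR -> TR) by apply/measurable_EFinP; exact: measurable_int ID.
have D0 l : 0 <= D l by rewrite (le_trans _ (fD l))// normc_ge0.
have bound e : 0 < e -> normc (AbelFourier (FT f) x e) <= \int[mu]_l D l.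
  move=> e0; pose h l := FT f l * expi (l * x) * (damp e l)%:C.
  have hD l : normc (h l) <= D l.
    rewrite !Normc.normcM normc_expi mulr1 normc_real ger0_norm ?damp_ge0//.
    rewrite -[leRHS]mulr1 ler_pM ?normc_ge0 ?damp_ge0//.
    by rewrite -expR0 ler_expR oppr_le0 mulr_ge0// ltW.
  have mh : Cm h.
    apply: CmeasurableM; last by apply: Cmeasurable_real; exact: measurable_damp.
    apply: CmeasurableM; first exact: Cm_FT.
    by apply: Cmeasurable_expi; exact: measurable_funM.
  have Lh : L1 h := le_L1 mh hD ID.
  rewrite /AbelFourier Normc.normcM normc_real.
  have -> : Cintegral [set: R] (fun l => FT f l * expi (l * x) * (expR (- (e * `|l|)))%:C) = CI h by [].
  apply: (@le_trans _ _ (normc (CI h))).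
    rewrite ler_piMl ?normc_ge0// gtr0_norm ?invr_gt0 ?mulr_gt0 ?pi_gt0//.
    by rewrite invf_le1 ?mulr_gt0 ?pi_gt0//; have := pi_ge2 R; lra.
  apply: (le_trans (normc_CI Lh)); apply: le_Rintegral => //; exact: L1_norm.
have b1 : `|Re (f x)| <= \int[mu]_l D l.
  apply: (@cvgr_to_le _ _ _ _ _ _ _ (cvg_norm l1)).
  exists 1; first exact: ltr01.
  move=> e _ e0; apply: (le_trans (le_Re_normc _)); exact: bound.
have b2 : `|Im (f x)| <= \int[mu]_l D l.
  apply: (@cvgr_to_le _ _ _ _ _ _ _ (cvg_norm l2)).
  exists 1; first exact: ltr01.
  move=> e _ e0; apply: (le_trans (le_Im_normc _)); exact: bound.
rewrite (le_trans (normc_le_ReIm _))//; lra.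
Qed.

End FourierInversion.

(** * Wiener's lemma *)

Section WienerAlgebra.
Context {R : realType}.
Notation mu := (@lebesgue_measure R).
Notation TR := (measurableTypeR R).
Implicit Types F G : R -> R[i].

(** Membership in the algebra of constants plus transforms of integrable functions, with norm at
    most [N]. A bound in place of a norm keeps the choice of the representation [a + FT h] out of
    the computations. *)
Definition wiener_le F (N : R) := exists a h,
  [/\ L1 h, forall l, F l = a + FT h l & normc a + nrm h <= N].

Lemma nrm0 : nrm (fun=> 0 : R[i]) = 0.
Proof.
rewrite /nrm; under eq_Rintegral do rewrite Normc.normc0.
by rewrite /Rintegral integral0.
Qed.

Lemma wiener_le_cst (c : R[i]) : wiener_le (fun=> c) (normc c).
Proof.
exists c, (fun=> 0); split; first exact: L10.
  by move=> l; rewrite FT0 addr0.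
by rewrite nrm0 addr0.
Qed.

Lemma wiener_le_FT h : L1 h -> wiener_le (FT h) (nrm h).
Proof.
by move=> Lh; exists 0, h; split => // [l|]; rewrite ?add0r// Normc.normc0 add0r.
Qed.

Lemma wiener_le_mono F N M : N <= M -> wiener_le F N -> wiener_le F M.
Proof. by move=> NM [a [h [Lh e n]]]; exists a, h; split => //; apply: le_trans NM. Qed.

Lemma wiener_le_ge0 F N : wiener_le F N -> 0 <= N.
Proof. by move=> [a [h [Lh e]]]; apply: le_trans; rewrite addr_ge0 ?normc_ge0 ?nrm_ge0. Qed.

Lemma wiener_leD F G N M : wiener_le F N -> wiener_le G M ->
  wiener_le (fun l => F l + G l) (N + M).
Proof.
move=> [a [h [Lh eh nh]]] [b [g [Lg eg ng]]]; exists (a + b), (fun x => h x + g x).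
split; first exact: L1D.
  by move=> l; rewrite eh eg FTD//; ring.
have := nrmD Lh Lg; have := normc_leD a b; lra.
Qed.

Lemma wiener_leM F G N M : wiener_le F N -> wiener_le G M ->
  wiener_le (fun l => F l * G l) (N * M).
Proof.
move=> wF wG; have N0 := wiener_le_ge0 wF; have M0 := wiener_le_ge0 wG.
move: wF wG => [a [h [Lh eh nh]]] [b [g [Lg eg ng]]].
have La := L1Zl a Lg; have Lb := L1Zl b Lh; have Lc := L1_conv Lh Lg.
exists (a * b), (fun x => (a * g x + b * h x) + conv h g x).
split; first by apply: L1D => //; exact: L1D.
  by move=> l; rewrite eh eg !FTD ?FTZ ?FT_conv//; [ring|exact: L1D].
apply: (@le_trans _ _ ((normc a + nrm h) * (normc b + nrm g))); last first.
  by rewrite ler_pM// addr_ge0 ?normc_ge0 ?nrm_ge0.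
have h1 := nrmD (L1D La Lb) Lc; have h2 := nrmD La Lb; have h3 := nrm_conv Lh Lg.
have e1 : nrm (fun x => a * g x) = normc a * nrm g := nrmZ a Lg.
have e2 : nrm (fun x => b * h x) = normc b * nrm h := nrmZ b Lh.
rewrite Normc.normcM mulrDl !mulrDr; rewrite e1 e2 in h2.
have e3 : normc b * nrm h = nrm h * normc b by rewrite mulrC.
lra.
Qed.

Lemma wiener_leX F N n : wiener_le F N -> wiener_le (fun l => F l ^+ n) (N ^+ n).
Proof.
move=> wF; elim: n => [|n IH].
  by have := wiener_le_cst 1; rewrite Normc.normc1.
under eq_fun do rewrite exprS; rewrite exprS; exact: wiener_leM.
Qed.

Lemma wiener_le_sum (I : Type) (s : seq I) (F : I -> R -> R[i]) (N : I -> R) :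
  (forall i, wiener_le (F i) (N i)) ->
  wiener_le (fun l => \sum_(i <- s) F i l) (\sum_(i <- s) N i).
Proof.
move=> wF; elim: s => [|i s IH].
  rewrite big_nil; have := wiener_le_cst 0; rewrite Normc.normc0.
  by congr wiener_le; apply/funext => l; rewrite big_nil.
rewrite big_cons; have := wiener_leD (wF i) IH.
by congr wiener_le; apply/funext => l; rewrite big_cons.
Qed.

Lemma wiener_leMn F N n : wiener_le F N -> wiener_le (fun l => F l *+ n) (N *+ n).
Proof.
move=> wF; elim: n => [|n IH].
  by have := wiener_le_cst 0; rewrite Normc.normc0.
under eq_fun do rewrite mulrS; rewrite mulrS; exact: wiener_leD.
Qed.

(** Binomial expansion: adding an element of norm at most [eta] raises the growth rate of the powers
    from [p] to at most [p + eta], with the same constant [C]. This carries the spectral radius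
    estimate from a dense class to all elements. *)
Lemma wiener_le_exprD F G (C p eta : R) n :
  (forall k, wiener_le (fun l => F l ^+ k) (C * p ^+ k)) -> wiener_le G eta ->
  wiener_le (fun l => (F l + G l) ^+ n) (C * (p + eta) ^+ n).
Proof.
move=> wF wG; rewrite addrC exprDn mulr_sumr.
under eq_fun do rewrite addrC exprDn.
apply: wiener_le_sum => i.
rewrite mulrnAr; apply: wiener_leMn; rewrite mulrCA.
by apply: wiener_leM => //; exact: wiener_leX.
Qed.

(** [s ^+ k] is at most each of the [k] preceding powers, and their geometric sum is below
    [(1 - s)^-1]. It absorbs the polynomial factor in [wiener_le_nice_expr]. *)
Lemma natmul_expr_le (s : R) k : 0 <= s < 1 -> k%:R * s ^+ k <= (1 - s)^-1.
Proof.
move=> /andP[s0 s1]; have p : 0 < 1 - s by rewrite subr_gt0.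
rewrite -[leRHS]mul1r ler_pdivlMr//.
have h : k%:R * s ^+ k <= \sum_(i < k) s ^+ i.
  rewrite mulr_natl -[X in _ *+ X](card_ord k) -sumr_const.
  by apply: ler_sum => i _; apply: ler_wiXn2l => //; [exact: ltW|exact: ltnW].
apply: (@le_trans _ _ ((\sum_(i < k) s ^+ i) * (1 - s))); first by rewrite ler_wpM2r// ltW.
have -> : (\sum_(i < k) s ^+ i) * (1 - s) = 1 - s ^+ k.
  by rewrite -[RHS]opprB subrX1; ring.
by rewrite gerBl exprn_ge0.
Qed.

Lemma ae_nrm F G : Cm F -> Cm G -> {ae mu, forall x, F x = G x} -> nrm F = nrm G.
Proof.
move=> mF mG FG; congr fine; apply: ae_eq_integral => //.
- by apply/measurable_EFinP; exact: measurable_normc.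
- by apply/measurable_EFinP; exact: measurable_normc.
- by move: FG; apply: ae_imp => x ->.
Qed.

Lemma Cm_sum (h : nat -> R -> R[i]) n : (forall k, Cm (h k)) ->
  Cm (fun x => \sum_(k < n) h k x).
Proof.
move=> mh; elim: n => [|n IH].
  under eq_fun do rewrite big_ord0; exact: Cmeasurable_cst.
by under eq_fun do rewrite big_ord_recr; exact: CmeasurableD.
Qed.

Lemma L1_sum (h : nat -> R -> R[i]) n : (forall k, L1 (h k)) ->
  L1 (fun x => \sum_(k < n) h k x).
Proof.
move=> mh; elim: n => [|n IH].
  under eq_fun do rewrite big_ord0; exact: L10.
by under eq_fun do rewrite big_ord_recr; exact: L1D.
Qed.

Lemma FT_sum (h : nat -> R -> R[i]) n l : (forall k, L1 (h k)) ->
  FT (fun x => \sum_(k < n) h k x) l = \sum_(k < n) FT (h k) l.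
Proof.
move=> Lh; elim: n => [|n IH].
  rewrite big_ord0 -[RHS](FT0 l).
  by apply: (congr1 (fun F => FT F l)); apply/funext => x; rewrite big_ord0.
rewrite big_ord_recr/= -IH -FTD//; last exact: L1_sum.
by apply: (congr1 (fun F => FT F l)); apply/funext => x; rewrite big_ord_recr.
Qed.

Lemma normc_sum n (z : 'I_n -> R[i]) : normc (\sum_(k < n) z k) <= \sum_(k < n) normc (z k).
Proof.
elim: n z => [|n IH] z; first by rewrite !big_ord0 Normc.normc0.
by rewrite !big_ord_recr/= (le_trans (normc_leD _ _))// lerD2r.
Qed.

Lemma Re_sum n (z : 'I_n -> R[i]) : Re (\sum_(k < n) z k) = \sum_(k < n) Re (z k).
Proof.
by elim: n z => [|n IH] z; [rewrite !big_ord0|rewrite !big_ord_recr/= cReD IH].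
Qed.

Lemma Im_sum n (z : 'I_n -> R[i]) : Im (\sum_(k < n) z k) = \sum_(k < n) Im (z k).
Proof.
by elim: n z => [|n IH] z; [rewrite !big_ord0|rewrite !big_ord_recr/= cImD IH].
Qed.

Lemma is_cvg_series_bound (u : nat -> R) (M : R) :
  (forall n, \sum_(k < n) `|u k| <= M) -> cvgn (fun n => \sum_(k < n) u k).
Proof.
move=> uM; have -> : (fun n => \sum_(k < n) u k) = series u.
  by apply/funext => n; rewrite /series/= big_mkord.
have E n : [normed series u] n = \sum_(k < n) `|u k| by rewrite [LHS](_ : _ = series (fun k => `|u k|) n)// seriesEord.
apply: normed_cvg; apply: nondecreasing_is_cvgn.
  by apply/nondecreasing_seqP => n; rewrite !E big_ord_recr/= lerDl.
by exists M => _ [n _ <-]; rewrite E.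
Qed.

(** Completeness of [L^1] for absolutely convergent series: the series [G] of the moduli has a
    finite integral, so it is finite off a null set, where it dominates all partial sums. *)
Lemma L1_series (h : nat -> R -> R[i]) (C : R) : (forall k, L1 (h k)) ->
  (forall n, \sum_(k < n) nrm (h k) <= C) ->
  exists2 s, L1 s & nrm (fun x => \sum_(k < n) h k x - s x) @[n --> \oo] --> 0.
Proof.
move=> Lh hC; have mh k := L1_measurable (Lh k).
pose G (x : R) := (\sum_(k <oo) (normc (h k x))%:E)%E.
have mn k : measurable_fun setT (fun x : TR => (normc (h k x))%:E).
  by apply/measurable_EFinP; exact: measurable_normc.
have n0 k x : (0 <= (normc (h k x))%:E)%E by rewrite lee_fin normc_ge0.
have G0 x : (0 <= G x)%E by apply: nneseries_ge0 => k _ _; exact: n0.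
have mG : measurable_fun setT (G : TR -> \bar R).
  by apply: ge0_emeasurable_sum => // k x _ _; exact: n0.
have intG : (\int[mu]_x G x <= C%:E)%E.
  rewrite integral_nneseries//.
  apply: lime_le; first by apply: is_cvg_nneseries => k _ _; exact: L1norm_ge0.
  apply: nearW => n; rewrite big_mkord.
  rewrite (eq_bigr (fun k : 'I_n => (nrm (h k))%:E)); last by move=> k _; rewrite -nrmE.
  by have := hC n; rewrite -lee_fin -sumEFin.
have IG : mu.-integrable setT (G : TR -> \bar R).
  apply/integrableP; split => //.
  under eq_integral do rewrite gee0_abs//.
  by rewrite (le_lt_trans intG)// ltry.
have [N [mN N0 subN]] := integrable_ae measurableT IG.
pose Z : set TR := ~` N.
have mZ : measurable Z by exact: measurableC.
have GZ x : Z x -> G x \is a fin_num.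
  by move=> Zx; apply: contrapT => nG; apply: Zx; apply: subN => /= /(_ I).
pose g x := fine (G x).
have g0 x : 0 <= g x by rewrite fine_ge0.
have Ig : mu.-integrable setT (EFin \o g).
  apply: le_integrable (IG) => //.
    by apply/measurable_EFinP; apply: measurableT_comp.
  move=> x _ /=; rewrite /g; case: (G x) => [r| |]//=; rewrite normr0 leey//.
have gZ x n : Z x -> \sum_(k < n) normc (h k x) <= g x.
  move=> Zx; rewrite -lee_fin -sumEFin /g fineK ?GZ// -(big_mkord xpredT (fun k => (normc (h k x))%:E)).
  exact: nneseries_lim_ge.
(* Cutting off to [Z], where [G] is finite, makes convergence and domination hold at every point. *)
pose h' k x := Cind Z x * h k x.
pose S n x := \sum_(k < n) h' k x.
have Lh' k : L1 (h' k) by exact: L1_ind.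
have bnd x n : \sum_(k < n) normc (h' k x) <= g x.
  have [Zx|nZx] := pselect (Z x).
    apply: le_trans (gZ x n Zx); apply: ler_sum => k _.
    by rewrite Normc.normcM ler_piMl ?normc_ge0// normc_ind_le.
  rewrite big1// => k _.
  by rewrite /h' CindF// mul0r Normc.normc0.
have cRe x : cvgn (fun n => \sum_(k < n) Re (h' k x)).
  apply: (@is_cvg_series_bound (fun k => Re (h' k x)) (g x)) => n; apply: le_trans (bnd x n).
  by apply: ler_sum => k _; exact: le_Re_normc.
have cIm x : cvgn (fun n => \sum_(k < n) Im (h' k x)).
  apply: (@is_cvg_series_bound (fun k => Im (h' k x)) (g x)) => n; apply: le_trans (bnd x n).
  by apply: ler_sum => k _; exact: le_Im_normc.
pose s x : R[i] := limn (fun n => \sum_(k < n) Re (h' k x)) +i*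
                   limn (fun n => \sum_(k < n) Im (h' k x)).
have mS n : Cm (S n) by apply: Cm_sum => k; exact: L1_measurable.
have Ss x : normc (S n x - s x) @[n --> \oo] --> 0.
  apply: normc_cvg0.
    by under eq_fun do rewrite Re_sum; exact: cRe.
  by under eq_fun do rewrite Im_sum; exact: cIm.
have ms : Cm s.
  split.
    apply: (@measurable_fun_cvg _ _ _ _ (fun n x => Re (S n x))); first by move=> n; case: (mS n).
    by move=> x _; under eq_fun do rewrite Re_sum; exact: cRe.
  apply: (@measurable_fun_cvg _ _ _ _ (fun n x => Im (S n x))); first by move=> n; case: (mS n).
  by move=> x _; under eq_fun do rewrite Im_sum; exact: cIm.
have Sg n x : normc (S n x) <= g x by apply: le_trans (bnd x n); exact: normc_sum.
have sg x : normc (s x) <= g x.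
  apply/ler_addgt0Pr => e e0.
  have /cvgrPdist_le/(_ e e0)[n _ /(_ n (leqnn n))] := Ss x.
  rewrite sub0r normrN ger0_norm ?normc_ge0// => H.
  have -> : s x = S n x - (S n x - s x) by ring.
  by rewrite (le_trans (normc_leB _ _))// lerD.
exists s; first exact: le_L1 ms sg Ig.
have -> : (fun n => nrm (fun x => \sum_(k < n) h k x - s x)) = (fun n => nrm (fun x => S n x - s x)).
  apply/funext => n; apply: ae_nrm.
  - by apply: CmeasurableB => //; exact: Cm_sum.
  - exact: CmeasurableB.
  - exists N; split => //; apply: subsetCl => x Zx /=; rewrite /S; congr (_ - _).
    by apply: eq_bigr => k _; rewrite /h' CindT// mul1r.
exact: L1_dct mS ms (ae_all Ss) Sg sg Ig.
Qed.

Lemma normc_cvg_uniq (z : nat -> R[i]) (a b : R[i]) :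
  normc (z n - a) @[n --> \oo] --> 0 -> normc (z n - b) @[n --> \oo] --> 0 -> a = b.
Proof.
move=> za zb; apply/eqP; rewrite -subr_eq0 -normc_eq0; apply/eqP/le_anti.
rewrite normc_ge0 andbT; apply/ler_addgt0Pr => e e0; rewrite add0r.
have e2 : 0 < e / 2 by rewrite divr_gt0.
have /cvgrPdist_le/(_ _ e2) h1 := za; have /cvgrPdist_le/(_ _ e2) h2 := zb.
have [n _ /(_ n (leqnn n)) /= []] := filterI h1 h2.
rewrite !sub0r !normrN !ger0_norm ?normc_ge0// => a1 b1.
have -> : a - b = (z n - b) - (z n - a) by ring.
by rewrite (le_trans (normc_leB _ _))// (splitr e) lerD.
Qed.

Definition in_wiener F := exists a h, L1 h /\ forall l, F l = a + FT h l.

Lemma wiener_le_in F N : wiener_le F N -> in_wiener F.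
Proof. by move=> [a [h [Lh e _]]]; exists a, h. Qed.

Lemma in_wiener_le F : in_wiener F -> exists N, wiener_le F N.
Proof. by move=> [a [h [Lh e]]]; exists (normc a + nrm h), a, h. Qed.

Lemma in_wienerM F G : in_wiener F -> in_wiener G -> in_wiener (fun l => F l * G l).
Proof.
move=> /in_wiener_le[N wF] /in_wiener_le[M wG]; exact: wiener_le_in (wiener_leM wF wG).
Qed.

(** Completeness of the algebra: constants and integrable parts are summed separately, and the sum
    is identified with the pointwise limit [G] because convergence in [L^1] implies convergence of
    the transforms. *)
Lemma in_wiener_series (F : nat -> R -> R[i]) (N : nat -> R) (C : R) G :
  (forall k, wiener_le (F k) (N k)) -> (forall n, \sum_(k < n) N k <= C) ->
  (forall l, normc (\sum_(k < n) F k l - G l) @[n --> \oo] --> 0) -> in_wiener G.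
Proof.
move=> wF NC FG.
have [a Ha] : {a & forall k, exists h, [/\ L1 h, forall l, F k l = a k + FT h l & normc (a k) + nrm h <= N k]}.
  by have /choice[a Ha] := wF; exists a.
have [h Hh] := choice Ha.
have Lh k : L1 (h k) by case: (Hh k).
have an k : normc (a k) <= N k.
  by case: (Hh k) => _ _; apply: le_trans; rewrite lerDl nrm_ge0.
have hn k : nrm (h k) <= N k.
  by case: (Hh k) => _ _; apply: le_trans; rewrite lerDr normc_ge0.
have [|s Ls hs] := @L1_series h C Lh.
  by move=> n; apply: le_trans (NC n); apply: ler_sum => k _.
have cRe : cvgn (fun n => \sum_(k < n) Re (a k)).
  apply: (@is_cvg_series_bound (fun k => Re (a k)) C) => n; apply: le_trans (NC n).
  by apply: ler_sum => k _; apply: le_trans (an k); exact: le_Re_normc.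
have cIm : cvgn (fun n => \sum_(k < n) Im (a k)).
  apply: (@is_cvg_series_bound (fun k => Im (a k)) C) => n; apply: le_trans (NC n).
  by apply: ler_sum => k _; apply: le_trans (an k); exact: le_Im_normc.
pose b : R[i] := limn (fun n => \sum_(k < n) Re (a k)) +i*
                 limn (fun n => \sum_(k < n) Im (a k)).
have ab : normc (\sum_(k < n) a k - b) @[n --> \oo] --> 0.
  apply: normc_cvg0.
    by under eq_fun do rewrite Re_sum; exact: cRe.
  by under eq_fun do rewrite Im_sum; exact: cIm.
exists b, s; split => // l; apply: normc_cvg_uniq (FG l) _.
have FE n : \sum_(k < n) F k l - (b + FT s l) =
    (\sum_(k < n) a k - b) + FT (fun x => \sum_(k < n) h k x - s x) l.
  rewrite FTB//; last exact: L1_sum.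
  rewrite FT_sum//.
  rewrite (eq_bigr (fun k : 'I_n => a k + FT (h k) l)); last by move=> k _; case: (Hh k).
  by rewrite big_split/=; ring.
have H : normc (\sum_(k < n) a k - b) + nrm (fun x => \sum_(k < n) h k x - s x) @[n --> \oo] --> 0.
  by rewrite -[X in _ --> X]addr0; exact: cvgD.
apply: (squeeze_cvgr _ (cvg_cst 0) H); apply: nearW => n.
rewrite normc_ge0/= FE (le_trans (normc_leD _ _))// lerD2l.
by apply: FT_le; apply: L1B => //; exact: L1_sum.
Qed.

End WienerAlgebra.

(** * Density of compactly supported functions with rapidly decaying transform *)

Section Density.
Context {R : realType}.
Notation mu := (@lebesgue_measure R).
Notation TR := (measurableTypeR R).

Definition box (d x : R) : R[i] := ((2 * d)^-1)%:C * Cind (`[- d, d] : set R) x.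

Lemma L1_ind_itv (a b : R) : L1 (Cind (`[a, b] : set R)).
Proof.
apply: (@le_L1 _ _ (\1_`[a, b])).
- exact: Cmeasurable_ind.
- by move=> x; rewrite normc_real ger0_norm// indicE.
- exact: integrable_indic_itv.
Qed.

Lemma L1_box (d : R) : L1 (box d).
Proof. exact: L1Zl (L1_ind_itv _ _). Qed.

Lemma CI_box (d : R) : 0 < d -> CI (box d) = 1.
Proof.
move=> d0; rewrite /box CIZl; last exact: L1_ind_itv.
have -> : CI (Cind (`[- d, d] : set R)) = (2 * d)%:C.
  apply: complexP; rewrite /CI/=; last by rewrite /Rintegral integral0.
  rewrite /Rintegral integral_indic//= setIT lebesgue_measure_itv/= lte_fin.
  by rewrite (lt_trans _ d0) ?oppr_lt0//= opprK mulr_natl mulr2n.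
by rewrite -rmorphM mulVf// gt_eqF// mulr_gt0.
Qed.

Lemma box_real (d x : R) : 0 < d -> box d x = (normc (box d x))%:C.
Proof.
move=> d0; rewrite /box -rmorphM normc_real ger0_norm//.
by rewrite mulr_ge0 ?indicE// invr_ge0 mulr_ge0// ltW.
Qed.

Lemma nrm_box (d : R) : 0 < d -> nrm (box d) = 1.
Proof.
move=> d0; transitivity (Re (CI (box d))); last by rewrite CI_box.
by apply: eq_Rintegral => x _; rewrite [in RHS]box_real.
Qed.

Lemma FT_box_le1 (d l : R) : 0 < d -> normc (FT (box d) l) <= 1.
Proof. by move=> d0; rewrite -(nrm_box d0); apply: FT_le; exact: L1_box. Qed.

Lemma Rintegral_FTC (f F : R -> R) (a b : R) : a < b -> continuous f ->
  (forall x : R, is_derive x 1 F (f x)) -> \int[mu]_(x in `[a, b]) f x = F b - F a.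
Proof.
move=> ab cf dF; have cF : continuous F.
  by move=> x; apply: differentiable_continuous; apply/derivable1_diffP.
rewrite /Rintegral (@continuous_FTC2 _ f F)//.
- exact: continuous_subspaceT.
- split => //; first exact/cvg_at_right_filter/cF.
  exact/cvg_at_left_filter/cF.
- by move=> x _; rewrite derive1E; exact: derive_val.
Qed.

(** Integrating the cosine and the sine gains a factor [1 / l]. Only the order of decay is used
    later, so real and imaginary parts are estimated separately. *)
Lemma FT_box_decay (d l : R) : 0 < d -> l != 0 -> normc (FT (box d) l) <= 2 / (d * `|l|).
Proof.
move=> d0 l0.
have dl (x : R) : is_derive x 1 (fun t : R => l * t) l.
  by apply: is_derive_eq; rewrite /GRing.scale/= mulr1.
have ds (x : R) : is_derive x 1 (fun t : R => sin (l * t)) (cos (l * x) * l).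
  exact: (@is_derive1_comp _ sin (fun t : R => l * t) x _ _ (is_derive_sin (l * x)) (dl x)).
have dc (x : R) : is_derive x 1 (fun t : R => cos (l * t)) (- sin (l * x) * l).
  exact: (@is_derive1_comp _ cos (fun t : R => l * t) x _ _ (is_derive_cos (l * x)) (dl x)).
have dd : - d < d by rewrite (lt_trans _ d0)// oppr_lt0.
have cc : continuous (fun x : R => cos (l * x)).
  by move=> x; apply: differentiable_continuous; apply/derivable1_diffP; have h := dc x; exact: ex_derive.
have cs : continuous (fun x : R => - sin (l * x)).
  move=> x; apply: differentiable_continuous; apply/derivable1_diffP.
  by apply: derivableN; have h := ds x; exact: ex_derive.
have Ic : \int[mu]_(x in `[- d, d]) cos (l * x) = l^-1 * sin (l * d) - l^-1 * sin (l * - d).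
  apply: (@Rintegral_FTC _ (fun t => l^-1 * sin (l * t))) => // x.
  by have h := ds x; apply: is_derive_eq; rewrite /GRing.scale/= mulrCA mulVf// mulr1.
have Is : \int[mu]_(x in `[- d, d]) - sin (l * x) = l^-1 * cos (l * d) - l^-1 * cos (l * - d).
  apply: (@Rintegral_FTC _ (fun t => l^-1 * cos (l * t))) => // x.
  by have h := dc x; apply: is_derive_eq; rewrite /GRing.scale/= mulrCA mulVf// mulr1.
have E : FT (box d) l = ((2 * d)^-1)%:C *
    ((\int[mu]_(x in `[- d, d]) cos (l * x)) +i* (\int[mu]_(x in `[- d, d]) - sin (l * x))).
  have -> : FT (box d) l = ((2 * d)^-1)%:C *
      CI (fun x => Cind (`[- d, d] : set R) x * expi (- (l * x))).
    rewrite -CIZl; last first.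
      have := L1_expiNM l (L1_ind_itv (- d) d); congr L1; apply/funext => x; exact: mulrC.
    by congr CI; apply/funext => x; rewrite /box; ring.
  congr (_ * _); rewrite -Cintegral_ind// /Cintegral; congr (_ +i* _).
    by apply: eq_Rintegral => x _; rewrite /= cosN.
  by apply: eq_Rintegral => x _; rewrite /= sinN.
have bnd (a b : R) : `|a| <= 1 -> `|b| <= 1 -> `|l^-1 * a - l^-1 * b| <= 2 / `|l|.
  move=> a1 b1; rewrite -mulrBr normrM normfV mulrC ler_pM2r ?invr_gt0 ?normr_gt0//.
  by rewrite (le_trans (ler_normB _ _))// -[leRHS]/(1 + 1) lerD.
have s1 (t : R) : `|sin t| <= 1 by rewrite ler_norml sin_geN1 sin_le1.
have c1 (t : R) : `|cos t| <= 1 by rewrite ler_norml cos_geN1 cos_le1.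
rewrite E Normc.normcM normc_real ger0_norm ?invr_ge0 ?mulr_ge0 ?(ltW d0)//.
have h : normc ((\int[mu]_(x in `[- d, d]) cos (l * x)) +i* (\int[mu]_(x in `[- d, d]) - sin (l * x))) <= 2 / `|l| + 2 / `|l|.
  apply: (le_trans (normc_le_ReIm _)); rewrite /= Ic Is lerD//; exact: bnd.
apply: (@le_trans _ _ ((2 * d)^-1 * (2 / `|l| + 2 / `|l|))).
  by rewrite ler_wpM2l// invr_ge0 mulr_ge0// ltW.
rewrite le_eqVlt; apply/orP; left; apply/eqP.
by field; rewrite normr_eq0 l0 gt_eqF.
Qed.

(** Compact support together with a transform of order [1 / (1 + l^2)]; this decay is expressed
    through [poisson 1], whose integral is known to be 1. *)
Definition nice (phi : R -> R[i]) := exists r K : R,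
  [/\ 0 <= r, 0 <= K, forall x, r < `|x| -> phi x = 0 &
      forall l, normc (FT phi l) <= K * poisson 1 l].

Lemma conv_support (f g : R -> R[i]) (r s : R) :
  (forall x, r < `|x| -> f x = 0) -> (forall x, s < `|x| -> g x = 0) ->
  forall x, r + s < `|x| -> conv f g x = 0.
Proof.
move=> fr gs x xrs; rewrite /conv -[RHS]CI0; congr CI; apply/funext => y.
have [ry|yr] := ltP r `|y|; first by rewrite fr// mul0r.
rewrite gs ?mulr0//; have := ler_normD (x - y) y; rewrite subrK; lra.
Qed.

Lemma box_support (d x : R) : d < `|x| -> box d x = 0.
Proof.
move=> dx; rewrite /box CindF ?mulr0//= in_itv/= -ler_norml; apply/negP.
by rewrite -ltNge.
Qed.

(** Each convolution with a box contributes one factor [1 / l] to the transform, so two of them give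
    quadratic decay. *)
Lemma nice_conv_box (f : R -> R[i]) (d r : R) : 0 < d -> 0 <= r -> L1 f ->
  (forall x, r < `|x| -> f x = 0) -> nice (conv (conv f (box d)) (box d)).
(* In the constant, [1 + 4 / d ^+ 2] bounds [|FT (box d) l|^2 (1 + l^2)] and [pi] compensates the
   normalization of [poisson 1]. *)
Proof.
move=> d0 r0 Lf fr; exists (r + d + d), (nrm f * (1 + 4 / d ^+ 2) * pi).
have c0 : 0 <= 1 + 4 / d ^+ 2 by rewrite addr_ge0// divr_ge0// exprn_ge0// ltW.
split.
- by rewrite !addr_ge0// ltW.
- by rewrite !mulr_ge0 ?nrm_ge0 ?pi_ge0.
- apply: conv_support; last exact: box_support.
  apply: conv_support => //; exact: box_support.
move=> l; have Lb := L1_box d; have Lc := L1_conv Lf Lb.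
rewrite !FT_conv// !Normc.normcM.
have b0 : 0 <= normc (FT (box d) l) := normc_ge0 _.
have -> : nrm f * (1 + 4 / d ^+ 2) * pi * poisson 1 l = nrm f * ((1 + 4 / d ^+ 2) / (1 + l ^+ 2)).
  have := pi_gt0 R; rewrite /poisson expr1n; move: (pi : R) => q q0.
  by field; rewrite !gt_eqF// ltr_pwDl ?sqr_ge0.
rewrite -mulrA; apply: ler_pM; rewrite ?normc_ge0 ?mulr_ge0//; first exact: FT_le.
rewrite ler_pdivlMr ?ltr_pwDl ?sqr_ge0// mulrDr mulr1 -expr2 lerD//.
  by rewrite expr_le1// FT_box_le1.
have [->|l0] := eqVneq l 0; first by rewrite expr0n mulr0 divr_ge0// exprn_ge0// ltW.
have h := FT_box_decay d0 l0.
have -> : 4 / d ^+ 2 = (2 / (d * `|l|)) ^+ 2 * l ^+ 2.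
  rewrite -[l ^+ 2]real_normK ?num_real//; field.
  by rewrite normr_eq0 l0 gt_eqF.
by rewrite ler_wpM2r ?sqr_ge0// lerXn2r// nnegrE// divr_ge0// mulr_ge0// ltW.
Qed.

Lemma L1_conv_box (f : R -> R[i]) (d x : R) : 0 < d -> L1 f ->
  L1 (fun y => f y * box d (x - y)).
Proof.
move=> d0 Lf; have := @L1_bounded _ (fun y => box d (x - y)) f ((2 * d)^-1) _ _ Lf.
rewrite (_ : (fun y => box d (x - y) * f y) = (fun y => f y * box d (x - y))); last first.
  by apply/funext => y; rewrite mulrC.
apply.
  by apply: L1_measurable; exact: L1_sub (L1_box d).
move=> y; rewrite Normc.normcM normc_real gtr0_norm ?invr_gt0 ?mulr_gt0//.
by rewrite ler_piMr ?invr_ge0 ?mulr_ge0 ?(ltW d0)// normc_ind_le.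
Qed.

Lemma conv_box_pt (f : R -> R[i]) (x eta : R) : 0 < eta -> L1 f ->
  lebesgue_pt (fun y => Re (f y)) x -> lebesgue_pt (fun y => Im (f y)) x ->
  exists2 delta : R, 0 < delta & forall d, 0 < d -> d < delta ->
    normc (conv f (box d) x - f x) <= 4 * eta.
Proof.
move=> eta0 Lf /(lebesgue_pt_bound eta0)[d1 d10 H1] /(lebesgue_pt_bound eta0)[d2 d20 H2].
have [mRe mIm] := L1_measurable Lf.
exists (Num.min d1 d2 / 2); first by rewrite divr_gt0// lt_min d10.
move=> d d0; rewrite ltr_pdivlMr// lt_min => /andP[dd1 dd2].
have Lfb := L1_conv_box x d0 Lf.
have Lb : L1 (fun y => f x * box d (x - y)) := L1Zl (f x) (L1_sub x (L1_box d)).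
have -> : conv f (box d) x - f x = CI (fun y => (f y - f x) * box d (x - y)).
  have fxE : f x = CI (fun y => f x * box d (x - y)).
    by rewrite CIZl ?CI_sub ?CI_box ?mulr1//; [exact: L1_box|exact: L1_sub (L1_box d)].
  by rewrite [X in _ - X]fxE -CIB//; congr CI; apply/funext => y; rewrite mulrBl.
have mF : Cm (fun y => (f y - f x) * box d (x - y)).
  have := L1_measurable (L1B Lfb Lb); congr Cmeasurable.
  by apply/funext => y; rewrite mulrBl.
rewrite -lee_fin; apply: (le_trans (normc_CI_le mF)).
(* The closed interval of radius [d] lies in the open ball of radius [2 d]. This doubling and the
   split into real and imaginary parts produce the factor 4. *)
pose B : set R := ball x (d * 2).
have mB : measurable B by exact: measurable_ball.
have d20' : 0 < d * 2 by rewrite mulr_gt0.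
pose g1 y := \1_B y * `|Re (f y) - Re (f x)|.
pose g2 y := \1_B y * `|Im (f y) - Im (f x)|.
have g10 y : 0 <= g1 y by rewrite mulr_ge0// indicE.
have g20 y : 0 <= g2 y by rewrite mulr_ge0// indicE.
have mg1 : measurable_fun setT (g1 : TR -> TR).
  apply: measurable_funM; first exact: measurable_indic.
  by apply: measurableT_comp => //; apply: measurable_funB.
have mg2 : measurable_fun setT (g2 : TR -> TR).
  apply: measurable_funM; first exact: measurable_indic.
  by apply: measurableT_comp => //; apply: measurable_funB.
apply: (@le_trans _ _ (\int[mu]_y ((2 * d)^-1 * (g1 y + g2 y))%:E)%E).
  apply: L1norm_le => //.
    by apply: measurable_funM => //; apply: measurable_funD.
  move=> y; rewrite Normc.normcM mulrC.
  have [yB|yB] := leP `|x - y| d; last first.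
    by rewrite box_support// Normc.normc0 mul0r mulr_ge0 ?addr_ge0// invr_ge0 mulr_ge0// ltW.
  apply: ler_pM; rewrite ?normc_ge0//.
    rewrite /box Normc.normcM normc_real gtr0_norm ?invr_gt0 ?mulr_gt0//.
    by rewrite ler_piMr ?invr_ge0 ?mulr_ge0 ?(ltW d0)// normc_ind_le.
  rewrite /g1 /g2 indicE mem_set ?mul1r; last first.
    by rewrite /B /ball/= (le_lt_trans yB)// ltr_pMr// ltr1n.
  by rewrite (le_trans (normc_le_ReIm _))// cReD cImD cReN cImN.
have i1 : (\int[mu]_y (g1 y)%:E <= (eta * (d * 2 *+ 2))%:E)%E.
  apply: le_trans (H1 _ d20' (ltW dd1)); rewrite le_eqVlt; apply/orP; left; apply/eqP.
  rewrite [RHS]integral_mkcond; apply: eq_integral => y _.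
  by rewrite patchE /g1 indicE; case: ifPn => _; rewrite ?mul1r ?mul0r.
have i2 : (\int[mu]_y (g2 y)%:E <= (eta * (d * 2 *+ 2))%:E)%E.
  apply: le_trans (H2 _ d20' (ltW dd2)); rewrite le_eqVlt; apply/orP; left; apply/eqP.
  rewrite [RHS]integral_mkcond; apply: eq_integral => y _.
  by rewrite patchE /g2 indicE; case: ifPn => _; rewrite ?mul1r ?mul0r.
under eq_integral do rewrite EFinM EFinD.
rewrite ge0_integralZl//; last 3 first.
- by apply: emeasurable_funD; exact/measurable_EFinP.
- by move=> y _; apply: adde_ge0; rewrite lee_fin.
- by rewrite lee_fin invr_ge0 mulr_ge0// ltW.
rewrite ge0_integralD//; last 4 first.
- by move=> y _; rewrite lee_fin.
- exact/measurable_EFinP.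
- by move=> y _; rewrite lee_fin.
- exact/measurable_EFinP.
apply: (le_trans (lee_wpmul2l _ (leeD i1 i2))).
  by rewrite lee_fin invr_ge0 mulr_ge0// ltW.
rewrite -EFinD -EFinM lee_fin le_eqVlt; apply/orP; left; apply/eqP.
by field; rewrite gt_eqF.
Qed.

(** Box averages converge at Lebesgue points, and dominated convergence applies: an average of mass
    1 keeps the bound [M], and half-widths at most 1 keep the support within radius [N + 1]. *)
Lemma conv_box_cvg (f : R -> R[i]) (N M : R) : L1 f -> 0 <= M ->
  (forall x, N < `|x| -> f x = 0) -> (forall x, normc (f x) <= M) ->
  nrm (fun x => conv f (box n.+1%:R^-1) x - f x) @[n --> \oo] --> 0.
Proof.
move=> Lf M0 fN fM; pose b n : R := n.+1%:R^-1.
have b0 n : 0 < b n by rewrite invr_gt0.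
have b1 n : b n <= 1 by rewrite invf_le1// ler1n.
apply: (@L1_dct _ (fun n => conv f (box (b n))) f (fun x => M * \1_(`[- (N + 1), N + 1] : set R) x)).
- by move=> n; apply: L1_measurable; apply: L1_conv => //; exact: L1_box.
- exact: L1_measurable.
- have [f1 f2] := Lf; have := ae_lebesgue_pt f2; have := ae_lebesgue_pt f1.
  apply: ae_imp2 => x l1 l2; apply/cvgrPdist_le => e e0.
  have e4 : 0 < e / 4 by rewrite divr_gt0.
  have [delta delta0 H] := conv_box_pt e4 Lf l1 l2.
  have := near_infty_natSinv_lt (PosNum delta0); apply: filterS => n /= nd.
  rewrite sub0r normrN ger0_norm ?normc_ge0// (le_trans (H _ (b0 n) nd))//.
  by rewrite mulrC divfK.
- move=> n x; have [xN|xN] := leP `|x| (N + 1); last first.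
    rewrite (@conv_support _ _ N (b n))// ?Normc.normc0 ?mulr_ge0 ?indicE//.
      exact: box_support.
    by rewrite (le_lt_trans _ xN)// lerD2l.
  rewrite indicE mem_set ?mulr1/= ?in_itv/= -?ler_norml//.
  have mF : Cm (fun y => f y * box (b n) (x - y)).
    by apply: CmeasurableM; apply: L1_measurable => //; exact: L1_sub (L1_box (b n)).
  rewrite -lee_fin; apply: (le_trans (normc_CI_le mF)).
  have Lb := L1_sub x (L1_box (b n)).
  apply: (@le_trans _ _ (L1norm (fun y => M%:C * box (b n) (x - y)))).
    apply: L1norm_le => //.
      by apply: measurable_normc; apply: CmeasurableM (L1_measurable Lb); exact: Cmeasurable_cst.
    move=> y; rewrite Normc.normcM [normc (M%:C * _)]Normc.normcM normc_real ger0_norm//.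
    by rewrite ler_wpM2r ?normc_ge0.
  rewrite L1normZ; last exact: L1_measurable.
  rewrite L1norm_sub; last by apply: L1_measurable; exact: L1_box.
  rewrite nrmE; last exact: L1_box.
  by rewrite nrm_box// normc_real ger0_norm// -EFinM mulr1.
- move=> x; have [xN|xN] := leP `|x| (N + 1); last first.
    rewrite fN ?Normc.normc0 ?mulr_ge0 ?indicE//.
    by rewrite (le_lt_trans _ xN)// lerDl.
  by rewrite indicE mem_set ?mulr1/= ?in_itv/= -?ler_norml.
- have := integrable_indic_itv (- (N + 1)) (N + 1) true false.
  by move=> /(integrableZl measurableT M); apply: eq_integrable.
Qed.

Lemma truncate_cvg (f : R -> R[i]) : L1 f -> exists F : nat -> R -> R[i],
  [/\ forall n, L1 (F n), forall n x, n%:R < `|x| -> F n x = 0,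
      forall n x, normc (F n x) <= n%:R &
      nrm (fun x => F n x - f x) @[n --> \oo] --> 0].
Proof.
move=> Lf; have mf := L1_measurable Lf.
pose A n : set TR := `[- n%:R, n%:R] `&` [set x | normc (f x) <= n%:R].
have mA n : measurable (A n).
  apply: measurableI; first exact: measurable_itv.
  rewrite (_ : [set x | _] = (fun x : TR => normc (f x) : TR) @^-1` `]-oo, n%:R]).
    by rewrite -[X in measurable X]setTI; exact: (measurable_normc mf).
  by apply/seteqP; split => x /=; rewrite in_itv.
exists (fun n x => Cind (A n) x * f x); split.
- by move=> n; exact: L1_ind (mA n) Lf.
- move=> n x nx; rewrite CindF ?mul0r// => -[/=].
  by rewrite in_itv/= -ler_norml leNgt nx.
- move=> n x; have [Ax|Ax] := pselect (A n x); last by rewrite CindF ?mul0r ?Normc.normc0.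
  by rewrite CindT// mul1r; case: Ax.
apply: (L1_dct _ mf _ _ (fun x => lexx (normc (f x)))).
- by move=> n; apply: CmeasurableM => //; exact: Cmeasurable_ind.
- apply: ae_all => x; apply/cvgrPdist_le => e e0.
  have := nbhs_infty_ger (Num.max `|x| (normc (f x))).
  apply: filterS => n; rewrite ge_max => /andP[xn fn].
  rewrite CindT ?mul1r ?subrr ?Normc.normc0 ?subrr ?normr0 ?ltW//.
  by split => //=; rewrite in_itv/= -ler_norml.
- by move=> n x; rewrite Normc.normcM ler_piMl ?normc_ge0// normc_ind_le.
- exact: L1_norm.
Qed.

(** Truncate, then average twice with the same box. The error of the second average is the average
    of the first error, and averaging does not increase the norm, so the total error is at most
    three times [e / 3]. *)
Lemma nice_dense (f : R -> R[i]) (e : R) : 0 < e -> L1 f ->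
  exists phi, [/\ L1 phi, nice phi & nrm (fun x => f x - phi x) <= e].
Proof.
move=> e0 Lf; have [F [LF Fsupp Fbnd Fcvg]] := truncate_cvg Lf.
have e3 : 0 < e / 3 by rewrite divr_gt0.
have /cvgrPdist_le/(_ _ e3)[n _ /(_ n (leqnn n)) /=] := Fcvg.
rewrite sub0r normrN ger0_norm ?nrm_ge0// => Fn.
have := conv_box_cvg (LF n) (ler0n _ _) (Fsupp n) (Fbnd n).
move=> /cvgrPdist_le/(_ _ e3)[m _ /(_ m (leqnn m)) /=].
rewrite sub0r normrN ger0_norm ?nrm_ge0//; set d : R := m.+1%:R^-1 => Fm.
have d0 : 0 < d by rewrite invr_gt0.
have Lb := L1_box d; have Lc := L1_conv (LF n) Lb; have Lcc := L1_conv Lc Lb.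
exists (conv (conv (F n) (box d)) (box d)); split => //.
  by apply: (@nice_conv_box _ _ n%:R) => //; exact: Fsupp.
have Ld : L1 (fun x => conv (F n) (box d) x - F n x) := L1B Lc (LF n).
have E x : conv (conv (F n) (box d)) (box d) x - conv (F n) (box d) x =
    conv (fun y => conv (F n) (box d) y - F n y) (box d) x.
  rewrite /conv -CIB; last 2 first.
  - exact: L1_conv_box.
  - exact: L1_conv_box.
  by congr CI; apply/funext => y; rewrite mulrBl.
pose D1 x := conv (fun y => conv (F n) (box d) y - F n y) (box d) x.
pose D2 x := conv (F n) (box d) x - F n x.
pose D3 x := F n x - f x.
have L1_ : L1 D1 by exact: L1_conv.
have L2_ : L1 D2 by [].
have L3_ : L1 D3 := L1B (LF n) Lf.
rewrite (_ : (fun x => _) = (fun x => - (D1 x + D2 x + D3 x))); last first.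
  by apply/funext => x; rewrite /D1 -E /D2 /D3; ring.
rewrite nrm_opp.
have h1 : nrm D1 <= nrm D2 * nrm (box d) := nrm_conv Ld Lb.
rewrite nrm_box// mulr1 in h1.
have h2 := nrmD L1_ L2_; have h3 := nrmD (L1D L1_ L2_) L3_.
have h4 : nrm D2 <= e / 3 := Fm.
have h5 : nrm D3 <= e / 3 := Fn.
lra.
Qed.

End Density.

(** * Inversion of nonvanishing elements of the Wiener algebra *)

Section WienerInversion.
Context {R : realType}.
Notation mu := (@lebesgue_measure R).
Notation TR := (measurableTypeR R).
Implicit Types f : R -> R[i].

(** For large [|l|] a [nice] approximant within [1/4] gives the Riemann-Lebesgue estimate
    [|FT f| <= 1/2]; the threshold [L = 4 K + 1] makes [K * poisson 1 l <= 1/4] beyond it. On the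
    remaining compact interval the continuous nonvanishing modulus attains a positive minimum. *)
Lemma FT_lower_bound f : L1 f -> (forall l, 1 + FT f l != 0) ->
  exists2 delta : R, 0 < delta & forall l, delta <= normc (1 + FT f l).
Proof.
move=> Lf nz; have q0 : (0 : R) < 4^-1 by rewrite invr_gt0.
have [phi [Lphi [r [K [r0 K0 _ FK]]] dphi]] := nice_dense q0 Lf.
pose L : R := 4 * K + 1.
have L1_ : 1 <= L by rewrite lerDr mulr_ge0.
have far l : L < `|l| -> 2^-1 <= normc (1 + FT f l).
  move=> Ll; have h1 : normc (FT phi l) <= 4^-1.
    apply: (le_trans (FK l)); rewrite /poisson expr1n mulrA mulr1 ler_pdivrMr; last first.
      by rewrite mulr_gt0 ?pi_gt0// ltr_pwDl ?sqr_ge0.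
    have h : L <= 1 + l ^+ 2.
      rewrite -[l ^+ 2]real_normK ?num_real//; have := sqr_ge0 (`|l|); move: Ll; move: `|l| => t.
      by move=> h1 h2; nra.
    have p2 := pi_ge2 R; have : 1 + l ^+ 2 <= pi * (1 + l ^+ 2).
      by rewrite ler_peMl ?addr_ge0 ?sqr_ge0//; lra.
    by rewrite /L in h; lra.
  have h2 : normc (FT f l - FT phi l) <= 4^-1.
    by rewrite -FTB//; apply: le_trans dphi; apply: FT_le; exact: L1B.
  have h3 : normc (FT f l) <= 2^-1.
    have -> : FT f l = (FT f l - FT phi l) + FT phi l by rewrite subrK.
    by apply: (le_trans (normc_leD _ _)); lra.
  have h4 : normc (1 + FT f l - FT f l : R[i]) = 1 by rewrite addrK Normc.normc1.
  have := normc_leB (1 + FT f l) (FT f l); rewrite h4; lra.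
have cg : continuous (fun l => normc (1 + FT f l)).
  apply: (@continuous_normc_FT_sub _ f (fun z => normc (1 + z))) => // z w.
  have e1 : 1 + z = (1 + w) + (z - w) by ring.
  have e2 : 1 + w = (1 + z) - (z - w) by ring.
  have h1 := normc_leD (1 + w) (z - w); have h2 := normc_leB (1 + z) (z - w).
  by rewrite -e1 in h1; rewrite -e2 in h2; rewrite ler_norml; lra.
have LL : - L <= L by rewrite (le_trans _ (le_trans ler01 L1_))// oppr_le0 (le_trans ler01 L1_).
have [c _ cmin] := EVT_min LL (continuous_subspaceT cg).
exists (Num.min (normc (1 + FT f c)) 2^-1).
  by rewrite lt_min invr_gt0 ltr0n andbT lt_neqAle normc_ge0 eq_sym normc_eq0 nz.
move=> l; rewrite ge_min; have [Ll|lL] := ltP L `|l|; first by rewrite far// orbT.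
by rewrite cmin// in_itv/= -ler_norml.
Qed.

Lemma nrm_support_le (h : R -> R[i]) (r M : R) : L1 h -> 0 <= r -> 0 <= M ->
  (forall x, r < `|x| -> h x = 0) -> {ae mu, forall x, normc (h x) <= M} ->
  nrm h <= 2 * r * M.
Proof.
move=> Lh r0 M0 hr hM; rewrite -lee_fin -nrmE//.
apply: (@le_trans _ _ (\int[mu]_x (M * \1_(`[- r, r] : set R) x)%:E)%E).
  apply: ae_ge0_le_integral => //.
  - by move=> x _; rewrite lee_fin normc_ge0.
  - by apply/measurable_EFinP; apply: measurable_normc; exact: L1_measurable.
  - by move=> x _; rewrite lee_fin mulr_ge0// indicE.
  - by apply/measurable_EFinP; apply: measurable_funM => //; exact: measurable_indic.
  apply: ae_imp hM => x hx _; rewrite lee_fin.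
  have [xr|xr] := leP `|x| r; last by rewrite hr// Normc.normc0 mulr_ge0// indicE.
  by rewrite indicE mem_set ?mulr1//= in_itv/= -ler_norml.
under eq_integral do rewrite EFinM.
rewrite ge0_integralZl//; last by apply/measurable_EFinP; exact: measurable_indic.
rewrite integral_indic//= setIT lebesgue_measure_itv/= lte_fin.
case: ltP => _; last by rewrite mule0 lee_fin !mulr_ge0.
by rewrite -EFinM lee_fin; lra.
Qed.

(* [(a + FT phi)^k - a^k] is the Fourier transform of a function supported in
   [-k r, k r] and bounded by the [L^1]-norm of its transform, which is at most
   [k q^(k-1)] times that of [FT phi]: its norm is of order [k^2 q^k]. *)
Lemma wiener_le_nice_expr (a : R[i]) (phi : R -> R[i]) (q p : R) :
  L1 phi -> nice phi -> 0 < q -> q < p -> normc a <= q ->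
  (forall l, normc (a + FT phi l) <= q) ->
  exists2 C, 0 <= C & forall k, wiener_le (fun l => (a + FT phi l) ^+ k) (C * p ^+ k).
Proof.
move=> Lphi [r [K [r0 K0 phir FK]]] q0 qp aq Fq; have p0 := lt_trans q0 qp.
(* Since [s^2 = q / p], one has [k^2 q^k = (k s^k)^2 p^k] with [k s^k] bounded, which absorbs the
   quadratic factor; [E] collects the remaining constants. *)
pose s := Num.sqrt (q / p); pose E := 4 * r * K / q.
have s2 : s ^+ 2 = q / p by rewrite sqr_sqrtr// ltW// divr_gt0.
have s0 : 0 <= s by exact: sqrtr_ge0.
have s1 : s < 1.
  by rewrite -(@expr_lt1 _ 2)// s2 ltr_pdivrMr// mul1r.
have E0 : 0 <= E by rewrite divr_ge0 ?mulr_ge0// ltW.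
have s1i : 0 <= (1 - s)^-1 by rewrite invr_ge0 subr_ge0 ltW.
(* Induction through [F^(k+1) - a^(k+1) = F (F^k - a^k) + FT phi * a^k], where [F = a + FT phi]. The
   estimate is multiplied by [q] to avoid the exponent [k - 1]. *)
have Hk k : exists h, [/\ L1 h, (forall l, FT h l = (a + FT phi l) ^+ k - a ^+ k),
    (forall x, k%:R * r < `|x| -> h x = 0) &
    forall l, normc (FT h l) * q <= k%:R * q ^+ k * K * poisson 1 l].
  elim: k => [|k [h [Lh hE hs hb]]].
    exists (fun=> 0); split; first exact: L10.
    - by move=> l; rewrite FT0 !expr0 subrr.
    - by [].
    - by move=> l; rewrite FT0 Normc.normc0 !mul0r.
  have La := L1Zl a Lh; have Lb := L1Zl (a ^+ k) Lphi; have Lc := L1_conv Lphi Lh.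
  have E1 l : FT (fun x => (a * h x + a ^+ k * phi x) + conv phi h x) l =
      (a + FT phi l) * FT h l + FT phi l * a ^+ k.
    by rewrite !FTD ?FTZ ?FT_conv//; [ring|exact: L1D].
  exists (fun x => (a * h x + a ^+ k * phi x) + conv phi h x); split.
  - by apply: L1D => //; exact: L1D.
  - by move=> l; rewrite E1 hE !exprS; ring.
  - move=> x kx; rewrite -natr1 mulrDl mul1r in kx.
    rewrite hs; last by rewrite (le_lt_trans _ kx)// lerDl.
    rewrite phir; last by rewrite (le_lt_trans _ kx)// lerDr mulr_ge0.
    by rewrite !mulr0 !add0r (conv_support phir hs)// addrC.
  - move=> l; rewrite E1; apply: (@le_trans _ _ ((q * normc (FT h l) + K * poisson 1 l * q ^+ k) * q)).
      rewrite ler_wpM2r ?(ltW q0)// (le_trans (normc_leD _ _))//.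
      rewrite !Normc.normcM lerD//; first by rewrite ler_wpM2r ?normc_ge0.
      rewrite normcX ler_pM ?normc_ge0 ?exprn_ge0 ?normc_ge0//.
      by rewrite lerXn2r ?nnegrE ?normc_ge0// ltW.
    rewrite mulrDl exprS -natr1.
    have := ler_wpM2l (ltW q0) (hb l); move: (poisson 1 l) (normc _) (q ^+ k) => P N Q.
    move=> h1; rewrite -subr_ge0; rewrite -subr_ge0 in h1; apply: le_trans h1 _.
    by rewrite le_eqVlt; apply/orP; left; apply/eqP; ring.
exists (1 + E * (1 - s)^-1 ^+ 2); first by rewrite addr_ge0// mulr_ge0// exprn_ge0.
move=> k; have [h [Lh hE hs hb]] := Hk k.
have hM : {ae mu, forall x, normc (h x) <= 2 * (k%:R * q ^+ k * K / q)}.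
  have Ip : mu.-integrable setT (EFin \o (fun l : R => k%:R * q ^+ k * K / q * poisson 1 l)).
    have := integrableZl measurableT (k%:R * q ^+ k * K / q) (integrable_poisson (@ltr01 R)).
    by apply: eq_integrable.
  have := @FT_sup_bound _ h _ Lh _ Ip.
  rewrite (_ : Rintegral _ _ _ = k%:R * q ^+ k * K / q); last first.
    rewrite RintegralZl//; last exact: integrable_poisson.
    by rewrite /Rintegral integral_poisson// mulr1.
  apply => l; have := hb l; rewrite -ler_pdivlMr// => /le_trans; apply.
  by rewrite le_eqVlt; apply/orP; left; apply/eqP; field; exact: lt0r_neq0.
have M0 : 0 <= 2 * (k%:R * q ^+ k * K / q).
  by rewrite !mulr_ge0// ?exprn_ge0 ?invr_ge0 ?(ltW q0).
have nh := nrm_support_le Lh (mulr_ge0 (ler0n _ _) r0) M0 hs hM.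
exists (a ^+ k), h; split => //.
  by move=> l; rewrite hE [RHS]addrC subrK.
have qp' : q ^+ k <= p ^+ k by rewrite lerXn2r ?nnegrE ?ltW.
have ks : (k%:R * s ^+ k) ^+ 2 <= (1 - s)^-1 ^+ 2.
  by rewrite lerXn2r ?nnegrE ?mulr_ge0 ?exprn_ge0//; apply: natmul_expr_le; rewrite s0.
have e : 2 * (k%:R * r) * (2 * (k%:R * q ^+ k * K / q)) = E * (k%:R * s ^+ k) ^+ 2 * p ^+ k.
  rewrite exprMn -exprM mulnC exprM s2 expr_div_n /E; move: (q ^+ k) (p ^+ k) (lt0r_neq0 (exprn_gt0 k p0)) => Q P P0.
  by field; rewrite P0 lt0r_neq0.
rewrite e in nh; rewrite mulrDl mul1r lerD//.
  by rewrite normcX (le_trans _ qp')// lerXn2r ?nnegrE ?normc_ge0// ltW.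
by apply: (le_trans nh); rewrite ler_wpM2r ?exprn_ge0 ?(ltW p0)// ler_wpM2l.
Qed.

(* The spectral radius of a Wiener-algebra element is its sup norm. *)
Lemma wiener_le_expr (a : R[i]) (b : R -> R[i]) (q0 : R) : L1 b -> 0 <= q0 < 1 ->
  normc a <= q0 -> (forall l, normc (a + FT b l) <= q0) ->
  exists C p, [/\ 0 <= C, 0 <= p < 1 &
    forall k, wiener_le (fun l => (a + FT b l) ^+ k) (C * p ^+ k)].
Proof.
(* Three margins [eta] are spent: on the sup norm of the approximant, on the gap between [q] and
   [p], and on the perturbation; [q0 + 3 eta] is still below 1. *)
move=> Lb /andP[q00 q01] aq Hq; pose eta := (1 - q0) / 4.
have eta0 : 0 < eta by rewrite divr_gt0// subr_gt0.
have [phi [Lphi nphi bphi]] := nice_dense eta0 Lb.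
have Lr := L1B Lb Lphi.
have [C C0 HC] : exists2 C, 0 <= C & forall k, wiener_le (fun l => (a + FT phi l) ^+ k) (C * (q0 + 2 * eta) ^+ k).
  apply: (@wiener_le_nice_expr a phi (q0 + eta)) => //; try lra.
  move=> l; have -> : a + FT phi l = (a + FT b l) - FT (fun x => b x - phi x) l.
    by rewrite FTB//; ring.
  by rewrite (le_trans (normc_leB _ _))// lerD// (le_trans (FT_le _ _)).
exists C, (q0 + 2 * eta + eta); split => //; first by rewrite /eta; apply/andP; split; lra.
move=> k; have := wiener_le_exprD k HC (wiener_le_mono bphi (wiener_le_FT Lr)).
congr wiener_le; apply/funext => l; rewrite FTB//; congr (_ ^+ _); ring.
Qed.

(** The norms of the powers decay geometrically by [wiener_le_expr], even if the algebra norm of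
    [a + FT b] itself exceeds 1, so the Neumann series is summable in the algebra. *)
Lemma in_wiener_neumann (a : R[i]) (b : R -> R[i]) (q0 : R) : L1 b -> 0 <= q0 < 1 ->
  normc a <= q0 -> (forall l, normc (a + FT b l) <= q0) ->
  in_wiener (fun l => (1 - (a + FT b l))^-1).
Proof.
move=> Lb q01 aq Hq; have [C [p [C0 p01 HC]]] := wiener_le_expr Lb q01 aq Hq.
have /andP[q00 q0lt] := q01; have /andP[p0 p1] := p01.
apply: (in_wiener_series HC (C := C / (1 - p))).
  move=> n; rewrite -mulr_sumr ler_wpM2l// -[leRHS]mul1r ler_pdivlMr ?subr_gt0//.
  have -> : (\sum_(i < n) p ^+ i) * (1 - p) = 1 - p ^+ n.
    by rewrite -[RHS]opprB subrX1; ring.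
  by rewrite gerBl exprn_ge0.
move=> l; set z := a + FT b l; have zq : normc z <= q0 := Hq l.
have z1 : 1 - z != 0.
  apply/eqP => /eqP; rewrite subr_eq0 => /eqP z1.
  by move: zq; rewrite -z1 Normc.normc1 leNgt q0lt.
have zi : normc (1 - z)^-1 = (normc (1 - z))^-1.
  have n0 : normc (1 - z) != 0 by rewrite normc_eq0.
  by apply: (mulfI n0); rewrite -Normc.normcM !divff ?Normc.normc1.
have E n : normc (\sum_(k < n) z ^+ k - (1 - z)^-1) = normc z ^+ n * (normc (1 - z))^-1.
  rewrite -normcX -zi -Normc.normcM -normcN; congr normc.
  apply: (mulIf z1); rewrite mulNr mulrBl mulVf// -mulrA mulVf// mulr1.
  have -> : (\sum_(i < n) z ^+ i) * (1 - z) = 1 - z ^+ n.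
    by rewrite -[RHS]opprB subrX1; ring.
  by rewrite opprB subKr.
have -> : (fun n => normc (\sum_(k < n) z ^+ k - (1 - z)^-1)) =
    (fun n => normc z ^+ n * (normc (1 - z))^-1) by apply/funext.
have zc : normc z ^+ n @[n --> \oo] --> 0.
  by apply: cvg_expr; rewrite ger0_norm ?normc_ge0// (le_lt_trans zq).
suff : normc z ^+ n * (normc (1 - z))^-1 @[n --> \oo] --> 0 * (normc (1 - z))^-1.
  by rewrite mul0r.
exact: cvgM zc (cvg_cst _).
Qed.

Theorem wiener_inverse f : L1 f -> (forall l, 1 + FT f l != 0) ->
  in_wiener (fun l => (1 + FT f l)^-1).
Proof.
move=> Lf nz; have [d d0 Hd] := FT_lower_bound Lf nz.
pose M : R := 1 + nrm f; have M1 : 1 <= M by rewrite lerDl nrm_ge0.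
have M0 : 0 < M by rewrite (lt_le_trans _ M1).
have FM l : normc (1 + FT f l) <= M.
  by rewrite (le_trans (normc_leD _ _))// Normc.normc1 lerD2l FT_le.
(* As [M] bounds [|1 + FT f|], this choice gives [c |1 + FT f|^2 <= 1]. *)
pose c := M ^- 2; have c0 : 0 < c by rewrite invr_gt0 exprn_gt0.
have c1 : c <= 1 by rewrite invf_le1 ?exprn_gt0// exprn_ege1.
pose fs x := conjc (f (- x)).
have Lfs : L1 fs by apply: L1_conj; exact: L1_opp.
have Lff := L1_conv Lf Lfs.
(* [fs] has the conjugate transform, so [|1 + FT f|^2] is 1 plus the transform of
   [f + fs + conv f fs]; thus [1 - c + FT b] is [1 - c |1 + FT f|^2]. *)
pose b x := - c%:C * (f x + fs x + conv f fs x).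
have Lfd : L1 (fun x => f x + fs x + conv f fs x) by apply: L1D => //; exact: L1D.
have Lb : L1 b := L1Zl _ Lfd.
have HE l : 1 - c%:C + FT b l = (1 - c * normc (1 + FT f l) ^+ 2)%:C.
  rewrite FTZ// !FTD//; last exact: L1D.
  have -> : (1 - c * normc (1 + FT f l) ^+ 2)%:C = 1 - c%:C * (normc (1 + FT f l) ^+ 2)%:C.
    by rewrite rmorphB rmorphM rmorph1.
  rewrite FT_conv// /fs FT_conj// -mul_conjc rmorphD rmorph1.
  ring.
have cF l : c * d ^+ 2 <= c * normc (1 + FT f l) ^+ 2 <= 1.
  apply/andP; split.
    by rewrite ler_wpM2l ?(ltW c0)// lerXn2r ?nnegrE ?normc_ge0 ?(ltW d0).
  rewrite mulrC ler_pdivrMr ?exprn_gt0// mul1r.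
  by rewrite lerXn2r ?nnegrE ?normc_ge0 ?(ltW M0).
(* The first entry bounds the function [1 - c |1 + FT f|^2], the second its constant term
   [1 - c]. *)
pose q0 := Num.max (1 - c * d ^+ 2) (1 - c).
have cd0 : 0 < c * d ^+ 2 by rewrite mulr_gt0// exprn_gt0.
have q01 : 0 <= q0 < 1.
  rewrite le_max gt_max; apply/andP; split; last by apply/andP; split; lra.
  by apply/orP; right; rewrite subr_ge0.
have iw : in_wiener (fun l => (1 - (1 - c%:C + FT b l))^-1).
  apply: (@in_wiener_neumann _ _ q0) => //.
    have -> : 1 - c%:C = (1 - c)%:C by rewrite rmorphB rmorph1.
    by rewrite normc_real ger0_norm ?subr_ge0// le_max lexx orbT.
  move=> l; have /andP[h1 h2] := cF l.
  by rewrite HE normc_real ger0_norm ?subr_ge0// le_max lerB.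
have iwc : in_wiener (fun l => conjc (1 + FT f l)).
  exists 1, fs; split => // l; by rewrite /fs FT_conj// rmorphD rmorph1.
have iwd : in_wiener (fun=> c%:C : R[i]).
  by exists c%:C, (fun=> 0); split; [exact: L10|move=> l; rewrite FT0 addr0].
have := in_wienerM iwd (in_wienerM iwc iw); congr in_wiener; apply/funext => l.
have cn : normc (1 + FT f l) != 0 by rewrite normc_eq0.
apply: (mulfI (nz l)); rewrite divff// HE.
have -> : 1 - (1 - c * normc (1 + FT f l) ^+ 2)%:C = c%:C * ((1 + FT f l) * conjc (1 + FT f l)).
  by rewrite mul_conjc -rmorphM rmorphB/= rmorph1; ring.
have h1 : conjc (1 + FT f l) != 0 by rewrite -normc_eq0 normc_conj.
have h2 : c%:C != 0 :> R[i] by rewrite -normc_eq0 normc_real normr_eq0 lt0r_neq0.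
have := nz l; move: (1 + FT f l) (conjc _) (c%:C) h1 h2 => u v w v0 w0 u0.
by field; rewrite v0 w0 u0.
Qed.

End WienerInversion.

(** * The Fredholm equation as multiplication of transforms *)

Section Fredholm.
Context {R : realType}.
Notation mu := (@lebesgue_measure R).
Notation TR := (measurableTypeR R).
Implicit Types k f g : R -> R[i].

Definition half_kernel k (x : R) : R[i] := Cind (`[0, +oo[ : set R) (- x) * k (- x).

Lemma L1_half_kernel k :
  L1 (fun z => Cind (`[0, +oo[ : set R) z * k z) -> L1 (half_kernel k).
Proof. by move=> Lk; exact: (L1_opp Lk). Qed.

Lemma FT_half_kernel k (l : R) : L1 (fun z => Cind (`[0, +oo[ : set R) z * k z) ->
  FT (half_kernel k) l = Cintegral `[0, +oo[ (fun z => expi (l * z) * k z).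
Proof.
move=> Lk; rewrite Cintegral_ind// /FT.
have m : Cm (fun z => expi (l * z) * (Cind (`[0, +oo[ : set R) z * k z)).
  exact: L1_measurable (L1_expiM l Lk).
transitivity (CI (fun z => expi (l * z) * (Cind (`[0, +oo[ : set R) z * k z))).
  by rewrite -(CI_opp m); congr CI; apply/funext => x; rewrite mulrN.
by congr CI; apply/funext => x; rewrite mulrCA.
Qed.

Lemma conv_half_kernel k f (x : R) : L1 (fun z => Cind (`[0, +oo[ : set R) z * k z) -> L1 f ->
  conv (half_kernel k) f x = Cintegral `[0, +oo[ (fun z => k z * f (z + x)).
Proof.
move=> Lk Lf; rewrite Cintegral_ind// /conv.
have m : Cm (fun z => (Cind (`[0, +oo[ : set R) z * k z) * f (z + x)).
  by apply: CmeasurableM; [exact: L1_measurable|exact: Cm_shift (L1_measurable Lf)].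
transitivity (CI (fun z => (Cind (`[0, +oo[ : set R) z * k z) * f (z + x))).
  by rewrite -(CI_opp m); congr CI; apply/funext => y; rewrite [- y + x]addrC.
by congr CI; apply/funext => y; rewrite mulrA.
Qed.

Lemma Fredholm_solutionP k g f : L1 (fun z => Cind (`[0, +oo[ : set R) z * k z) ->
  L1 g -> Fredholm_solution k g f <->
  L1 f /\ forall l, FT f l * (1 + FT (half_kernel k) l) = FT g l.
Proof.
move=> Lk Lg; have Lh := L1_half_kernel Lk.
have E f' l : L1 f' -> FT (fun x => f' x + conv (half_kernel k) f' x) l =
    FT f' l * (1 + FT (half_kernel k) l).
  by move=> Lf'; rewrite FTD ?FT_conv//; [ring|exact: L1_conv].
split => -[Lf H]; split => //.
  move=> l; rewrite -E//; apply: ae_FT.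
  - by apply: L1_measurable; apply: L1D => //; exact: L1_conv.
  - exact: L1_measurable.
  - by apply: ae_imp H => x <-; rewrite conv_half_kernel.
have LL : L1 (fun x => f x + conv (half_kernel k) f x) by apply: L1D => //; exact: L1_conv.
have := FT_inj LL Lg (fun l => etrans (E f l Lf) (H l)).
by apply: ae_imp => x <-; rewrite conv_half_kernel.
Qed.

Theorem Fredholm_inverse_fourier k g :
  L1 (fun z => Cind (`[0, +oo[ : set R) z * k z) -> L1 g ->
  (forall l, 1 + FT (half_kernel k) l != 0) ->
  unique_Fredholm_solution k g (inverse_fourier (fun l => FT g l / (1 + FT (half_kernel k) l))).
Proof.
move=> Lk Lg nz; have Lh := L1_half_kernel Lk.
have [a [h [Lh' ah]]] := wiener_inverse Lh nz.
(* The integrable function with transform [FT g * (a + FT h)]; [inverse_fourier] recovers it almost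
   everywhere. *)
pose r x := a * g x + conv h g x.
have Lc := L1_conv Lh' Lg.
have Lr : L1 r by apply: L1D => //; exact: L1Zl.
have rE l : FT r l = FT g l / (1 + FT (half_kernel k) l).
  by rewrite /r FTD ?FTZ ?FT_conv ?ah//; [ring|exact: L1Zl].
rewrite (_ : (fun l => _) = FT r); last by apply/funext => l; rewrite rE.
have ir := inverse_fourier_FT Lr.
have Li := L1_inverse_fourier Lr.
have FTi l : FT (inverse_fourier (FT r)) l = FT r l.
  by apply: ae_FT => //; exact: L1_measurable.
split.
  by apply/Fredholm_solutionP => //; split => // l; rewrite FTi rE mulfVK.
move=> f /Fredholm_solutionP-/(_ Lk Lg)[Lf H].
apply: FT_inj => // l; rewrite FTi rE; apply: (mulIf (nz l)); rewrite H mulfVK//.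
Qed.

End Fredholm.

(** * Null sets under reflection and translation *)

Section AeSubstitution.
Context {R : realType}.
Notation mu := (@lebesgue_measure R).
Notation TR := (measurableTypeR R).
Implicit Types P : R -> Prop.

Lemma ae_measurable_preimage (h : TR -> TR) P : measurable_fun setT h ->
  (forall A : set R, measurable A -> mu A = 0%E -> mu (h @^-1` A) = 0%E) ->
  {ae mu, forall x, P x} -> {ae mu, forall x, P (h x)}.
Proof.
move=> mh h0 [N [mN N0 PN]]; exists (h @^-1` N); split.
- by rewrite -[X in measurable X]setTI; exact: mh.
- exact: h0.
- by move=> x /= nP; exact: PN.
Qed.

Lemma ae_opp P : {ae mu, forall x, P x} -> {ae mu, forall x, P (- x)}.
Proof.
apply: (@ae_measurable_preimage (fun x : TR => - x : TR)) => [|A mA A0].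
  exact: measurableT_comp.
by rewrite -A0; exact: lebesgue_measureN.
Qed.

Lemma ae_shift (b : R) P : {ae mu, forall x, P x} -> {ae mu, forall x, P (x + b)}.
Proof.
apply: (@ae_measurable_preimage (fun x : TR => x + b : TR)) => [|A mA A0].
  exact: measurable_funD.
rewrite -A0 -(lebesgue_measure_affine b ltr01 mA) mul1e.
by congr mu; apply/seteqP; split => x /=; rewrite mul1r.
Qed.

End AeSubstitution.

(** * Wronskians and Volterra systems *)

Section Kernels.
Context {R : realType}.
Notation mu := (@lebesgue_measure R).
Notation TR := (measurableTypeR R).
Implicit Types (f g c : R -> R[i]) (F H : R -> R -> R[i]).

(** Sections of the kernels are integrable only for almost all [x]; treating positive and negative
    parts by Tonelli gives measurability of the integral at all [x], default values included. *)
Lemma measurable_Rintegral_section (h : TR * TR -> R) : measurable_fun setT h ->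
  measurable_fun setT (fun x : TR => \int[mu]_y h (x, y) : TR).
Proof.
move=> mh; rewrite /Rintegral.
apply: (@measurableT_comp _ _ _ _ _ _ (@fine R)) => //.
have mE : measurable_fun setT (fun p : TR * TR => (h p)%:E) by exact/measurable_EFinP.
under eq_fun do rewrite integralE.
apply: emeasurable_funB.
  have h0 : (forall p, 0 <= (fun p : TR * TR => (h p)%:E)^\+ p)%E by move=> p; exact: funepos_ge0.
  have := measurable_fun_fubini_tonelli_F (m2 := mu) _ (measurable_funepos mE) h0.
  congr measurable_fun; apply/funext => x; apply: eq_integral => y _.
  by rewrite !funeposE.
have h0 : (forall p, 0 <= (fun p : TR * TR => (h p)%:E)^\- p)%E by move=> p; exact: funeneg_ge0.
have := measurable_fun_fubini_tonelli_F (m2 := mu) _ (measurable_funeneg mE) h0.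
congr measurable_fun; apply/funext => x; apply: eq_integral => y _.
by rewrite !funenegE.
Qed.

Lemma Cm_CI F : Cm2 F -> Cm (fun x => CI (F x)).
Proof.
move=> [m1 m2]; split.
  exact: (measurable_Rintegral_section m1).
exact: (measurable_Rintegral_section m2).
Qed.

Lemma L1_ae_bounded c f (M : R) : Cm c -> {ae mu, forall x, normc (c x) <= M} ->
  L1 f -> L1 (fun x => c x * f x).
Proof.
move=> mc cM Lf; have mf := L1_measurable Lf.
pose D : set TR := [set x | normc (c x) <= M].
have mD : measurable D.
  rewrite (_ : D = (fun x : TR => normc (c x) : TR) @^-1` `]-oo, M]).
    by rewrite -[X in measurable X]setTI; exact: (measurable_normc mc).
  by apply/seteqP; split => x /=; rewrite in_itv.
have L : L1 (fun x => (Cind D x * c x) * f x).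
  apply: (@L1_bounded _ _ _ `|M|) => //; first by apply: CmeasurableM => //; exact: Cmeasurable_ind.
  move=> x; have [Dx|Dx] := pselect (D x); last by rewrite CindF// mul0r Normc.normc0.
  by rewrite CindT// mul1r (le_trans Dx)// ler_norm.
apply: ae_L1 L; first exact: CmeasurableM.
by apply: ae_imp cM => x Dx; rewrite CindT// mul1r.
Qed.

Lemma Cm2_FT H (l : R) : Cm2 H -> Cm (fun z => FT (H z) l).
Proof.
move=> mH; apply: Cm_CI; apply: CmeasurableM => //.
by apply: (@Cm2_snd _ (fun s => expi (- (l * s)))); exact: Cm_expiNM.
Qed.

Section superposition.
Variables (c : R -> R[i]) (H : R -> R -> R[i]) (C : R).
Hypotheses (Lc : L1 c) (mH : Cm2 H) (HC : {ae mu, forall z, (L1norm (H z) <= C%:E)%E}).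

Lemma ae_L1_kernel : {ae mu, forall z, L1 (H z)}.
Proof.
apply: ae_imp HC => z h; apply/L1P; split; first exact: Cm2_sec1.
by rewrite (le_lt_trans h)// ltry.
Qed.

Lemma ae_FT_kernel_le (l : R) : {ae mu, forall z, normc (FT (H z) l) <= C}.
Proof.
apply: (ae_imp2 _ HC ae_L1_kernel) => z h Lz.
by rewrite (le_trans (FT_le l Lz))// -lee_fin -nrmE.
Qed.

Let G z s := c z * H z s.

Let mG : Cm2 G.
Proof. by apply: CmeasurableM => //; exact: Cm2_fst (L1_measurable Lc). Qed.

Let GC : (\int[mu]_z L1norm (G z) < +oo)%E.
Proof.
have C0 : (0 <= (`|C|%:E : \bar R))%E by rewrite lee_fin.
apply: (@le_lt_trans _ _ (\int[mu]_z (`|C|%:E * (normc (c z))%:E)))%E.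
  apply: ae_ge0_le_integral => //.
  - by move=> z _; exact: L1norm_ge0.
  - exact: measurable_L1norm.
  - by move=> z _; rewrite mule_ge0// lee_fin normc_ge0.
  - apply: measurable_funeM; apply/measurable_EFinP; apply: measurable_normc; exact: L1_measurable.
  apply: ae_imp HC => z h _; rewrite /G L1normZ; last exact: Cm2_sec1.
  rewrite muleC; apply: lee_wpmul2r; first by rewrite lee_fin normc_ge0.
  by rewrite (le_trans h)// lee_fin ler_norm.
rewrite ge0_integralZl//; last 2 first.
- by apply/measurable_EFinP; apply: measurable_normc; exact: L1_measurable.
- by move=> z _; rewrite lee_fin normc_ge0.
by rewrite -[X in (_ * X)%E]/(L1norm c) nrmE// -EFinM ltry.
Qed.

Lemma L1_superposition : L1 (fun s => CI (fun z => c z * H z s)).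
Proof. exact: (fubini_L1' mG GC). Qed.

(** Absolute convergence comes from integrability of [c] and the uniform [L^1] bound on the kernels.
    It turns a Volterra equation in two variables into an equation in [x] alone for each [l]. *)
Lemma FT_superposition (l : R) :
  FT (fun s => CI (fun z => c z * H z s)) l = CI (fun z => c z * FT (H z) l).
Proof.
pose E z s := expi (- (l * s)) * G z s.
have mE : Cm2 E.
  apply: CmeasurableM => //; apply: (@Cm2_snd _ (fun s => expi (- (l * s)))); exact: Cm_expiNM.
have nE z : L1norm (E z) = L1norm (G z).
  by apply: eq_integral => y _; rewrite Normc.normcM normc_expi mul1r.
have EC : (\int[mu]_z L1norm (E z) < +oo)%E by under eq_integral do rewrite nE.
transitivity (CI (fun s => CI (fun z => E z s))).
  apply: ae_CI.
  - by apply: CmeasurableM; [exact: Cm_expiNM|exact: L1_measurable L1_superposition].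
  - exact: L1_measurable (fubini_L1' mE EC).
  - by apply: ae_imp (fubini_ae2 mG GC) => s Ls; rewrite /E CIZl.
rewrite -fubini_CI//; apply: ae_CI.
- exact: L1_measurable (fubini_L1 mE EC).
- by apply: CmeasurableM; [exact: L1_measurable|exact: Cm2_FT].
apply: ae_imp ae_L1_kernel => z Lz; rewrite /E /G /FT -CIZl; last exact: L1_expiNM.
by congr CI; apply/funext => s; rewrite mulrCA.
Qed.

End superposition.

(** Together with [ltail], primitives (up to sign) that vanish at [+oo] and at [-oo]; they represent
    solutions known only through integral equations. *)
Definition rtail f (x : R) : R[i] := CI (fun z => Cind (`[x, +oo[ : set R) z * f z).
Definition ltail f (x : R) : R[i] := CI (fun z => Cind (`]-oo, x] : set R) z * f z).

Lemma normc_rtail f (x : R) : L1 f -> normc (rtail f x) <= nrm f.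
Proof.
move=> Lf; have L : L1 (fun z => Cind (`[x, +oo[ : set R) z * f z) by exact: L1_ind.
rewrite -lee_fin -nrmE//; apply: (le_trans (normc_CI_le (L1_measurable L))).
apply: L1norm_le; first exact: L1_measurable.
  by apply: measurable_normc; exact: L1_measurable.
by move=> z; rewrite Normc.normcM ler_piMl ?normc_ge0// normc_ind_le.
Qed.

Lemma Cm2_ind_ge : Cm2 (fun x z => Cind (`[x, +oo[ : set R) z).
Proof.
have := @Cm2_comp R (fun p => p.2 - p.1) (Cind (`[0, +oo[ : set R)) _ _.
rewrite (_ : (fun x y => _) = (fun x z => Cind (`[x, +oo[ : set R) z)).
  by apply; [exact: measurable_funB|exact: Cmeasurable_ind].
apply/funext => x; apply/funext => y; rewrite /Cind !indicE; congr (_%:R%:C).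
by rewrite !mem_setE !in_itv/= !andbT subr_ge0.
Qed.

Lemma Cm_rtail f : Cm f -> Cm (rtail f).
Proof.
move=> mf; apply: Cm_CI; apply: CmeasurableM; first exact: Cm2_ind_ge.
exact: Cm2_snd.
Qed.

Lemma ltailE f (x : R) : L1 f -> ltail f x = CI f - rtail f x.
Proof.
move=> Lf; rewrite /ltail /rtail -CIB//; last exact: L1_ind.
apply: ae_CI.
- by apply: CmeasurableM; [exact: Cmeasurable_ind|exact: L1_measurable].
- by apply: L1_measurable; apply: L1B => //; exact: L1_ind.
exists [set x]; split; [exact: measurable_set1|exact: lebesgue_measure_set1|].
apply: subsetCl => z /= zx.
have [xz|xz] := leP z x.
  rewrite CindT/= ?in_itv//= CindF ?mul0r ?mul1r ?subr0//= in_itv/= andbT.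
  by apply/negP; rewrite -ltNge lt_neqAle xz andbT; exact/eqP.
rewrite CindF/= ?in_itv/=; last by apply/negP; rewrite -ltNge.
by rewrite CindT ?mul1r ?mul0r ?subrr//= in_itv/= ltW.
Qed.

Lemma Cm_ltail f : L1 f -> Cm (ltail f).
Proof.
move=> Lf; rewrite (_ : ltail f = (fun x => CI f - rtail f x)).
  apply: CmeasurableB; first exact: Cmeasurable_cst.
  by apply: Cm_rtail; exact: L1_measurable.
by apply/funext => x; exact: ltailE.
Qed.

Lemma normc_ltail f (x : R) : L1 f -> normc (ltail f x) <= nrm f.
Proof.
move=> Lf; have L : L1 (fun z => Cind (`]-oo, x] : set R) z * f z) by exact: L1_ind.
rewrite -lee_fin -nrmE//; apply: (le_trans (normc_CI_le (L1_measurable L))).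
apply: L1norm_le; first exact: L1_measurable.
  by apply: measurable_normc; exact: L1_measurable.
by move=> z; rewrite Normc.normcM ler_piMl ?normc_ge0// normc_ind_le.
Qed.

Lemma L1_rtailM f g : L1 f -> L1 g -> L1 (fun x => rtail f x * g x).
Proof.
move=> Lf Lg; apply: (@L1_bounded _ _ _ (nrm f)) => //.
  by apply: Cm_rtail; exact: L1_measurable.
by move=> x; exact: normc_rtail.
Qed.

Lemma L1_ltailM f g : L1 f -> L1 g -> L1 (fun x => ltail f x * g x).
Proof.
move=> Lf Lg; apply: (@L1_bounded _ _ _ (nrm f)) => //; first exact: Cm_ltail.
by move=> x; exact: normc_ltail.
Qed.

(** Integration by parts for tails: Fubini for [f z * g x] over the half-plane [x <= z]. *)
Lemma CI_tailC f g : L1 f -> L1 g ->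
  CI (fun x => rtail f x * g x) = CI (fun x => ltail g x * f x).
Proof.
move=> Lf Lg; have mf := L1_measurable Lf; have mg := L1_measurable Lg.
pose F x z := g x * (Cind (`[x, +oo[ : set R) z * f z).
have mF : Cm2 F.
  apply: CmeasurableM; first exact: Cm2_fst.
  by apply: CmeasurableM; [exact: Cm2_ind_ge|exact: Cm2_snd].
have FC : (\int[mu]_x L1norm (F x) < +oo)%E.
  apply: (@le_lt_trans _ _ (\int[mu]_x ((nrm f)%:E * (normc (g x))%:E))%E).
    apply: ge0_le_integral => //.
    - by move=> x _; exact: L1norm_ge0.
    - exact: measurable_L1norm.
    - apply: measurable_funeM; apply/measurable_EFinP; exact: measurable_normc.
    move=> x _; rewrite /F L1normZ; last by apply: CmeasurableM => //; exact: Cmeasurable_ind.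
    rewrite muleC; apply: lee_wpmul2r; first by rewrite lee_fin normc_ge0.
    rewrite -nrmE//; apply: L1norm_le; first by apply: CmeasurableM => //; exact: Cmeasurable_ind.
      exact: measurable_normc.
    by move=> z; rewrite Normc.normcM ler_piMl ?normc_ge0// normc_ind_le.
  rewrite ge0_integralZl//; last 3 first.
  - by apply/measurable_EFinP; exact: measurable_normc.
  - by move=> z _; rewrite lee_fin normc_ge0.
  - by rewrite lee_fin nrm_ge0.
  by rewrite -[X in (_ * X)%E]/(L1norm g) nrmE// -EFinM ltry.
transitivity (CI (fun x => CI (F x))).
  congr CI; apply/funext => x; rewrite mulrC /rtail -CIZl//; exact: L1_ind.
rewrite fubini_CI//; congr CI; apply/funext => z.
rewrite /ltail -CIZr; last exact: L1_ind.
congr CI; apply/funext => x; rewrite /F mulrA; congr (_ * _); rewrite mulrC; congr (_ * _).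
rewrite /Cind !indicE; congr (_%:R%:C).
by rewrite !mem_setE !in_itv/= andbT.
Qed.

(* Integrates [(F G)' = F g - f G] for [F = c + \int_x^oo f], [G = d + \int_-oo^x g]. *)
Lemma wronskian (c d : R[i]) f g : L1 f -> L1 g ->
  CI (fun x => (c + rtail f x) * g x) - CI (fun x => f x * (d + ltail g x)) =
  c * CI g - d * CI f.
Proof.
move=> Lf Lg; have L1_ := L1Zl c Lg; have L2 := L1_rtailM Lf Lg.
have L3 := L1Zl d Lf; have L4 := L1_ltailM Lg Lf.
have -> : CI (fun x => (c + rtail f x) * g x) = c * CI g + CI (fun x => rtail f x * g x).
  by rewrite -CIZl// -CID//; congr CI; apply/funext => x; rewrite mulrDl.
have -> : CI (fun x => f x * (d + ltail g x)) = d * CI f + CI (fun x => ltail g x * f x).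
  by rewrite -CIZl// -CID//; congr CI; apply/funext => x; ring.
by rewrite CI_tailC//; ring.
Qed.

End Kernels.

(** * Fourier transform of the Volterra system in the second variable *)

Section VolterraSystem.
Context {R : realType}.
Notation mu := (@lebesgue_measure R).
Notation TR := (measurableTypeR R).
Implicit Types (p q : R -> R[i]) (A B : R -> R -> R[i]).

(* [A x s] and [B x s] are kernels at [(x, x + s)], extended by [0] to [s < 0];
   this extension lets every [z]-integral run over the whole half-line. *)
Definition volterra_system p q A B : Prop :=
  [/\ Cm2 A, Cm2 B,
      exists C : R, {ae mu, forall x, (L1norm (A x) <= C%:E)%E} /\
        {ae mu, forall x, (L1norm (B x) <= C%:E)%E},
      {ae mu, forall x, {ae mu, forall s,
        A x s = CI (fun z => Cind (`[x, +oo[ : set R) z * p z * B z s)}} &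
      {ae mu, forall x, {ae mu, forall s,
        B x s = - (2^-1 * (Cind (`[0, +oo[ : set R) s * q (s / 2 + x))) -
          CI (fun z => Cind (`[x, +oo[ : set R) z * q z * A z (s - 2 * (z - x)))}}].

Lemma L1_shifted_expi q (l x : R) : L1 q ->
  L1 (fun z => Cind (`[x, +oo[ : set R) z * q z * expi (- (2 * l * (z - x)))).
Proof.
move=> Lq; have Lc : L1 (fun z => Cind (`[x, +oo[ : set R) z * q z) by exact: L1_ind.
have mh : measurable_fun setT (fun z : TR => - (2 * l * (z - x)) : TR).
  apply: measurableT_comp => //; apply: measurable_funM => //; exact: measurable_funB.
have := L1_expi mh Lc; congr L1; apply/funext => z; exact: mulrC.
Qed.

(** Substitution [z = s / 2 + x], whose Jacobian is the factor [2^-1]. *)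
Lemma FT_source q (l x : R) : L1 q ->
  FT (fun s => 2^-1 * (Cind (`[0, +oo[ : set R) s * q (s / 2 + x))) l =
  CI (fun z => Cind (`[x, +oo[ : set R) z * q z * expi (- (2 * l * (z - x)))).
Proof.
move=> Lq; have h0 : 0 < 2^-1 :> R by rewrite invr_gt0.
have h2 : (2^-1)%:C = 2^-1 :> R[i] by rewrite fmorphV rmorph_nat.
have Lc := L1_shifted_expi l x Lq.
have La := L1_affine x h0 Lc.
rewrite (CI_affine x h0 Lc) -CIZl// h2 /FT; congr CI; apply/funext => s.
have -> : Cind (`[x, +oo[ : set R) (2^-1 * s + x) = Cind (`[0, +oo[ : set R) s :> R[i].
  rewrite /Cind !indicE; congr (_%:R%:C).
  by rewrite !mem_setE !in_itv/= !andbT lerDr pmulr_rge0.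
have -> : - (2 * l * (2^-1 * s + x - x)) = - (l * s) by field.
by rewrite [s / 2]mulrC; ring.
Qed.

Section system.
Variables (p q : R -> R[i]) (A B : R -> R -> R[i]) (l : R).
Hypotheses (Lp : L1 p) (Lq : L1 q) (AB : volterra_system p q A B).

(** [hatf] and [hatg] are the integrands whose right tails give the Jost solution: [FT (A x) l] is
    the tail of [hatf], and [FT (B x) l] is minus a phase times the tail of [hatg] ([ae_FT_A],
    [ae_FT_B]). *)
Definition hatf x := p x * FT (B x) l.
Definition hatg x := q x * expi (- (2 * l * x)) * (1 + FT (A x) l).

Let mA : Cm2 A. Proof. by case: AB. Qed.
Let mB : Cm2 B. Proof. by case: AB. Qed.

Lemma L1_hatf : L1 hatf.
Proof.
case: AB => _ _ [C [_ BC]] _ _.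
rewrite /hatf (_ : (fun x => _) = (fun x => FT (B x) l * p x)); last first.
  by apply/funext => x; rewrite mulrC.
by apply: (L1_ae_bounded (Cm2_FT l mB) (ae_FT_kernel_le mB BC l)).
Qed.

Lemma L1_qexpi : L1 (fun x => q x * expi (- (2 * l * x))).
Proof.
have := L1_expiNM (2 * l) Lq; congr L1; apply/funext => x; exact: mulrC.
Qed.

Lemma L1_hatg : L1 hatg.
Proof.
case: AB => _ _ [C [AC _]] _ _.
rewrite /hatg (_ : (fun x => _) = (fun x => q x * expi (- (2 * l * x)) +
    FT (A x) l * (q x * expi (- (2 * l * x))))); last first.
  by apply/funext => x; ring.
apply: L1D; first exact: L1_qexpi.
by apply: (L1_ae_bounded (Cm2_FT l mA) (ae_FT_kernel_le mA AC l)) L1_qexpi.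
Qed.

Lemma ae_FT_A : {ae mu, forall x, FT (A x) l = rtail hatf x}.
Proof.
case: AB => _ _ [C [AC BC]] EA _; apply: ae_imp EA => x Ex.
have Lc : L1 (fun z => Cind (`[x, +oo[ : set R) z * p z) by exact: L1_ind.
rewrite (ae_FT _ _ _ Ex).
- rewrite (FT_superposition Lc mB BC).
  by congr CI; apply/funext => z; rewrite mulrA.
- exact: Cm2_sec1.
- exact: L1_measurable (L1_superposition Lc mB BC).
Qed.

Lemma ae_FT_B : {ae mu, forall x, FT (B x) l = - expi (2 * l * x) * rtail hatg x}.
Proof.
case: AB => _ _ [C [AC BC]] _ EB; apply: ae_imp EB => x Ex.
have Lc : L1 (fun z => Cind (`[x, +oo[ : set R) z * q z) by exact: L1_ind.
(* Under the transform the translation by [2 * (z - x)] becomes a phase, which factors into a part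
   in [x], taken out of the integral, and a part in [z], absorbed in [hatg]. *)
pose H z s := A z (s - 2 * (z - x)).
have mH : Cm2 H.
  apply: (@Cmeasurable_comp _ _ (TR * TR)%type _ (TR * TR)%type
    (fun p : TR * TR => (p.1, p.2 - 2 * (p.1 - x)) : TR * TR) _ _ mA).
  apply: measurable_fun_pair => //; apply: measurable_funB => //.
  by apply: measurable_funM => //; exact: measurable_funB.
have HC : {ae mu, forall z, (L1norm (H z) <= C%:E)%E}.
  apply: ae_imp AC => z; rewrite -(L1norm_shift (- (2 * (z - x))) (Cm2_sec1 z mA))//.
have LS := L1_superposition Lc mH HC.
pose S s := 2^-1 * (Cind (`[0, +oo[ : set R) s * q (s / 2 + x)).
have LSq : L1 S.
  apply: L1Zl; apply: L1_ind => //.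
  have h0 : 0 < 2^-1 :> R by rewrite invr_gt0.
  by have := L1_affine x h0 Lq; congr L1; apply/funext => s; rewrite mulrC.
rewrite (ae_FT _ _ _ Ex).
- rewrite FTB//; last exact: L1N.
  rewrite FTN// FT_source// (FT_superposition Lc mH HC).
  have Lh : L1 (fun z => Cind (`[x, +oo[ : set R) z * hatg z) by exact: L1_ind L1_hatg.
  have mS : Cm (fun z => Cind (`[x, +oo[ : set R) z * q z * FT (H z) l).
    by apply: CmeasurableM; [exact: L1_measurable|exact: Cm2_FT].
  have E1 : CI (fun z => Cind (`[x, +oo[ : set R) z * q z * FT (H z) l) =
      CI (fun z => Cind (`[x, +oo[ : set R) z * q z * (expi (- (2 * l * (z - x))) * FT (A z) l)).
    apply: ae_CI => //.
      apply: CmeasurableM; first exact: L1_measurable.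
      apply: CmeasurableM; last exact: Cm2_FT.
      apply: Cmeasurable_expi; apply: measurableT_comp => //; apply: measurable_funM => //.
      exact: measurable_funB.
    apply: ae_imp (ae_L1_kernel mA AC) => z Lz; congr (_ * _).
    by rewrite /H FT_shift//; congr (expi _ * _); ring.
  have Ls := L1_shifted_expi l x Lq.
  have LsA : L1 (fun z => Cind (`[x, +oo[ : set R) z * q z *
      (expi (- (2 * l * (z - x))) * FT (A z) l)).
    have := L1_ae_bounded (Cm2_FT l mA) (ae_FT_kernel_le mA AC l) Ls.
    by congr L1; apply/funext => z; rewrite mulrC mulrA.
  rewrite E1 -opprD mulNr; congr (- _); rewrite /rtail -CIZl// -(CID Ls LsA).
  congr CI; apply/funext => z; rewrite /hatg.
  have -> : - (2 * l * (z - x)) = 2 * l * x + - (2 * l * z) by ring.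
  by rewrite expiD; ring.
- exact: Cm2_sec1.
- by apply: L1_measurable; apply: L1B => //; exact: L1N.
Qed.

Lemma ae_hatf : {ae mu, forall x, hatf x = - (p x * expi (2 * l * x)) * rtail hatg x}.
Proof. by apply: ae_imp ae_FT_B => x E; rewrite /hatf E; ring. Qed.

Lemma ae_hatg : {ae mu, forall x,
  hatg x = q x * expi (- (2 * l * x)) * (1 + rtail hatf x)}.
Proof. by apply: ae_imp ae_FT_A => x E; rewrite /hatg E. Qed.

Lemma L1_Phi : L1 (fun s => CI (fun y => p y * B y s)).
Proof. by case: AB => _ _ [C [_ BC]] _ _; exact: (L1_superposition Lp mB BC). Qed.

Lemma FT_Phi : FT (fun s => CI (fun y => p y * B y s)) l = CI hatf.
Proof. by case: AB => _ _ [C [_ BC]] _ _; exact: (FT_superposition Lp mB BC). Qed.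

Let H z s := A z (s - 2 * z).

Let mH : Cm2 H.
Proof.
apply: (@Cmeasurable_comp _ _ (TR * TR)%type _ (TR * TR)%type
  (fun p : TR * TR => (p.1, p.2 - 2 * p.1) : TR * TR) _ _ mA).
apply: measurable_fun_pair => //; apply: measurable_funB => //.
exact: measurable_funM.
Qed.

Let HC (C : R) : {ae mu, forall x, (L1norm (A x) <= C%:E)%E} ->
  {ae mu, forall z, (L1norm (H z) <= C%:E)%E}.
Proof.
by apply: ae_imp => z; rewrite -(L1norm_shift (- (2 * z)) (Cm2_sec1 z mA)).
Qed.

Lemma L1_Theta : L1 (fun s => CI (fun y => q y * A y (s - 2 * y))).
Proof. by case: AB => _ _ [C [/HC HA _]] _ _; exact: (L1_superposition Lq mH HA). Qed.

(** The transform of the potential accounts for the summand 1 in [hatg], the superposition of the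
    [A y] for the summand [FT (A x) l]. *)
Lemma FT_Theta : CI (fun y => expi (- (2 * l * y)) * q y) +
  FT (fun s => CI (fun y => q y * A y (s - 2 * y))) l = CI hatg.
Proof.
case: AB => _ _ [C [AC _]] _ _.
rewrite (FT_superposition Lq mH (HC AC)).
have E1 : CI (fun z => q z * FT (H z) l) =
    CI (fun z => q z * expi (- (2 * l * z)) * FT (A z) l).
  apply: ae_CI.
  - by apply: CmeasurableM; [exact: L1_measurable|exact: Cm2_FT].
  - by apply: CmeasurableM; [exact: L1_measurable L1_qexpi|exact: Cm2_FT].
  apply: ae_imp (ae_L1_kernel mA AC) => z Lz.
  by rewrite /H FT_shift// mulrA; congr (_ * expi _ * _); ring.
have L : L1 (fun z => q z * expi (- (2 * l * z)) * FT (A z) l).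
  have := L1_ae_bounded (Cm2_FT l mA) (ae_FT_kernel_le mA AC l) L1_qexpi.
  by congr L1; apply/funext => z; rewrite mulrC.
rewrite E1 -(CID (L1_expiNM (2 * l) Lq) L).
by congr CI; apply/funext => z; rewrite /hatg; ring.
Qed.

End system.

End VolterraSystem.

(** * Wronskian identities between solutions from the left and from the right *)

Section ScatteringIdentities.
Context {R : realType}.
Notation mu := (@lebesgue_measure R).
Notation TR := (measurableTypeR R).
Implicit Types (w r : R -> R[i]).

Lemma ltail_opp (f : R -> R[i]) (x : R) : L1 f -> ltail (fun y => f (- y)) x = rtail f (- x).
Proof.
move=> Lf; have m : Cm (fun z => Cind (`[- x, +oo[ : set R) z * f z).
  by apply: L1_measurable; exact: L1_ind.
rewrite /rtail -(CI_opp m); congr CI; apply/funext => z; congr (_ * _).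
by rewrite /Cind !indicE; congr (_%:R%:C); rewrite !mem_setE !in_itv/= andbT lerN2.
Qed.

Lemma L1_tail1 (c : R[i]) (f g : R -> R[i]) : L1 f -> L1 g -> L1 (fun x => (c + rtail f x) * g x).
Proof.
move=> Lf Lg; have := L1D (L1Zl c Lg) (L1_rtailM Lf Lg).
by congr L1; apply/funext => x; rewrite mulrDl.
Qed.

Lemma L1_tail2 (c : R[i]) (f g : R -> R[i]) : L1 f -> L1 g -> L1 (fun x => f x * (c + ltail g x)).
Proof.
move=> Lf Lg; have := L1D (L1Zl c Lf) (L1_ltailM Lg Lf).
by congr L1; apply/funext => x; ring.
Qed.

Section left_right.
Variables (w r f2 g2 : R -> R[i]).
Hypotheses (Lf2 : L1 f2) (Lg2 : L1 g2).
Hypothesis f2E : {ae mu, forall x, f2 x = - r x * ltail g2 x}.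
Hypothesis g2E : {ae mu, forall x, g2 x = w x * (1 + ltail f2 x)}.

(** Once the equations are substituted, the Wronskian identity for [(f1, f2)] with constants 1, 1
    and that for [(g1, g2)] with constants 0, 0 have the same left side; hence their right sides
    [CI f2 - CI f1] and 0 agree. The pair [(f1, g1)] has the coefficients [w] and [r] exchanged. *)
Lemma CI_transmission (f1 g1 : R -> R[i]) : L1 f1 -> L1 g1 ->
  {ae mu, forall x, f1 x = - w x * rtail g1 x} ->
  {ae mu, forall x, g1 x = r x * (1 + rtail f1 x)} -> CI f1 = CI f2.
Proof.
move=> Lf1 Lg1 f1E g1E.
have W1 := wronskian 1 1 Lf1 Lf2; have W2 := wronskian 0 0 Lg1 Lg2.
have E1 : CI (fun x => (1 + rtail f1 x) * f2 x) = - CI (fun x => g1 x * (0 + ltail g2 x)).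
  rewrite -CIN; apply: ae_CI.
  - exact: L1_measurable (L1_tail1 _ _ _).
  - exact: L1_measurable (L1N (L1_tail2 _ _ _)).
  by apply: ae_imp2 f2E g1E => x -> ->; ring.
have E2 : CI (fun x => f1 x * (1 + ltail f2 x)) = - CI (fun x => (0 + rtail g1 x) * g2 x).
  rewrite -CIN; apply: ae_CI.
  - exact: L1_measurable (L1_tail2 _ _ _).
  - exact: L1_measurable (L1N (L1_tail1 _ _ _)).
  by apply: ae_imp2 f1E g2E => x -> ->; ring.
apply/eqP; rewrite eq_sym -subr_eq0; apply/eqP.
rewrite !mul1r in W1; rewrite !mul0r subr0 in W2; rewrite -W1 E1 E2.
by rewrite -[RHS]W2; ring.
Qed.

(** Here both pairs have the same coefficients, and the identities for [(f1, g2)] and [(g1, f2)]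
    have opposite left sides; their right sides are [CI g2] and [- CI g1]. *)
Lemma CI_reflection (f1 g1 : R -> R[i]) : L1 f1 -> L1 g1 ->
  {ae mu, forall x, f1 x = - r x * rtail g1 x} ->
  {ae mu, forall x, g1 x = w x * (1 + rtail f1 x)} -> CI g1 = CI g2.
Proof.
move=> Lf1 Lg1 f1E g1E.
have W1 := wronskian 1 0 Lf1 Lg2; have W2 := wronskian 0 1 Lg1 Lf2.
have E1 : CI (fun x => (1 + rtail f1 x) * g2 x) = CI (fun x => g1 x * (1 + ltail f2 x)).
  apply: ae_CI.
  - exact: L1_measurable (L1_tail1 _ _ _).
  - exact: L1_measurable (L1_tail2 _ _ _).
  by apply: ae_imp2 g2E g1E => x -> ->; ring.
have E2 : CI (fun x => f1 x * (0 + ltail g2 x)) = CI (fun x => (0 + rtail g1 x) * f2 x).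
  apply: ae_CI.
  - exact: L1_measurable (L1_tail2 _ _ _).
  - exact: L1_measurable (L1_tail1 _ _ _).
  by apply: ae_imp2 f1E f2E => x -> ->; ring.
rewrite !(mul1r, mul0r) ?subr0 ?sub0r in W1 W2.
by rewrite -[RHS]W1 E1 E2 -[LHS]opprK -W2; ring.
Qed.

(* Conservation law [|a_r1|^2 - |a_r3|^2 = 1] of the defocusing case. *)
Lemma defocusing_unitarity : (forall x, w x = - conjc (r x)) ->
  (1 + CI f2) * conjc (1 + CI f2) = 1 + CI g2 * conjc (CI g2).
Proof.
move=> wr; have Lcf := L1_conj Lf2; have Lcg := L1_conj Lg2.
have conj_ltail (f : R -> R[i]) x : L1 f -> conjc (ltail f x) = ltail (fun y => conjc (f y)) x.
  move=> Lf; rewrite /ltail -CI_conj; last exact: L1_ind.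
  by congr CI; apply/funext => z; rewrite conjcM; congr (_ * _); apply: complexP => /=; rewrite ?oppr0.
have cN (z : R[i]) : conjc (- z) = - conjc z by exact: rmorphN.
have rw x : r x = - conjc (w x) by rewrite wr; apply: complexP; rewrite ?(cReN, cImN, Re_conjc, Im_conjc) ?opprK.
have LNf := L1N Lf2; have LNg := L1N Lg2.
have W1 := wronskian (1 + CI f2) 1 LNf Lcf.
have W2 := wronskian (CI g2) 0 LNg Lcg.
(* A left tail is rewritten as a constant plus a right tail, so that [wronskian] can pair the left
   solution with its own conjugate. *)
have RN (f : R -> R[i]) x : L1 f -> CI f + rtail (fun y => - f y) x = ltail f x.
  move=> Lf; rewrite ltailE//; congr (_ + _); rewrite /rtail -CIN.
  by congr CI; apply/funext => y; rewrite mulrN.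
have E1 : CI (fun x => (1 + CI f2 + rtail (fun y => - f2 y) x) * conjc (f2 x)) =
    - CI (fun x => - g2 x * (0 + ltail (fun y => conjc (g2 y)) x)).
  rewrite -CIN; apply: ae_CI.
  - exact: L1_measurable (L1_tail1 _ _ _).
  - exact: L1_measurable (L1N (L1_tail2 _ _ _)).
  apply: ae_imp2 f2E g2E => x f2x g2x; rewrite -addrA RN// f2x g2x conjcM.
  by rewrite -conj_ltail// cN wr; ring.
have E2 : CI (fun x => - f2 x * (1 + ltail (fun y => conjc (f2 y)) x)) =
    - CI (fun x => (CI g2 + rtail (fun y => - g2 y) x) * conjc (g2 x)).
  rewrite -CIN; apply: ae_CI.
  - exact: L1_measurable (L1_tail2 _ _ _).
  - exact: L1_measurable (L1N (L1_tail1 _ _ _)).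
  apply: ae_imp2 f2E g2E => x f2x g2x; rewrite RN// f2x g2x conjcM -conj_ltail//.
  by rewrite rmorphD rmorph1 rw; ring.
rewrite E1 E2 in W1; rewrite !CI_conj// !CIN in W1 W2.
rewrite rmorphD rmorph1.
move: W1 W2; move: (CI (fun x => _ * (0 + _))) (CI (fun x => (CI g2 + _) * _)) => X Y W1 W2.
have -> : (1 + CI f2) * (1 + conjc (CI f2)) = 1 + (Y - X) - ((- X - - Y) - ((1 + CI f2) * conjc (CI f2) - 1 * - CI f2)).
  by ring.
by rewrite W1 W2; ring.
Qed.

End left_right.

End ScatteringIdentities.

(** * The Zakharov-Shabat kernels *)

Section RawKernels.
Context {R : realType}.
Notation mu := (@lebesgue_measure R).
Notation TR := (measurableTypeR R).
Implicit Types (S : R -> set R) (p q : R -> R[i]) (K : R -> R -> R[i]).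

(** Only the values at [y] in [S x] carry information; with the extension by 0 the sections become
    functions on the whole line. *)
Definition cut S K x y : R[i] := Cind (S x : set TR) y * K x y.
Notation rext := (cut half_right).
Notation lext := (cut half_left).

Definition regular_kernel S K : Prop :=
  Cm2 (cut S K) /\ exists C : R, {ae mu, forall x, (L1norm (cut S K x) <= C%:E)%E}.

Lemma Volterra_regular S K :
  measurable [set p : TR * TR | S p.1 p.2] -> (forall x, measurable (S x)) ->
  Volterra_kernel S K -> regular_kernel S K.
Proof.
move=> mS mSx [mK [C KC]]; split.
  by have := Cmeasurable_restrict mS mK; congr Cmeasurable; apply/funext => -[x y].
exists C; apply: ae_imp KC => x; apply: le_trans.
rewrite integral_mkcond le_eqVlt; apply/orP; left; apply/eqP.
apply: eq_integral => y _; rewrite patchE; case: ifPn => [/set_mem|/negP] Sy.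
  by rewrite /cut CindT// mul1r.
rewrite /cut CindF ?mul0r ?Normc.normc0// => h; apply: Sy; exact/mem_set.
Qed.

Lemma rextT K (x y : R) : x <= y -> rext K x y = K x y.
Proof. by move=> xy; rewrite /cut CindT ?mul1r// /half_right/= in_itv/= andbT. Qed.

Lemma rextF K (x y : R) : y < x -> rext K x y = 0.
Proof.
move=> xy; rewrite /cut CindF ?mul0r// /half_right/= in_itv/= andbT.
by apply/negP; rewrite -ltNge.
Qed.

Lemma lextT K (x y : R) : y <= x -> lext K x y = K x y.
Proof. by move=> xy; rewrite /cut CindT ?mul1r// /half_left/= in_itv. Qed.

Lemma lextF K (x y : R) : x < y -> lext K x y = 0.
Proof.
move=> xy; rewrite /cut CindF ?mul0r// /half_left/= in_itv/=.
by apply/negP; rewrite -ltNge.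
Qed.

Lemma rext_regular K : Volterra_kernel half_right K -> regular_kernel half_right K.
Proof.
apply: Volterra_regular => [|x]; last exact: measurable_itv.
rewrite (_ : [set p : TR * TR | _] = (fun p : TR * TR => p.2 - p.1 : TR) @^-1` `[0, +oo[).
  rewrite -[X in measurable X]setTI.
  have : measurable_fun setT (fun p : TR * TR => p.2 - p.1 : TR) by exact: measurable_funB.
  exact.
by apply/seteqP; split => -[x y]; rewrite /half_right/= !in_itv/= !andbT subr_ge0.
Qed.

Lemma lext_regular K : Volterra_kernel half_left K -> regular_kernel half_left K.
Proof.
apply: Volterra_regular => [|x]; last exact: measurable_itv.
rewrite (_ : [set p : TR * TR | _] = (fun p : TR * TR => p.1 - p.2 : TR) @^-1` `[0, +oo[).
  rewrite -[X in measurable X]setTI.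
  have : measurable_fun setT (fun p : TR * TR => p.1 - p.2 : TR) by exact: measurable_funB.
  exact.
by apply/seteqP; split => -[x y]; rewrite /half_left/= !in_itv/= !andbT subr_ge0.
Qed.

Definition reflect K x y : R[i] := K (- x) (- y).

Lemma rext_reflect K x y : rext (reflect K) x y = lext K (- x) (- y).
Proof.
have [xy|yx] := leP x y; first by rewrite rextT// lextT// lerN2.
by rewrite rextF// lextF// ltrN2.
Qed.

Lemma reflect_regular K : regular_kernel half_left K -> regular_kernel half_right (reflect K).
Proof.
move=> [mK [C KC]]; split.
  have mh : measurable_fun setT (fun p : TR * TR => (- p.1, - p.2) : TR * TR).
    by apply: measurable_fun_pair; apply: measurableT_comp.
  have := Cmeasurable_comp mh mK; congr Cmeasurable; apply/funext => -[x y].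
  exact/esym/rext_reflect.
exists C; have := ae_opp KC; apply: ae_imp => x.
rewrite -(L1norm_opp (Cm2_sec1 (- x) mK)); congr (L1norm _ <= _)%E.
apply/funext => y; exact/esym/rext_reflect.
Qed.

Lemma opp_regular S K : regular_kernel S K -> regular_kernel S (fun x y => - K x y).
Proof.
move=> [mK [C KC]]; split.
  have := CmeasurableN mK; congr Cmeasurable; apply/funext => -[x y] /=.
  by rewrite /cut mulrN.
exists C; apply: ae_imp KC => x; congr (_ <= _)%E.
by apply: eq_integral => y _; rewrite /cut mulrN normcN.
Qed.

(** Common form of the three systems: [K] with its components exchanged, [Kbar] with the sign of one
    component changed, [M] reflected. *)
Definition right_system p q K1 K2 : Prop :=
  [/\ regular_kernel half_right K1, regular_kernel half_right K2 &
   {ae mu, forall x, {ae mu, forall y, x <= y ->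
     K1 x y = Cintegral `[x, +oo[ (fun z => p z * K2 z (z + y - x)) /\
     K2 x y = - (2^-1 * q ((x + y) / 2)) -
       Cintegral `[x, (x + y) / 2] (fun z => q z * K1 z (x + y - z))}}].

Definition shift_kernel K x s : R[i] := rext K x (s + x).

(** Put [y = s + x]. For [s < 0] all terms vanish; for [s >= 0] the upper limit [(x + y) / 2] of the
    second integral is encoded by the extended kernel, which is 0 as soon as [z > s / 2 + x]. *)
Lemma volterra_right_system p q K1 K2 : right_system p q K1 K2 ->
  volterra_system p q (shift_kernel K1) (shift_kernel K2).
Proof.
have mshift K : regular_kernel half_right K -> Cm2 (shift_kernel K).
  move=> [mK _]; have mh : measurable_fun setT (fun p : TR * TR => (p.1, p.2 + p.1) : TR * TR).
    by apply: measurable_fun_pair => //; exact: measurable_funD.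
  by have := Cmeasurable_comp mh mK; congr Cmeasurable; apply/funext => -[x y].
have bshift K (C : R) : regular_kernel half_right K ->
    {ae mu, forall x, (L1norm (rext K x) <= C%:E)%E} ->
    {ae mu, forall x, (L1norm (shift_kernel K x) <= C%:E)%E}.
  move=> [mK _]; apply: ae_imp => x.
  by rewrite -(L1norm_shift x (Cm2_sec1 x mK)).
have CIz (f : R -> R[i]) : (forall x, f x = 0) -> CI f = 0.
  by move=> f0; rewrite (_ : f = fun=> 0) ?CI0//; apply/funext.
move=> [r1 r2 E]; split.
- exact: mshift.
- exact: mshift.
- have [_ [C1 H1]] := r1; have [_ [C2 H2]] := r2; exists (Num.max C1 C2); split.
    apply: bshift => //; apply: ae_imp H1 => x /le_trans; apply.
    by rewrite lee_fin le_max lexx.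
  apply: bshift => //; apply: ae_imp H2 => x /le_trans; apply.
  by rewrite lee_fin le_max lexx orbT.
- apply: ae_imp E => x /(ae_shift x); apply: ae_imp => s Es.
  have [s0|s0] := leP 0 s; last first.
    rewrite /shift_kernel rextF ?gtrDr// CIz// => z.
    by rewrite rextF ?gtrDr// mulr0.
  have xs : x <= s + x by rewrite lerDr.
  have [+ _] := Es xs; rewrite /shift_kernel rextT// => ->.
  rewrite Cintegral_ind//; congr CI; apply/funext => z.
  rewrite mulrA rextT ?lerDr//; congr (_ * K2 _ _); ring.
apply: ae_imp E => x /(ae_shift x); apply: ae_imp => s Es.
have [s0|s0] := leP 0 s; last first.
  rewrite /shift_kernel rextF ?gtrDr// CindF/= ?in_itv/= ?andbT; last by apply/negP; rewrite -ltNge.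
  rewrite CIz ?mul0r ?mulr0 ?oppr0 ?addr0// => z.
  have [xz|zx] := leP x z; last first.
    by rewrite CindF ?mul0r//= in_itv/= andbT; apply/negP; rewrite -ltNge.
  by rewrite rextF ?mulr0// gtrDr; lra.
have xs : x <= s + x by rewrite lerDr.
have [_ +] := Es xs; rewrite /shift_kernel rextT// => ->.
have -> : (x + (s + x)) / 2 = s / 2 + x by field.
rewrite CindT/= ?in_itv/= ?s0// mul1r; congr (_ - _).
rewrite Cintegral_ind//; congr CI; apply/funext => z; rewrite mulrA.
have [xz|zx] := leP x z; last first.
  rewrite !CindF ?mul0r//= in_itv/= ?andbT; first by apply/negP; rewrite -ltNge.
  by apply/negP; rewrite leNgt zx.
rewrite [Cind _ z in RHS]CindT/= ?in_itv/= ?xz// mul1r.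
have [zs|sz] := leP z (s / 2 + x).
  rewrite CindT/= ?in_itv/= ?xz// mul1r rextT; last by lra.
  by congr (_ * K1 _ _); ring.
rewrite CindF ?mul0r/= ?in_itv/= ?xz/=; last by apply/negP; rewrite -ltNge.
by rewrite rextF ?mulr0//; lra.
Qed.

Lemma right_system_K u0 v0 Kup Kdn : K_solution u0 v0 Kup Kdn ->
  right_system v0 u0 Kdn Kup.
Proof.
move=> [V1 V2 E]; split; [exact: rext_regular|exact: rext_regular|].
apply: ae_imp E => x; apply: ae_imp => y Exy xy; have [E1 E2] := Exy xy; split.
  by apply/eqP; rewrite -subr_eq0 E2.
by rewrite -E1 addrK.
Qed.

Lemma Cintegral_opposite (D : set R) (f : R -> R[i]) : measurable D ->
  Cintegral D (fun x => - f x) = - Cintegral D f.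
Proof.
move=> mD; rewrite !Cintegral_ind// -CIN.
by congr CI; apply/funext => x; rewrite mulrN.
Qed.

(* Negating [Kdn] brings [Kbar] to the sign pattern of [K]. *)
Lemma right_system_Kbar u0 v0 Kup Kdn : Kbar_solution u0 v0 Kup Kdn ->
  right_system u0 v0 Kup (fun x y => - Kdn x y).
Proof.
move=> [V1 V2 E]; split; [exact: rext_regular|exact/opp_regular/rext_regular|].
apply: ae_imp E => x; apply: ae_imp => y Exy xy; have [E1 E2] := Exy xy; split.
  apply/eqP; rewrite -subr_eq0 -E1; apply/eqP; congr (_ + _).
  by rewrite -Cintegral_opposite//; congr Cintegral; apply/funext => z; rewrite mulrN opprK.
by rewrite -E2; ring.
Qed.

Lemma right_system_M u0 v0 Mup Mdn : L1 u0 -> L1 v0 -> M_solution u0 v0 Mup Mdn ->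
  right_system (fun x => u0 (- x)) (fun x => v0 (- x)) (reflect Mup) (reflect Mdn).
Proof.
move=> Lu Lv [V1 V2 E].
have r1 := lext_regular V1; have r2 := lext_regular V2.
have mu0 := L1_measurable Lu; have mv0 := L1_measurable Lv.
split; [exact: reflect_regular|exact: reflect_regular|].
apply: ae_imp (ae_opp E) => x /ae_opp; apply: ae_imp => y Exy xy.
have [|E1 E2] := Exy; first by rewrite lerN2.
split.
  move/eqP: E1; rewrite subr_eq0 => /eqP; rewrite -[LHS]/(reflect Mup x y) => ->.
  (* [CI_opp] asks for measurability; on the range of integration [Mdn] coincides with its extension
     by 0, which is jointly measurable. *)
  have m : Cm (fun z => Cind (`]-oo, (- x)] : set TR) z * (u0 z * Mdn z (z + - y - - x))).
    have [mM _] := r2.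
    have mh : measurable_fun setT (fun z : TR => (z, z + (- y - - x)) : TR * TR).
      by apply: measurable_fun_pair => //; exact: measurable_funD.
    have := CmeasurableM (Cmeasurable_ind (measurable_itv `]-oo, (- x)])) (CmeasurableM mu0 (Cmeasurable_comp mh mM)).
    congr Cmeasurable; apply/funext => z /=; congr (_ * (_ * _)).
    rewrite -[LHS]/(lext Mdn z (z + (- y - - x))) lextT ?addrA//.
    by lra.
  rewrite !Cintegral_ind// -(CI_opp m); congr CI; apply/funext => z.
  congr (_ * (_ * Mdn _ _)); last by ring.
  by rewrite /Cind !indicE; congr (_%:R%:C); rewrite !mem_setE !in_itv/= andbT lerN2.
have -> : reflect Mdn x y = - (2^-1 * v0 ((- x + - y) / 2)) -
    Cintegral `[(- x + - y) / 2, - x] (fun z => v0 z * Mup z (- x + - y - z)).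
  by rewrite -E2 addrK.
have h : (- x + - y) / 2 = - ((x + y) / 2) by field.
rewrite h; congr (_ - _).
have m : Cm (fun z => Cind (`[(- ((x + y) / 2)), (- x)] : set TR) z * (v0 z * Mup z (- x + - y - z))).
  have [mM _] := r1.
  have mh : measurable_fun setT (fun z : TR => (z, - x + - y - z) : TR * TR).
    by apply: measurable_fun_pair => //; exact: measurable_funB.
  have := CmeasurableM (Cmeasurable_ind (measurable_itv `[(- ((x + y) / 2)), (- x)])) (CmeasurableM mv0 (Cmeasurable_comp mh mM)).
  congr Cmeasurable; apply/funext => z /=.
  have [zD|zD] := pselect (z \in `[(- ((x + y) / 2)), (- x)]); last by rewrite !CindF ?mul0r.
  move: (zD); rewrite in_itv/= => /andP[z1 z2].
  by rewrite lextT//; lra.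
rewrite !Cintegral_ind// -(CI_opp m); congr CI; apply/funext => z.
congr (_ * (_ * Mup _ _)); last by ring.
by rewrite /Cind !indicE; congr (_%:R%:C); rewrite !mem_setE !in_itv/= !lerN2 andbC.
Qed.

End RawKernels.

(** * Scattering data expressed by the extended kernels *)

Section ScatteringData.
Context {R : realType}.
Notation mu := (@lebesgue_measure R).
Notation TR := (measurableTypeR R).
Implicit Types (u v k f : R -> R[i]) (K M : R -> R -> R[i]).
Notation pos := (Cind (`[0, +oo[ : set R)).

Lemma FT_half_kernelN k l : L1 (fun z => pos z * k z) ->
  FT (half_kernel k) l = FT (fun z => pos z * k z) (- l).
Proof.
move=> Lk; rewrite FT_half_kernel// Cintegral_ind//; congr CI; apply/funext => z.
by rewrite mulNr opprK mulrCA.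
Qed.

Lemma L1_dilation v : L1 v -> L1 (fun x => 2^-1 * v (x / 2)).
Proof.
move=> Lv; have h0 : 0 < 2^-1 :> R by rewrite invr_gt0.
apply: L1Zl; have := L1_affine 0 h0 Lv; congr L1; apply/funext => x.
by rewrite addr0 mulrC.
Qed.

Lemma FT_dilation v (l : R) : L1 v ->
  FT (fun x => 2^-1 * v (x / 2)) l = CI (fun y => expi (- (2 * l * y)) * v y).
Proof.
move=> Lv; have h0 : 0 < 2^-1 :> R by rewrite invr_gt0.
have h2 : (2^-1)%:C = 2^-1 :> R[i] by rewrite fmorphV rmorph_nat.
have Lc := L1_expiNM (2 * l) Lv; have La := L1_affine 0 h0 Lc.
rewrite (CI_affine 0 h0 Lc) -CIZl// h2; congr CI; apply/funext => x.
have -> : 2 * l * (2^-1 * x + 0) = l * x by field.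
by rewrite addr0 [x / 2]mulrC mulrCA.
Qed.

Lemma Phi_upE v K z :
  pos z * Phi_up v K z = CI (fun y => v y * shift_kernel K y z).
Proof.
have [z0|z0] := leP 0 z.
  rewrite CindT/= ?in_itv/= ?z0// mul1r; congr CI; apply/funext => y.
  by rewrite /shift_kernel rextT ?lerDr// addrC.
rewrite CindF/= ?in_itv/= ?andbT; last by apply/negP; rewrite -ltNge.
rewrite mul0r -[LHS]CI0; congr CI; apply/funext => y.
by rewrite /shift_kernel rextF ?gtrDr// mulr0.
Qed.

Lemma Psi_dnE u M z : L1 u -> Volterra_kernel half_left M ->
  pos z * Psi_dn u M z = CI (fun y => u (- y) * shift_kernel (reflect M) y z).
Proof.
move=> Lu /lext_regular[mM _].
have [z0|z0] := leP 0 z; last first.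
  rewrite CindF/= ?in_itv/= ?andbT; last by apply/negP; rewrite -ltNge.
  rewrite mul0r -[LHS]CI0; congr CI; apply/funext => y.
  by rewrite /shift_kernel rextF ?gtrDr// mulr0.
have m : Cm (fun y => u y * cut half_left M y (y - z)).
  have mh : measurable_fun setT (fun y : TR => (y, y - z) : TR * TR).
    by apply: measurable_fun_pair => //; exact: measurable_funB.
  exact: CmeasurableM (L1_measurable Lu) (Cmeasurable_comp mh mM).
rewrite CindT/= ?in_itv/= ?z0// mul1r.
transitivity (CI (fun y => u y * cut half_left M y (y - z))).
  by congr CI; apply/funext => y; rewrite lextT// gerBl.
rewrite -(CI_opp m); congr CI; apply/funext => y.
by rewrite /shift_kernel rext_reflect; congr (_ * cut half_left M _ _); ring.
Qed.

(** The upper limit [z / 2] is encoded by the extension, since the kernel at [(y, z - y)] is cut off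
    when [z - y < y]. *)
Lemma Phibar_upE v K z :
  Phibar_up v K z = CI (fun y => v y * shift_kernel K y (z - 2 * y)).
Proof.
rewrite /Phibar_up Cintegral_ind//; congr CI; apply/funext => y.
rewrite mulrCA /shift_kernel; congr (_ * _).
have -> : z - 2 * y + y = z - y by ring.
have [yz|zy] := leP y (z / 2).
  by rewrite CindT/= ?in_itv//= mul1r rextT//; lra.
by rewrite CindF/= ?in_itv/= ?mul0r ?rextF//; [lra|apply/negP; rewrite -ltNge].
Qed.

(** The substitution [y -> - y] makes the left kernel a right one and replaces [z] by [- z]; the
    transform at [l] thus becomes one at [- l]. *)
Lemma Psi_upE v M z : L1 v -> Volterra_kernel half_left M ->
  Psi_up v M z = CI (fun y => v (- y) * shift_kernel (reflect M) y (- z - 2 * y)).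
Proof.
move=> Lv /lext_regular[mM _].
have m : Cm (fun y => v y * cut half_left M y (z - y)).
  have mh : measurable_fun setT (fun y : TR => (y, z - y) : TR * TR).
    by apply: measurable_fun_pair => //; exact: measurable_funB.
  exact: CmeasurableM (L1_measurable Lv) (Cmeasurable_comp mh mM).
transitivity (CI (fun y => v y * cut half_left M y (z - y))).
  rewrite /Psi_up Cintegral_ind//; congr CI; apply/funext => y.
  rewrite mulrCA; congr (_ * _); have [zy|yz] := leP (z / 2) y.
    by rewrite CindT/= ?in_itv/= ?zy// mul1r lextT//; lra.
  by rewrite CindF/= ?in_itv/= ?mul0r ?lextF ?andbT//; [lra|apply/negP; rewrite -ltNge].
rewrite -(CI_opp m); congr CI; apply/funext => y.
by rewrite /shift_kernel rext_reflect; congr (_ * cut half_left M _ _); ring.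
Qed.

End ScatteringData.

(** * Reduction of both Fredholm equations to the scattering data of [M] *)

Theorem theorem4p1 (R : realType) (u0 v0 : R -> R[i])
    (Kbarup Kbardn Kup Kdn Mup Mdn : R -> R -> R[i])
    (u0_L1 : Cintegrable setT u0)
    (Kbar_sol : Kbar_solution u0 v0 Kbarup Kbardn)
    (K_sol : K_solution u0 v0 Kup Kdn)
    (M_sol : M_solution u0 v0 Mup Mdn)
    (* In the focusing case the quotient defining the reflection coefficient
       must have a nonvanishing denominator (no spectral singularities); in the
       defocusing case this is automatic. *)
    (focusing_or_defocusing :
      ((forall x, v0 x = conjc (u0 x)) /\
       (forall lambda : R, a_r1 u0 Mdn lambda != 0)) \/
      (forall x, v0 x = - conjc (u0 x))) :
  let rho := inverse_fourier (reflection_right u0 v0 Mup Mdn) in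
  unique_Fredholm_solution (Phi_up v0 Kup)
    (fun alpha => - (2^-1 * v0 (alpha / 2)) - Phibar_up v0 Kbarup alpha) rho /\
  unique_Fredholm_solution (Psi_dn u0 Mdn)
    (fun alpha => - (2^-1 * v0 (alpha / 2)) - Psi_up v0 Mup alpha) rho.
Proof.
have Lu : L1 u0 := u0_L1.
have Lv : L1 v0.
  case: focusing_or_defocusing => [[vE _]|vE]; move/funext: vE => ->.
    exact: L1_conj.
  by apply: L1N; exact: L1_conj.
have Lu' := L1_opp Lu; have Lv' := L1_opp Lv.
have [VM1 VM2 _] := M_sol.
have SK := volterra_right_system (right_system_K K_sol).
have SB := volterra_right_system (right_system_Kbar Kbar_sol).
have SM := volterra_right_system (right_system_M Lu Lv M_sol).
have PhiE := funext (Phi_upE v0 Kup).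
have PsiE := funext (fun z => Psi_dnE z Lu VM2).
have PhibE := funext (Phibar_upE v0 Kbarup).
have PsiuE := funext (fun z => Psi_upE z Lv VM1).
have LPhi : L1 (fun z => Cind (`[0, +oo[ : set R) z * Phi_up v0 Kup z).
  rewrite PhiE; exact: L1_Phi Lv SK.
have LPsi : L1 (fun z => Cind (`[0, +oo[ : set R) z * Psi_dn u0 Mdn z).
  rewrite PsiE; exact: L1_Phi Lu' SM.
have LPhib : L1 (Phibar_up v0 Kbarup) by rewrite PhibE; exact: L1_Theta Lv SB.
have LPsiu : L1 (Psi_up v0 Mup) by rewrite PsiuE; exact: L1_opp (L1_Theta Lv' SM).
have Ld := L1_dilation Lv.
(* The pair of the reflected system, reflected back to a left pair. Since [x -> - x] reverses
   phases, it is evaluated at [- l]. *)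
pose f l x := hatf (fun x => u0 (- x)) (shift_kernel (reflect Mdn)) (- l) (- x).
pose g l x := hatg (fun x => v0 (- x)) (shift_kernel (reflect Mup)) (- l) (- x).
have Lf l : L1 (f l) := L1_opp (L1_hatf (- l) Lu' SM).
have Lg l : L1 (g l) := L1_opp (L1_hatg (- l) Lv' SM).
have CIf l : CI (f l) = CI (hatf (fun x => u0 (- x)) (shift_kernel (reflect Mdn)) (- l)).
  by rewrite CI_opp//; exact: L1_measurable (L1_hatf (- l) Lu' SM).
have CIg l : CI (g l) = CI (hatg (fun x => v0 (- x)) (shift_kernel (reflect Mup)) (- l)).
  by rewrite CI_opp//; exact: L1_measurable (L1_hatg (- l) Lv' SM).
(* The potentials with the free phases absorbed: these are the coefficients [w] and [r] of the left
   pair [(f l, g l)]. *)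
pose w l x := v0 x * expi (- (2 * l * x)).
pose r l x := u0 x * expi (2 * l * x).
have fE l : {ae lebesgue_measure, forall x, f l x = - r l x * ltail (g l) x}.
  have := ae_opp (ae_hatf (- l) Lv' SM); apply: ae_imp => x; rewrite /f => ->.
  rewrite ltail_opp; last exact: L1_hatg Lv' SM.
  by rewrite opprK; congr (- (_ * expi _) * _); ring.
have gE l : {ae lebesgue_measure, forall x, g l x = w l x * (1 + ltail (f l) x)}.
  have := ae_opp (ae_hatg (- l) Lu' SM); apply: ae_imp => x; rewrite /g => ->.
  rewrite ltail_opp; last exact: L1_hatf Lu' SM.
  by rewrite opprK; congr (_ * expi _ * _); ring.
have r1E l : 1 + FT (half_kernel (Psi_dn u0 Mdn)) l = 1 + CI (f l).
  by rewrite FT_half_kernelN// CIf PsiE (FT_Phi (- l) Lu' SM).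
(* This is [a_l4 = a_r1]: at [- l] the system of [K] has first coefficient [w l] and second
   coefficient [r l], the exchange that [CI_transmission] expects. *)
have r1E' l : 1 + FT (half_kernel (Phi_up v0 Kup)) l = 1 + CI (f l).
  rewrite FT_half_kernelN// PhiE (FT_Phi (- l) Lv SK); congr (1 + _).
  apply: (CI_transmission (Lf l) (Lg l) (fE l) (gE l) (L1_hatf (- l) Lv SK)
    (L1_hatg (- l) Lu SK)).
    apply: ae_imp (ae_hatf (- l) Lu SK) => x ->.
    by congr (- (_ * expi _) * _); ring.
  apply: ae_imp (ae_hatg (- l) Lv SK) => x ->.
  by congr (_ * expi _ * _); ring.
have CI_v l : CI (fun y => expi (- (2 * l * y)) * v0 y) = CI (fun y => expi (- (2 * - l * y)) * v0 (- y)).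
  rewrite -(CI_opp (L1_measurable (L1_expiNM (2 * l) Lv))).
  by congr CI; apply/funext => y; congr (expi _ * _); ring.
have FTpsi l : CI (fun y => expi (- (2 * l * y)) * v0 y) + FT (Psi_up v0 Mup) l = CI (g l).
  have E : FT (Psi_up v0 Mup) l =
      FT (fun s => CI (fun y => v0 (- y) * shift_kernel (reflect Mup) y (s - 2 * y))) (- l).
    rewrite /FT -(CI_opp (L1_measurable (L1_expiNM l LPsiu))) PsiuE.
    by congr CI; apply/funext => z; rewrite opprK mulNr mulrN.
  by rewrite CI_v E (FT_Theta (- l) Lv' SM) CIg.
(* This is [a_l3 = - a_r3]: at [l] the system of [Kbar] has the same coefficients as the left pair,
   so [CI_reflection] applies. *)
have FTphi l : CI (fun y => expi (- (2 * l * y)) * v0 y) + FT (Phibar_up v0 Kbarup) l = CI (g l).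
  rewrite PhibE (FT_Theta l Lv SB).
  apply: (CI_reflection (Lf l) (Lg l) (fE l) (gE l) (L1_hatf l Lu SB) (L1_hatg l Lv SB)).
    exact: ae_hatf Lv SB.
  exact: ae_hatg Lu SB.
have a1E l : a_r1 u0 Mdn l = 1 + CI (f l) by rewrite -r1E FT_half_kernel.
have a3E l : a_r3 v0 Mup l = - CI (g l).
  rewrite -FTpsi opprD /a_r3; congr (- CI _ - _).
  by apply/funext => y; congr (expi _ * _); ring.
(* In the defocusing case [w l = - conjc (r l)], and a zero would turn the conservation law into
   [0 = 1 + |CI (g l)|^2]. *)
have nz l : 1 + CI (f l) != 0.
  rewrite -a1E; case: focusing_or_defocusing => [[_]//|vE].
  apply/eqP => a0; have wr x : w l x = - conjc (r l x).
    by rewrite /w /r vE conjcM conj_expi mulNr.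
  have := defocusing_unitarity (Lf l) (Lg l) (fE l) (gE l) wr.
  rewrite -a1E a0 mul0r mul_conjc => /(congr1 (@complex.Re R)).
  rewrite cReD cReC /= => /esym/eqP; rewrite gt_eqF// ltr_pwDl// sqr_ge0.
(* The two equations differ only in [k] and [h]. In both, the right side has transform [- CI (g l)],
   which is [a_r3], and the symbol [1 + CI (f l)] is [a_r1]. *)
have solve k h : L1 (fun z => Cind (`[0, +oo[ : set R) z * k z) -> L1 h ->
    (forall l, 1 + FT (half_kernel k) l = 1 + CI (f l)) ->
    (forall l, CI (fun y => expi (- (2 * l * y)) * v0 y) + FT h l = CI (g l)) ->
    unique_Fredholm_solution k (fun alpha => - (2^-1 * v0 (alpha / 2)) - h alpha)
      (inverse_fourier (reflection_right u0 v0 Mup Mdn)).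
  move=> Lk Lh kE hE; have LN := L1B (L1N Ld) Lh.
  have kn l : 1 + FT (half_kernel k) l != 0 by rewrite kE.
  have := Fredholm_inverse_fourier Lk LN kn.
  congr (unique_Fredholm_solution _ _ (inverse_fourier _)); apply/funext => l.
  rewrite /reflection_right a1E a3E kE; congr (_ / _).
  rewrite -hE opprD (FTB l (L1N Ld) Lh) FTN (FT_dilation l Lv)//.
by split; exact: solve.
Qed.
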